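(* Let $X$ be a complex manifold of dimension $n\ge 2$, $U\subset X$ a domain, and $\rho:U\to\mathbb{R}$ a smooth, strictly plurisubharmonic Morse function. Let $t_0\in\mathbb{R}$ be such that the level set $\Sigma_{t_0}=\{x\in U:\rho(x)=t_0\}$ is connected and compact, and assume that either $\Sigma_{t_0}$ contains no critical point of $\rho$ (''$\Sigma_{t_0}$ is smooth'') or it contains exactly one critical point $c$ of $\rho$. Let $\mathcal{N}$ be a holomorphic line bundle on $U$ and let $\mathcal{F}$ be a $k$-th root of $\mathcal{N}$ on $U_{t_0}^{+}=\{x\in U:\rho(x)>t_0\}$. Suppose that one of the following holds: (a) $\Sigma_{t_0}$ is smooth; (b) $n\ge 3$ and the Morse index $\mathrm{ind}\,\rho|_{c}$ is arbitrary; (c) $n=2$ and $\mathrm{ind}\,\rho|_{c}\neq 2$. Then $\mathcal{F}$ extends to a holomorphic line bundle to a neighborhood of $\Sigma_{t_0}$ and stays there to be a $k$-th root of $\mathcal{N}$; that is, there are an open neighborhood $V\subset U$ of $\Sigma_{t_0}$ and a holomorphic line bundle $\widetilde{\mathcal{F}}$ on $U_{t_0}^{+}\cup V$ such that $\widetilde{\mathcal{F}}|_{U_{t_0}^{+}}\cong\mathcal{F}$ and $\widetilde{\mathcal{F}}^{\otimes k}\cong\mathcal{N}|_{U_{t_0}^{+}\cup V}$.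
   Context: A $k$-th root of a holomorphic line bundle $\mathcal{N}$ on an open set $G$ is a holomorphic line bundle $\mathcal{F}$ on $G$ with $\mathcal{F}^{\otimes k}\cong\mathcal{N}|_{G}$. A holomorphic bundle $\mathcal{F}$ on $Y$ extends to $\widetilde Y\supset Y$ if there is a holomorphic bundle $\widetilde{\mathcal{F}}$ on $\widetilde Y$ together with an isomorphism $\widetilde{\mathcal{F}}|_{Y}\to\mathcal{F}$. $\mathrm{ind}\,\rho|_{c}$ denotes the Morse index of $\rho$ at the critical point $c$ (for strictly plurisubharmonic $\rho$ one has $0\le \mathrm{ind}\,\rho|_{c}\le n$). *)

(* Defs.v *)
From HB Require Import structures.
From mathcomp Require Import all_boot all_order all_algebra.
From mathcomp Require Import all_classical all_reals all_analysis.
From mathcomp Require Import complex.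
Set Implicit Arguments.
Unset Strict Implicit.
Unset Printing Implicit Defensive.
Import Order.TTheory GRing.Theory Num.Theory.
Import numFieldNormedType.Exports.
Local Open Scope classical_set_scope.
Local Open Scope ring_scope.

(* Folded as a [numClosedFieldType] so that the generic norm and topology
   instances on numeric fields apply to it. *)
Definition C (R : realType) : numClosedFieldType := R[i].

Record chart (R : realType) (n : nat) (X : topologicalType) := Chart {
  chart_dom : set X;
  chart_map :> X -> 'rV[C R]_n;
  chart_inv : 'rV[C R]_n -> X;
  chart_dom_open : open chart_dom;
  chart_im_open : open (chart_map @` chart_dom);
  chart_mapK : forall x, chart_dom x -> chart_inv (chart_map x) = x;
  chart_map_continuous : {within chart_dom, continuous chart_map};
  chart_inv_continuous :
    {within chart_map @` chart_dom, continuous chart_inv}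
}.

(* [differentiable] is over the scalar field [C R], i.e. complex (Frechet)
   differentiability on an open subset of C^n. *)
Record complex_manifold (R : realType) (n : nat) := ComplexManifold {
  cm_space :> topologicalType;
  cm_hausdorff : hausdorff_space cm_space;
  cm_second_countable : @second_countable cm_space;
  cm_index : Type;
  cm_chart : cm_index -> chart R n cm_space;
  cm_cover : forall x, exists i, chart_dom (cm_chart i) x;
  cm_compatible : forall i j z,
    (cm_chart i @` (chart_dom (cm_chart i) `&` chart_dom (cm_chart j))) z ->
    differentiable (cm_chart j \o chart_inv (cm_chart i)) z
}.

Definition is_domain (X : topologicalType) (U : set X) : Prop :=
  [/\ open U, connected U & U !=set0].

Section SmoothFunctions.
Variables (R : realType) (m : nat).
Implicit Types (f : 'rV[R]_m -> R) (D : set 'rV[R]_m).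

Definition partial (i : 'I_m) f : 'rV[R]_m -> R :=
  fun x => 'D_(delta_mx 0 i) (f : 'rV[R]_m -> R^o) x.

Fixpoint Ck_on (k : nat) D f : Prop :=
  (forall x, D x -> {for x, continuous f}) /\
  (if k is k'.+1 then
     (forall x i, D x -> derivable (f : 'rV[R]_m -> R^o) x (delta_mx 0 i)) /\
     (forall i, Ck_on k' D (partial i f))
   else True).

Definition smooth_on D f : Prop := forall k, Ck_on k D f.

Definition hessian f (x : 'rV[R]_m) : 'M[R]_m :=
  \matrix_(i, j) partial i (partial j f) x.

(* Index of a symmetric bilinear form: the largest dimension of a subspace on
   which the form is negative definite. *)
Definition neg_index (H : 'M[R]_m) : nat :=
  \max_(d < m.+1 | `[< exists W : {vspace 'rV[R]_m}, \dim W = d /\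
     forall v, v \in W -> v != 0 -> (v *m H *m v^T) 0 0 < 0 >]) d.

End SmoothFunctions.

Section RealCoordinates.
Variables (R : realType) (n : nat).

(* C^n = R^(2n): the first n real coordinates are the real parts x_j, the last
   n the imaginary parts y_j. *)
Definition cplx_of_real (x : 'rV[R]_(n + n)) : 'rV[C R]_n :=
  \row_j (x 0 (lshift n j) +i* x 0 (rshift n j))%C.

Definition real_of_cplx (z : 'rV[C R]_n) : 'rV[R]_(n + n) :=
  row_mx (\row_j complex.Re (z 0 j)) (\row_j complex.Im (z 0 j)).

(* The matrix d^2 f / dz_j d\bar z_k, expanded from
   d/dz_j = (d/dx_j - i d/dy_j) / 2 and d/d\bar z_k = (d/dx_k + i d/dy_k) / 2. *)
Definition levi_mx (f : 'rV[R]_(n + n) -> R) (x : 'rV[R]_(n + n)) :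
    'M[C R]_n :=
  let d2 a b := partial a (partial b f) x in
  \matrix_(j, k) (4^-1 *
    ((d2 (lshift n j) (lshift n k) + d2 (rshift n j) (rshift n k)) +i*
     (d2 (lshift n j) (rshift n k) - d2 (rshift n j) (lshift n k)))%C).

End RealCoordinates.

Section FunctionsOnManifolds.
Variables (R : realType) (n : nat) (M : complex_manifold R n).

Definition holomorphic_on (S : set M) (g : M -> C R) : Prop :=
  forall (i : cm_index M) z,
    (cm_chart i @` (chart_dom (cm_chart i) `&` S)) z ->
    differentiable (g \o chart_inv (cm_chart i) : 'rV[C R]_n -> (C R)^o) z.

Variable rho : M -> R.

Definition in_chart (i : cm_index M) : 'rV[R]_(n + n) -> R :=
  fun x => rho (chart_inv (cm_chart i) (cplx_of_real x)).

Definition coords (i : cm_index M) (p : M) : 'rV[R]_(n + n) :=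
  real_of_cplx (cm_chart i p).

(* [rho] and [U] pulled back to R^(2n) by the chart [i]; only the values of
   [rho] on [U] matter. *)
Definition smooth_fun (U : set M) : Prop :=
  forall i, smooth_on
    [set x | (cm_chart i @` (chart_dom (cm_chart i) `&` U)) (cplx_of_real x)]
    (in_chart i).

Definition strictly_psh (U : set M) : Prop :=
  forall i p, chart_dom (cm_chart i) p -> U p ->
  forall w : 'rV[C R]_n, w != 0 ->
  0 < \sum_j \sum_k levi_mx (in_chart i) (coords i p) j k
                    * w 0 j * (w 0 k)^*.

Definition critical_point (p : M) : Prop :=
  forall i, chart_dom (cm_chart i) p ->
  forall a, partial a (in_chart i) (coords i p) = 0.

Definition morse_fun (U : set M) : Prop :=
  forall p, U p -> critical_point p ->
  forall i, chart_dom (cm_chart i) p ->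
  hessian (in_chart i) (coords i p) \in unitmx.

(* At a critical point the index of the Hessian does not depend on the chart;
   an arbitrary one around [p] is chosen. *)
Definition morse_index (p : M) : nat :=
  let i := sval (cid (cm_cover p)) in
  neg_index (hessian (in_chart i) (coords i p)).

End FunctionsOnManifolds.

(* A holomorphic line bundle on the open set [G]: a family of complex vector
   spaces with local trivialisations, fibrewise linear isomorphisms onto C,
   whose transition functions are holomorphic; these determine the complex
   structure of the total space.  Fibres outside [G] are irrelevant. *)
Record line_bundle (R : realType) (n : nat) (M : complex_manifold R n)
    (G : set M) := LineBundle {
  lb_fiber :> M -> vectType (C R);
  lb_index : Type;
  lb_dom : lb_index -> set M;
  lb_triv : lb_index -> forall x, 'Hom(lb_fiber x, (C R)^o);
  lb_dom_open : forall a, open (lb_dom a);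
  lb_cover : \bigcup_a lb_dom a = G;
  lb_triv_bij : forall a x, lb_dom a x -> bijective (lb_triv a x);
  lb_transition : forall a b, exists2 g : M -> C R,
    holomorphic_on (lb_dom a `&` lb_dom b) g &
    forall x, lb_dom a x -> lb_dom b x -> lb_triv b x = g x *: lb_triv a x
}.

(* The restrictions of [E] and [F] to an open set [S] contained in both bases
   are isomorphic as holomorphic line bundles. *)
Definition lb_iso_on (R : realType) (n : nat) (M : complex_manifold R n)
    (S G1 G2 : set M) (E : line_bundle G1) (F : line_bundle G2) : Prop :=
  exists h : forall x, 'Hom(E x, F x),
    (forall x, S x -> bijective (h x)) /\
    forall (a : lb_index E) (b : lb_index F), exists2 g : M -> C R,
      holomorphic_on (S `&` (lb_dom a `&` lb_dom b)) g &
      forall x, S x -> lb_dom a x -> lb_dom b x ->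
        (lb_triv b x \o h x)%VF = g x *: lb_triv a x.

Section Tensor.
Variables (R : realType) (n : nat) (M : complex_manifold R n) (G : set M).

Lemma holomorphic_onS (S S' : set M) (g : M -> C R) :
  S' `<=` S -> holomorphic_on S g -> holomorphic_on S' g.
Proof.
by move=> SS' hg i z [x [dx Sx] <-]; apply: hg; exists x => //; split=> //; apply: SS'.
Qed.

Lemma holomorphic_on_cst (S : set M) (c : C R) : holomorphic_on S (fun=> c).
Proof. by move=> i z _; exact: differentiable_cst. Qed.

Lemma holomorphic_onM (S : set M) (g h : M -> C R) :
  holomorphic_on S g -> holomorphic_on S h ->
  holomorphic_on S (fun x => g x * h x).
Proof.
move=> hg hh i z Sz; have := hg i z Sz; have := hh i z Sz.
move=> dh dg; exact: (differentiableM dg dh).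
Qed.

Lemma lb_open (E : line_bundle G) : open G.
Proof. by rewrite -(lb_cover E); apply: bigcup_open => a _; exact: lb_dom_open. Qed.

Section Trivial.
Hypothesis openG : open G.

Lemma trivial_cover : \bigcup_(a : unit) G = G.
Proof. by apply/seteqP; split=> [x [] //|x Gx]; exists tt. Qed.

Lemma trivial_bij (a : unit) (x : M) :
  G x -> bijective (\1%VF : 'Hom((C R)^o, (C R)^o)).
Proof. by move=> _; exists id => v; rewrite id_lfunE. Qed.

Lemma trivial_transition (a b : unit) : exists2 g : M -> C R,
  holomorphic_on (G `&` G) g &
  forall x, G x -> G x ->
    \1%VF = g x *: \1%VF :> 'Hom((C R)^o, (C R)^o).
Proof.
exists (fun=> 1); first exact: holomorphic_on_cst.
by move=> x _ _; rewrite scale1r.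
Qed.

Definition lb_trivial : line_bundle G :=
  @LineBundle R n M G (fun=> (C R)^o) unit (fun=> G) (fun _ _ => \1%VF)
    (fun=> openG) trivial_cover trivial_bij trivial_transition.

End Trivial.

Section TensorProduct.
Variables E F : line_bundle G.

(* The (canonical, finite-dimensional) model Hom(E_x^*, F_x) of E_x (x) F_x,
   in which u (x) v is the map alpha |-> alpha(u) v. *)
Definition tensor_fiber (x : M) : vectType (C R) :=
  'Hom('Hom(E x, (C R)^o), F x).

(* s (x) t : E_x (x) F_x -> C, with (s (x) t)(u (x) v) = s(u) t(v). *)
Definition tensor_triv (x : M) (s : 'Hom(E x, (C R)^o)) (t : 'Hom(F x, (C R)^o)) :
    'Hom(tensor_fiber x, (C R)^o) :=
  linfun (fun T : 'Hom('Hom(E x, (C R)^o), F x) => t (T s)).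

Lemma tensor_trivE (x : M) (s : 'Hom(E x, (C R)^o)) (t : 'Hom(F x, (C R)^o)) T :
  tensor_triv s t T = t (T s).
Proof.
have lin : linear (fun T : 'Hom('Hom(E x, (C R)^o), F x) => t (T s)).
  by move=> c T1 T2; rewrite add_lfunE scale_lfunE linearP.
pose L := GRing.isLinear.Build _ _ _ _
  (fun T : 'Hom('Hom(E x, (C R)^o), F x) => t (T s)) lin.
pose f : {linear _ -> _} := HB.pack
  (fun T : 'Hom('Hom(E x, (C R)^o), F x) => t (T s)) L.
exact: (lfunE f).
Qed.

Lemma tensor_triv_bij (x : M) (s : 'Hom(E x, (C R)^o)) (t : 'Hom(F x, (C R)^o)) :
  bijective s -> bijective t -> bijective (tensor_triv s t).
Proof.
move=> [s' sK s'K] [t' tK t'K].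
have t'0 : t' 0 = 0 by rewrite -(linear0 t) tK.
pose u (v : F x) := linfun (fun alpha : 'Hom(E x, (C R)^o) => alpha (s' 1) *: v).
have uE v alpha : u v alpha = alpha (s' 1) *: v.
  have lin : linear (fun alpha : 'Hom(E x, (C R)^o) => alpha (s' 1) *: v).
    move=> c a1 a2; rewrite add_lfunE scale_lfunE scalerDl.
    by congr (_ + _); rewrite scalerA.
  pose L := GRing.isLinear.Build _ _ _ _
    (fun alpha : 'Hom(E x, (C R)^o) => alpha (s' 1) *: v) lin.
  pose f : {linear _ -> _} := HB.pack
    (fun alpha : 'Hom(E x, (C R)^o) => alpha (s' 1) *: v) L.
  exact: (lfunE f).
have dualE (alpha : 'Hom(E x, (C R)^o)) : alpha = alpha (s' 1) *: s.
  apply/lfunP => w; rewrite scale_lfunE -{1}(sK w).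
  have -> : s' (s w) = s w *: s' 1.
    by rewrite -[RHS]sK linearZ/= s'K /GRing.scale/= mulr1.
  by rewrite linearZ/= /GRing.scale/= mulrC.
exists (fun c => u (t' c)) => [T|c].
  apply/lfunP => alpha; rewrite tensor_trivE uE tK.
  by rewrite [in RHS](dualE alpha) linearZ.
by rewrite tensor_trivE uE s'K scale1r t'K.
Qed.

Let tdom (a : lb_index E * lb_index F) : set M :=
  lb_dom a.1 `&` lb_dom a.2.

Lemma tensor_dom_open a : open (tdom a).
Proof. by apply: openI; exact: lb_dom_open. Qed.

Lemma tensor_cover : \bigcup_a tdom a = G.
Proof.
apply/seteqP; split=> [x [a _ [ax _]]|x Gx].
  by rewrite -(lb_cover E); exists a.1.
have := Gx; rewrite -{1}(lb_cover E) => -[a _ ax].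
have := Gx; rewrite -{1}(lb_cover F) => -[b _ bx].
by exists (a, b).
Qed.

Lemma tensor_bij a x : tdom a x ->
  bijective (tensor_triv (lb_triv a.1 x) (lb_triv a.2 x)).
Proof. by move=> [ax bx]; apply: tensor_triv_bij; exact: lb_triv_bij. Qed.

Lemma tensor_transition a b : exists2 g : M -> C R,
  holomorphic_on (tdom a `&` tdom b) g &
  forall x, tdom a x -> tdom b x ->
    tensor_triv (lb_triv b.1 x) (lb_triv b.2 x) =
      g x *: tensor_triv (lb_triv a.1 x) (lb_triv a.2 x).
Proof.
have [g hg gE] := lb_transition a.1 b.1.
have [h hh hE] := lb_transition a.2 b.2.
exists (fun x => g x * h x).
  apply: holomorphic_onM.
    by apply: holomorphic_onS hg => x [[? _] [? _]].
  by apply: holomorphic_onS hh => x [[_ ?] [_ ?]].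
move=> x [a1 a2] [b1 b2]; apply/lfunP => T.
rewrite scale_lfunE !tensor_trivE gE// hE// scale_lfunE linearZ/= linearZ/=.
by rewrite /GRing.scale/= mulrCA mulrA.
Qed.

Definition lb_tensor : line_bundle G :=
  LineBundle tensor_dom_open tensor_cover tensor_bij tensor_transition.

End TensorProduct.

Fixpoint lb_power (k : nat) (F : line_bundle G) : line_bundle G :=
  if k is k'.+1 then lb_tensor F (lb_power k' F) else lb_trivial (lb_open F).

End Tensor.

(* [F], on [G], is a [k]-th root of the restriction to [G] of [N]; here [N] is
   given on some [G'] containing [G]. *)
Definition is_kth_root (R : realType) (n : nat) (M : complex_manifold R n)
    (G G' : set M) (k : nat) (F : line_bundle G) (N : line_bundle G') : Prop :=
  lb_iso_on G (lb_power k F) N.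

Definition level_set (X : Type) (R : realType) (U : set X) (rho : X -> R)
    (t : R) : set X := [set x | U x /\ rho x = t].

Definition superlevel_set (X : Type) (R : realType) (U : set X) (rho : X -> R)
    (t : R) : set X := [set x | U x /\ t < rho x].

(* Main.v *)
Require Import Defs.
From HB Require Import structures.
From mathcomp Require Import all_boot all_order all_algebra.
From mathcomp Require Import all_classical all_reals all_analysis.
From mathcomp Require Import complex ring lra zify.
Import Order.TTheory GRing.Theory Num.Theory.
Import numFieldNormedType.Exports.
Local Open Scope classical_set_scope.
Local Open Scope ring_scope.
Set Implicit Arguments.
Unset Strict Implicit.

(** Extending a [k]-th root of a line bundle across a level set is a topological
    problem. Over an open set where [N] is trivialised by a frame [b], call a frame
    of [F] flat if its [k]-th power is [b]. Flat frames exist locally, and two of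
    them differ locally by a [k]-th root of unity: they form a local system of
    rank one. If this system has a section over the part above the level set of a
    neighbourhood of a point, that section is a frame of [F] to be used for the
    extension; the transition function between two such frames is a continuous
    [k]-th root of a transition function of [N], and it extends across the level
    set, uniquely if the part of small neighbourhoods above the level set is
    connected. Continuous roots of holomorphic functions are holomorphic, so the
    extended cocycle is holomorphic ([hol_root]).

    Hence two facts are needed about the sets [W `&` P], where [P] is the
    superlevel set and [W] runs through a basis of neighbourhoods of a point of
    the level set: they are connected and local systems over them have global
    sections ([tame]). Both properties hold for star-shaped open sets
    ([star_monodromy_free]), because a section can be continued along thin convex
    tubes around the segments from the centre, and they pass to a union of sets
    whose pairwise intersections are connected and whose triple intersections are
    nonempty ([monodromy_free_bigcup]).

    At a noncritical point small balls work: their part above the level is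
    star-shaped ([submersion_monodromy_free]). At a critical point, linear
    coordinates turn the Hessian into a sum of squares with signs. Strict
    plurisubharmonicity makes the Hessian positive on average over every complex
    line, so a negative definite subspace has real dimension at most [n]
    ([neg_def_dim]); under each of the assumptions on the dimension and the index
    at least three squares are positive ([psh_signature]). The part of a ball above
    the level is then a union of sets cut out by cones in the positive directions
    around the vertices of a simplex; each of them, and each intersection of two,
    is star-shaped, and any three of them whose indices include a fixed one meet
    as soon as there are three positive directions ([saddle_monodromy_free]). This
    replaces the homotopy equivalence with a sphere, and it needs only a second
    order Taylor estimate ([strict_second_order]).

    The gluing ([extend_frames]) uses the compactness of the level set: finitely
    many frames and finitely many extensions of transition functions are chosen;
    they are compatible at the points of the level set by continuity, hence in a
    neighbourhood of it. Choosing a basis vector in each fibre turns all bundles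
    into families of scalar functions, and the extended bundle is built from such
    a family ([kth_root_extension]). *)

(** * Roots of complex numbers *)

Section Roots.
Variable K : numClosedFieldType.

Lemma cvg_exprn (T : Type) (F : set_system T) (FF : Filter F) (f : T -> K) (a : K) k :
  f x @[x --> F] --> a -> f x ^+ k @[x --> F] --> a ^+ k.
Proof.
move=> fa; elim: k => [|k IH]; first by under eq_fun do rewrite expr0; exact: cvg_cst.
by under eq_fun do rewrite exprS; rewrite exprS; apply: cvgM.
Qed.

Lemma geom_sum_diag (k : nat) (z : K) : (0 < k)%N -> z != 0 ->
  \sum_(i < k) z ^+ (k.-1 - i) * z ^+ i != 0.
Proof.
move=> k0 zn0.
have -> : \sum_(i < k) z ^+ (k.-1 - i) * z ^+ i = \sum_(i < k) z ^+ k.-1.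
  by apply: eq_bigr => i _; rewrite -exprD subnK // -ltnS prednK.
by rewrite sumr_const card_ord mulrn_eq0 negb_or -lt0n k0 expf_neq0.
Qed.

Lemma pow_locally_inj (k : nat) (z0 : K) : (0 < k)%N -> z0 != 0 ->
  \forall p \near (z0, z0), p.1 ^+ k = p.2 ^+ k -> p.1 = p.2.
Proof.
move=> k0 z0n0.
pose S (p : K * K) := \sum_(i < k) p.1 ^+ (k.-1 - i) * p.2 ^+ i.
have cS : S p @[p --> (z0, z0)] --> S (z0, z0).
  apply: cvg_big => [|i _]; first exact: add_continuous.
  by apply: cvgM; apply: cvg_exprn; [exact: cvg_fst|exact: cvg_snd].
have S0 : S (z0, z0) != 0 by exact: geom_sum_diag.
near=> p.
have Sp : S p != 0 by near: p; exact: cvgr_neq0 cS S0.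
move=> /eqP; rewrite -subr_eq0 subrXX mulf_eq0 -/(S p) (negbTE Sp) orbF subr_eq0.
by move/eqP.
Unshelve. all: by end_near. Qed.

(** The monic polynomial [X^k - w] splits, so [|z0^k - w|] is the product of
    the distances from [z0] to its [k] roots: one of them must be small. *)
Lemma root_near (k : nat) (z0 : K) (e : K) : (0 < k)%N -> 0 < e ->
  \forall w \near z0 ^+ k, exists2 z, `|z0 - z| < e & z ^+ k = w.
Proof.
move=> k0 e0; apply/nbhs_ballP; exists (e ^+ k); first by rewrite /= exprn_gt0.
move=> w; rewrite -ball_normE /= => wlt.
have [rs rsE] := closed_field_poly_normal ('X^k - w%:P).
have lc : lead_coef ('X^k - w%:P) = 1.
  by rewrite lead_coefDl ?lead_coefXn // size_polyXn size_polyN (leq_ltn_trans (size_polyC_leq1 _)).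
rewrite lc scale1r in rsE.
have szr : size rs = k.
  have := congr1 (fun p : {poly K} => size p) rsE.
  by rewrite size_prod_XsubC size_XnsubC // => -[].
have prodE : \prod_(z <- rs) (z0 - z) = z0 ^+ k - w.
  have := congr1 (fun p => p.[z0]) rsE; rewrite horner_prod !hornerE => ->.
  by apply: eq_bigr => z _; rewrite !hornerE.
have [/hasP[z zrs zlt]|] := boolP (has (fun z => `|z0 - z| < e) rs).
  exists z => //; have : root ('X^k - w%:P) z by rewrite rsE root_prod_XsubC.
  by rewrite rootE !hornerE subr_eq0 => /eqP.
rewrite -all_predC => /allP far; suff : e ^+ k <= `|z0 ^+ k - w|.
  by move=> /le_lt_trans /(_ wlt); rewrite ltxx.
rewrite -prodE normr_prod -szr.
elim: rs far {rsE szr prodE} => [|r rs IH] far; first by rewrite big_nil.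
rewrite big_cons exprS; apply: ler_pM; rewrite ?exprn_ge0 ?(ltW e0) //; last first.
  by apply: IH => z zrs; apply: far; rewrite inE zrs orbT.
have := far r (mem_head _ _) => /=; rewrite real_ltNge ?negbK ?normr_real//.
exact: gtr0_real.
Qed.

(** The branch of the [k]-th root with value [z0] at [z0 ^+ k] is the one that
    stays in a ball on which [z |-> z ^+ k] is injective. *)
Lemma local_root (k : nat) (z0 : K) : (0 < k)%N -> z0 != 0 ->
  exists r : K -> K,
    (\forall w \near z0 ^+ k, r w ^+ k = w /\ {for w, continuous r}) /\
    (\forall z \near z0, r (z ^+ k) = z).
Proof.
move=> k0 z0n0.
have [d d0 dinj] : exists2 d : K, 0 < d & forall z z', `|z0 - z| < d ->
    `|z0 - z'| < d -> z ^+ k = z' ^+ k -> z = z'.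
  have [[A B] [/= /nbhs_ballP[a a0 aA] /nbhs_ballP[b b0 bB]] AB] := pow_locally_inj k0 z0n0.
  have cab : a >=< b by rewrite real_comparable ?gtr0_real.
  exists (Num.min a b); first by rewrite comparable_lt_min // a0 b0.
  move=> z z'; rewrite !comparable_lt_min //.
  move=> /andP[za zb] /andP[za' zb']; apply: (AB (z, z')); split => /=.
  - by apply: aA; rewrite -ball_normE.
  - by apply: bB; rewrite -ball_normE.
pose r w := xget z0 [set z | `|z0 - z| < d /\ z ^+ k = w].
have rP w : (exists2 z, `|z0 - z| < d & z ^+ k = w) -> `|z0 - r w| < d /\ r w ^+ k = w.
  by move=> [z zd zw]; rewrite /r; case: xgetP => [y -> //|/(_ z)[]].
have rE z : `|z0 - z| < d -> r (z ^+ k) = z.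
  by move=> zd; have [|? ?] := rP (z ^+ k); [exists z | apply: dinj].
exists r; split; last first.
  by apply/nbhs_ballP; exists d => // z; rewrite -ball_normE; exact: rE.
have [e' e0' e'P] : exists2 e : K, 0 < e & forall w, `|z0 ^+ k - w| < e -> 
    exists2 z, `|z0 - z| < d & z ^+ k = w.
  have /nbhs_ballP[e e0 eP] := root_near z0 k0 d0.
  by exists e => // w we; apply: eP; rewrite -ball_normE.
apply/nbhs_ballP; exists e' => // w; rewrite -ball_normE /= => /e'P/rP[rd rw].
split => //; apply/(@cvgrPdist_lt K K K (nbhs w)) => e e0 /=.
have cde : e >=< d - `|z0 - r w| by rewrite real_comparable ?gtr0_real ?subr_gt0.
have de : 0 < Num.min e (d - `|z0 - r w|) by rewrite comparable_lt_min // e0 subr_gt0.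
have rn := root_near (r w) k0 de; rewrite rw in rn; move: rn.
apply: (@filterS _ (nbhs w)) => w' [z + <-].
rewrite comparable_lt_min // => /andP[ze zd].
rewrite rE //; apply: le_lt_trans (ler_distD (r w) _ _) _.
by rewrite -ltrBrDl.
Qed.

Lemma near_eq_differentiable (V W : normedModType K) (f g : V -> W) (x : V) :
  {near x, f =1 g} -> differentiable f x -> differentiable g x.
Proof.
move=> fg df; have fgx : f x = g x by exact: nbhs_singleton fg.
have dfc : continuous ('d f x) by exact: diff_continuous.
have eqo : g \o shift x = cst (g x) + 'd f x +o_ (0 : V) id.
  have /eqaddoP fo := diff_locally df; apply/eqaddoP => e e0.
  have fg0 : \forall h \near (0 : V), f (h + x) = g (h + x).
    by move: fg; rewrite (near_shift 0 x) /=; apply: filterS => h; rewrite subr0.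
  apply: filterS2 (fo e e0) fg0 => h /=.
  by rewrite !fctE /= => + <-; rewrite -fgx.
by apply/diff_locallyP; rewrite (diff_unique dfc eqo).
Qed.

(** Near [x] the function [g] is [n] followed by a branch of the [k]-th root,
    and that branch is holomorphic because its difference quotients are
    inverses of geometric sums. *)
Lemma differentiable_root (V : normedModType K) (g n : V -> K^o) (k : nat) (x : V) :
  (0 < k)%N -> g x != 0 -> {for x, continuous g} ->
  (\forall y \near x, g y ^+ k = n y) -> differentiable n x ->
  differentiable g x.
Proof.
move=> k0 gx0 cg gn dn.
have [r [r1 r2]] := local_root k0 gx0.
have nx : n x = g x ^+ k by rewrite (nbhs_singleton gn).
have rw : r (n x) = g x by rewrite nx (nbhs_singleton r2).
have cr : {for n x, continuous r} by rewrite nx; exact: (nbhs_singleton r1).2.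
have gr : {near x, (r \o n : V -> K^o) =1 g}.
  have r2g : \forall y \near x, r (g y ^+ k) = g y by exact: cg r2.
  by apply: filterS2 r2g gn => y /= ry <-.
apply: (near_eq_differentiable gr).
apply: differentiable_comp => //.
apply/derivable1_diffP.
pose q w := \sum_(i < k) r w ^+ (k.-1 - i) * r (n x) ^+ i.
have q0 : q (n x) != 0 by rewrite /q rw geom_sum_diag.
have cq : q w @[w --> n x] --> q (n x).
  apply: (@cvg_big _ _ _ _ _ _ _ (nbhs (n x))) => [|i _]; first exact: add_continuous.
  by apply: (@cvgM _ _ (nbhs (n x))); [exact: cvg_exprn cr|exact: cvg_cst].
have cqh : q (h + n x) @[h --> (0 : K)] --> q (n x).
  have cs : h + n x @[h --> (0 : K)] --> (0 : K) + n x.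
    by apply: (@cvgD K K K (nbhs 0) _ id (cst (n x))); [exact: cvg_id|exact: cvg_cst].
  by rewrite add0r in cs; exact: cvg_comp cs cq.
have cqV : (q (h + n x))^-1 @[h --> (0 : K)^'] --> (q (n x))^-1.
  by apply: cvgV => //; apply: cvg_within_filter.
have key : \forall h \near (0 : K)^', (q (h + n x))^-1 =
    h^-1 *: ((r \o shift (n x)) (h *: (1 : K^o)) - r (n x)).
  near=> h.
  have h0 : h != 0 by near: h; exact: nbhs_dnbhs_neq.
  have qh : q (h + n x) != 0.
    near: h; apply: (@cvgr_neq0 _ _ _ _ _ _ (q (n x))) => //.
    exact: cvg_within_filter.
  have rk : r (h + n x) ^+ k = h + n x.
    near: h; apply: nbhs_dnbhs.
    have := r1; rewrite -nx (near_shift 0 (n x)) /=.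
    by apply: filterS => h /=; rewrite subr0 => -[].
  rewrite /= [h *: 1]mulr1; apply: (mulfI qh); rewrite mulfV // /GRing.scale /=.
  rewrite mulrCA [q _ * _]mulrC -subrXX rk rw -nx.
  by rewrite addrK mulVf.
apply: cvgP (_ : _ --> (q (n x))^-1).
by apply: cvg_trans cqV; exact: near_eq_cvg.
Unshelve. all: by end_near. Qed.
End Roots.

(** * Rank-one local systems *)

Lemma connected_locally_const (T : topologicalType) (A : set T) (P : T -> Prop) :
  connected A -> (forall x, A x -> \forall y \near x, A y -> (P x <-> P y)) ->
  forall x y, A x -> A y -> P x -> P y.
Proof.
move=> cA loc x y Ax Ay Px.
pose U b := interior [set z | A z -> (P z <-> b)].
have AU z b : A z -> (P z <-> b) -> U b z.
  by move=> Az Pz; apply: filterS (loc z Az) => w Azw /Azw <-.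
have UA z b : A z -> U b z -> (P z <-> b) by move=> Az /interior_subset; apply.
suff AE : A `&` U True = A.
  have [_ Uy] : (A `&` U True) y by rewrite AE.
  by apply/(UA _ _ Ay Uy).
apply: cA.
- by exists x; split => //; apply: AU.
- by exists (U True) => //; exact: open_interior.
- exists (~` U False); first by apply: open_closedC; exact: open_interior.
  apply/seteqP; split=> z [Az Uz]; split => //.
  + by move=> UFz; have [h _] := UA _ _ Az UFz; apply: h; apply/(UA _ _ Az Uz).
  + by apply: (AU z True Az); split=> // _; apply: contrapT => nP; apply: Uz; exact: AU.
Qed.

(** Sections of a rank-one local system with structure group [G], described
    by their germs: [sec s x] says that the function [s] represents a section
    near [x]. *)
Record local_system (K : fieldType) (T : topologicalType) (G : set K) (S : set T)
    (sec : (T -> K) -> T -> Prop) : Prop := LocalSystem {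
  ls_open : forall s x, S x -> sec s x -> \forall y \near x, sec s y;
  ls_neq0 : forall s x, S x -> sec s x -> s x != 0;
  ls_ratio : forall s s' x, S x -> sec s x -> sec s' x ->
    exists2 a, G a & \forall y \near x, s' y = a * s y;
  ls_scale : forall s s' a x, S x -> G a -> sec s x ->
    (\forall y \near x, s' y = a * s y) -> sec s' x;
  ls_exists : forall x, S x -> exists s, sec s x
}.

Section LocalSystems.
Variables (K : fieldType) (T : topologicalType).
Implicit Types (S A B : set T) (G : set K).

(** A substitute for simple connectedness that avoids paths: all rank-one local
    systems over [S] are trivial. *)
Definition monodromy_free S := forall G sec, @local_system K T G S sec ->
  exists s, forall x, S x -> sec s x.

Lemma local_systemS G S A sec : A `<=` S -> local_system G S sec ->
  local_system G A sec.
Proof.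
move=> AS [h1 h2 h3 h4 h5]; split.
- by move=> s x /AS; exact: h1.
- by move=> s x /AS; exact: h2.
- by move=> s s' x /AS; exact: h3.
- by move=> s s' a x /AS; exact: h4.
- by move=> x /AS; exact: h5.
Qed.

Section Fixed.
Variables (G : set K) (S : set T) (sec : (T -> K) -> T -> Prop).
Hypothesis ls : local_system G S sec.

Lemma ls_ext s s' x : S x -> sec s x -> (\forall y \near x, s' y = s y) -> sec s' x.
Proof.
move=> Sx sx ss'; have [a Ga sa] := ls_ratio ls Sx sx sx.
have a1 : a = 1.
  by apply: (mulIf (ls_neq0 ls Sx sx)); rewrite mul1r -(nbhs_singleton sa).
apply: (ls_scale ls Sx Ga sx); rewrite a1; apply: filterS ss' => y ->.
by rewrite mul1r.
Qed.

Lemma ls_ratio_connected A s s' a : A `<=` S -> open A -> connected A ->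
  (forall x, A x -> sec s x) -> (forall x, A x -> sec s' x) ->
  forall x y, A x -> A y -> s' x = a * s x -> s' y = a * s y.
Proof.
move=> AS oA cA sA sA'.
apply: (connected_locally_const (P := fun x => s' x = a * s x)) => // x Ax.
have [b _ bE] := ls_ratio ls (AS _ Ax) (sA _ Ax) (sA' _ Ax).
have bx := nbhs_singleton bE.
apply: filterS bE => y yE Ay; rewrite bx yE.
by split=> /mulIf -> //; exact: (ls_neq0 ls (AS _ _) (sA _ _)).
Qed.

(** Two sections over open sets with connected intersection differ by a
    constant there, so rescaling one of them makes them agree. *)
Lemma ls_glue A B s s' z : A `<=` S -> B `<=` S -> open A -> open B ->
  connected (A `&` B) -> A z -> B z ->
  (forall x, A x -> sec s x) -> (forall x, B x -> sec s' x) ->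
  exists2 s'', (forall x, A x -> s'' x = s x) &
    forall x, A x \/ B x -> sec s'' x.
Proof.
move=> AS BS oA oB cAB Az Bz sA sB.
have [a Ga aE] := ls_ratio ls (BS _ Bz) (sB _ Bz) (sA _ Az).
have sE : forall x, A x -> B x -> s x = a * s' x.
  move=> x Ax Bx.
  apply: (@ls_ratio_connected (A `&` B) s' s a _ _ cAB _ _ z x) => //.
  - by move=> y [/AS].
  - exact: openI.
  - by move=> y [_ /sB].
  - by move=> y [/sA].
  - exact: nbhs_singleton aE.
pose s'' x := if pselect (A x) then s x else a * s' x.
exists s''; first by move=> x Ax; rewrite /s''; case: pselect.
move=> x [Ax|Bx].
  apply: (ls_ext (AS _ Ax) (sA _ Ax)).
  have := open_nbhs_nbhs (conj oA Ax); apply: filterS => y Ay.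
  by rewrite /s''; case: pselect.
apply: (ls_scale ls (BS _ Bx) Ga (sB _ Bx)).
have := open_nbhs_nbhs (conj oB Bx); apply: filterS => y By.
by rewrite /s''; case: pselect => // Ay; exact: sE.
Qed.
End Fixed.

(** The combinatorial form of the vanishing of monodromy on a union: the
    sections over the [A j], normalised to agree with the one over [A j0], agree
    with each other because [A i], [A j] and [A j0] have a common point and
    [A i `&` A j] is connected. *)
Lemma monodromy_free_bigcup (J : Type) (j0 : J) (A : J -> set T) :
  (forall j, open (A j)) -> (forall j, monodromy_free (A j)) ->
  (forall i j, connected (A i `&` A j)) ->
  (forall i j, A i `&` A j `&` A j0 !=set0) ->
  monodromy_free (\bigcup_j A j).
Proof.
move=> oA mA cA tA G sec ls.
have AS j : A j `<=` \bigcup_j A j by exact: bigcup_sup.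
have /choice[s sP] : forall j, exists s, forall x, A j x -> sec s x.
  by move=> j; exact: mA (local_systemS (AS j) ls).
have [s' s'0 s'P] : exists2 s' : J -> T -> K,
    forall j x, A j x -> A j0 x -> s' j x = s j0 x &
    forall j x, A j x -> sec (s' j) x.
  have /choice[s' s'P] : forall j, exists s',
     (forall x, A j x -> A j0 x -> s' x = s j0 x) /\ forall x, A j x -> sec s' x.
    move=> j; have [z [[Az _] A0z]] := tA j j.
    have [s'' s''0 s''P] := ls_glue ls (AS j0) (AS j) (oA j0) (oA j) (cA j0 j) A0z Az
      (sP j0) (sP j).
    exists s''; split; first by move=> x _; exact: s''0.
    by move=> x Ajx; apply: s''P; right.
  by exists s' => j; case: (s'P j).
have s'E i j x : A i x -> A j x -> s' i x = s' j x.
  move=> Aix Ajx; have [z [[Aiz Ajz] A0z]] := tA i j.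
  rewrite -[RHS]mul1r.
  apply: (@ls_ratio_connected _ _ _ ls (A i `&` A j) (s' j) (s' i) 1 _ _ (cA i j) _ _ z x) => //.
  - by move=> y [/AS].
  - exact: openI.
  - by move=> y [_ /s'P].
  - by move=> y [/s'P].
  - by rewrite mul1r !s'0.
pose J' x := if pselect (exists j, A j x) is left h then sval (cid h) else j0.
exists (fun x => s' (J' x) x) => x [j _ Ajx].
apply: (ls_ext ls (AS _ _ Ajx) (s'P _ _ Ajx)).
have := open_nbhs_nbhs (conj (oA j) Ajx); apply: filterS => y Ajy.
rewrite /J'; case: pselect => [h|]; last by case; exists j.
by apply: s'E => //; exact: svalP (cid h).
Qed.

Lemma bigcup_pairwise_connected (J : Type) (A : J -> set T) :
  (forall j, connected (A j)) -> (forall i j, A i `&` A j !=set0) ->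
  connected (\bigcup_j A j).
Proof.
move=> cA nA; have [[j0 _]|noJ] := pselect (exists j : J, True); last first.
  suff -> : \bigcup_j A j = set0 by exact: connected0.
  by apply/seteqP; split => // x [j]; case: noJ; exists j.
have [z [A0z _]] := nA j0 j0.
have -> : \bigcup_j A j = \bigcup_j (A j0 `|` A j).
  apply/seteqP; split=> [x [j _ Ajx]|x [j _ [|] Ax]].
  - by exists j => //; right.
  - by exists j0.
  - by exists j.

apply: (@bigcup_connected _ _ (fun j => A j0 `|` A j) setT).
  by exists z => j _; left.
by move=> j _; exact: connectedU.
Qed.
End LocalSystems.

Lemma monodromy_free_image (K : fieldType) (T T' : topologicalType) (S : set T)
    (phi : T -> T') (psi : T' -> T) : open S ->
  (forall y, S y -> {for y, continuous phi}) ->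
  (forall y, S y -> psi (phi y) = y) ->
  (forall y (A : set T), S y -> nbhs y A -> nbhs (phi y) (phi @` A)) ->
  monodromy_free K S -> monodromy_free K (phi @` S).
Proof.
move=> oS cphi psiK phio mS G sec ls.
have near_pull (P : T' -> Prop) y : S y -> (\forall x \near phi y, P x) ->
    \forall y' \near y, P (phi y') by move=> Sy Px; exact: cphi Sy _ Px.
have near_push (P : T' -> Prop) y : S y -> (\forall y' \near y, S y' -> P (phi y')) ->
    \forall x \near phi y, P x.
  move=> Sy Py; have SP : \forall y' \near y, P (phi y').
    by apply: filterS2 (open_nbhs_nbhs (conj oS Sy)) Py => y' Sy'; apply.
  by apply: filterS (phio _ _ Sy SP) => x [y' Py' <-].
pose sec' (s : T -> K) y := sec (s \o psi) (phi y).
have Sphi y : S y -> (phi @` S) (phi y) by exists y.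
have ls' : local_system G S sec'.
  split.
  - by move=> s y Sy /(ls_open ls (Sphi _ Sy)); exact: near_pull.
  - by move=> s y Sy /(ls_neq0 ls (Sphi _ Sy)) /=; rewrite psiK.
  - move=> s s' y Sy sy s'y; have [a Ga aE] := ls_ratio ls (Sphi _ Sy) sy s'y.
    exists a => //; apply: filterS2 (open_nbhs_nbhs (conj oS Sy)) (near_pull _ _ Sy aE).
    by move=> y' Sy' /=; rewrite psiK.
  - move=> s s' a y Sy Ga sy s'E; apply: (ls_scale ls (Sphi _ Sy) Ga sy).
    by apply: near_push => //; apply: filterS s'E => y' /= E Sy'; rewrite psiK.
  - move=> y Sy; have [s sy] := ls_exists ls (Sphi _ Sy); exists (s \o phi).
    apply: (ls_ext ls (Sphi _ Sy) sy); apply: near_push => //.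
    by apply: filterE => y' Sy' /=; rewrite psiK.
have [s sP] := mS _ _ ls'.
by exists (s \o psi) => _ [y Sy <-]; exact: sP.
Qed.

(** * Star-shaped sets *)

Section StarShaped.
Variables (R : realType) (m : nat).
Local Notation V := 'rV[R]_m.
Implicit Types (S A B : set V) (c x y : V) (t u : R).

Definition star_shaped S c := S c /\
  forall x t, S x -> 0 <= t <= 1 -> S (c + t *: (x - c)).

Definition is_convex S := forall x y t, S x -> S y -> 0 <= t <= 1 ->
  S (x + t *: (y - x)).

Lemma is_convexI A B : is_convex A -> is_convex B -> is_convex (A `&` B).
Proof. by move=> cA cB x y t [Ax Bx] [Ay By] t01; split; [exact: cA|exact: cB]. Qed.

Lemma convex_ball c e : is_convex (ball c e).
Proof.
move=> x y t; rewrite -!ball_normE /= => xe ye /andP[t0 t1].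
have -> : c - (x + t *: (y - x)) = (1 - t) *: (c - x) + t *: (c - y).
  by apply/rowP => i; rewrite !mxE; ring.
apply: le_lt_trans (ler_normD _ _) _; rewrite !normrZ (ger0_norm t0).
rewrite ger0_norm ?subr_ge0 //.
have [->|tn0] := eqVneq t 0; first by rewrite subr0 mul1r mul0r addr0.
rewrite -[e](_ : (1 - t) * e + t * e = e); last by ring.
apply: ler_ltD; first by rewrite ler_wpM2l ?subr_ge0 // ltW.
by rewrite ltr_pM2l // lt_def tn0.
Qed.

Lemma star_connected S c : star_shaped S c -> connected S.
Proof.
move=> [Sc St].
have -> : S = \bigcup_(x in S) ((fun t => c + t *: (x - c)) @` `[0, 1]).
  apply/seteqP; split=> [x Sx|_ [x Sx [t /= t01 <-]]].
    exists x => //; exists 1; first by rewrite /= in_itv /= ler01 lexx.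
    by rewrite scale1r addrC subrK.
  by apply: St => //; rewrite in_itv /= in t01.
apply: bigcup_connected.
  exists c => x Sx; exists 0; first by rewrite /= in_itv /= ler01 lexx.
  by rewrite scale0r addr0.
move=> x Sx; apply: connected_continuous_connected; first exact: segment_connected.
apply: continuous_subspaceT => t.
by apply: cvgD; [exact: cvg_cst|apply: cvgZl; exact: cvg_id].
Qed.

Lemma convex_connected A : is_convex A -> connected A.
Proof.
move=> cA; have [->|/set0P[c Ac]] := eqVneq A set0; first exact: connected0.
by apply: (@star_connected _ c); split=> // x t Ax; exact: cA.
Qed.

(** The open neighbourhood of radius [e] of the segment from [c] to the point of
    parameter [t] on the way to [x]. *)
Definition tube c x t e := [set y | exists2 u, 0 <= u <= t & ball (c + u *: (x - c)) e y].

Lemma tube_open c x t e : open (tube c x t e).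
Proof.
rewrite openE => y [u ut]; rewrite -ball_normE /= => ye.
apply/nbhs_ballP; exists (e - `|c + u *: (x - c) - y|); first by rewrite /= subr_gt0.
move=> z; rewrite -ball_normE /= => yz; exists u => //; rewrite -ball_normE /=.
by apply: le_lt_trans (ler_distD y _ _) _; rewrite -ltrBrDl.
Qed.

Lemma tube_convex c x t e : is_convex (tube c x t e).
Proof.
move=> y y' l [u /andP[u0 ut] uy] [u' /andP[u'0 u't] uy'] l01.
exists (u + l * (u' - u)).
  move: l01 => /andP[l0 l1].
  by apply/andP; split; nra.
move: uy uy'; rewrite -!ball_normE /= => uy uy'.
have := @convex_ball 0 e (y - (c + u *: (x - c))) (y' - (c + u' *: (x - c))) l.
rewrite -ball_normE /= !sub0r !normrN => /(_ _ _ l01).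
rewrite ![`|y - _|]distrC ![`|y' - _|]distrC => /(_ uy uy').
move=> h; rewrite distrC; move: h.
by congr (`|_| < e); apply/rowP => i; rewrite !mxE; ring.
Qed.

Lemma tube_center c x t e : 0 <= t -> 0 < e -> tube c x t e c.
Proof.
move=> t0 e0; exists 0; first by rewrite lexx.
by rewrite scale0r addr0; exact: ballxx.
Qed.

Lemma tube_end c x t e : 0 <= t -> 0 < e -> tube c x t e (c + t *: (x - c)).
Proof. by move=> t0 e0; exists t; [rewrite lexx t0|exact: ballxx]. Qed.

(** The sections over thin convex tubes around the segments from the centre,
    normalised at the centre, agree on the convex overlaps of these tubes. *)
Lemma star_monodromy_free (K : fieldType) S c : open S -> star_shaped S c -> monodromy_free K S.
Proof.
move=> oS [Sc St] G sec ls.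
have [s0 s0c] := ls_exists ls Sc.
pose good x t e s := [/\ 0 < e, tube c x t e `<=` S,
  forall y, tube c x t e y -> sec s y & s c = s0 c].
(* The set of those [t] for which a section over some tube reaches the parameter
   [t] is open and closed: extending or shortening the tube near [t0] amounts to
   glueing in a section over a ball around that point. *)
have step x t0 : S x -> 0 <= t0 <= 1 -> exists2 d : R, 0 < d & forall t1 t2,
    0 <= t1 <= 1 -> 0 <= t2 <= 1 -> `|t0 - t1| < d -> `|t0 - t2| < d ->
    (exists e s, good x t1 e s) -> exists e s, good x t2 e s.
  move=> Sx t01; pose g t := c + t *: (x - c).
  have Sg t : 0 <= t <= 1 -> S (g t) by exact: St.
  have [s sg] := ls_exists ls (Sg _ t01).
  have [e e0 eP] : exists2 e : R, 0 < e & forall y, ball (g t0) e y -> S y /\ sec s y.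
    have : \forall y \near g t0, S y /\ sec s y.
      apply: filterS2 (open_nbhs_nbhs (conj oS (Sg _ t01))) (ls_open ls (Sg _ t01) sg).
      by move=> y.
    by move=> /nbhs_ballP[e e0 eP]; exists e.
  pose n := `|x - c| + 1.
  have n0 : 0 < n by rewrite ltr_wpDl.
  have gd t t' : `|g t - g t'| <= `|t - t'| * n.
    have -> : g t - g t' = (t - t') *: (x - c).
      by rewrite /g; apply/rowP => i; rewrite !mxE; ring.
    by rewrite normrZ ler_wpM2l // lerDl.
  exists (e / 2 / n); first by rewrite !divr_gt0.
  move=> t1 t2 t1P t2P t1d t2d [e1 [s1 [e10 tS s1P s1c]]].
  have gd1 t : `|t0 - t| < e / 2 / n -> `|g t0 - g t| < e / 2.
    move=> td; apply: le_lt_trans (gd _ _) _.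
    by rewrite -ltr_pdivlMr.
  have [t10 t20] : 0 <= t1 /\ 0 <= t2 by move: t1P t2P => /andP[-> _] /andP[-> _].
  have gt1A : tube c x t1 e1 (g t1) by exact: tube_end.
  have gt1B : ball (g t0) e (g t1).
    rewrite -ball_normE /=; apply: lt_trans (gd1 _ t1d) _.
    by rewrite ltr_pdivrMr // ltr_pMr // ltr1n.
  have BS : ball (g t0) e `<=` S by move=> y /eP[].
  have sB y : ball (g t0) e y -> sec s y by move=> /eP[].
  have [s2 s21 s2P] := ls_glue ls tS BS (@tube_open _ _ _ _) (@ball_open _ _ _ _)
    (convex_connected (is_convexI (@tube_convex _ _ _ _) (@convex_ball _ _))) gt1A gt1B s1P sB.
  have sub y : tube c x t2 (Num.min e1 (e / 2)) y -> tube c x t1 e1 y \/ ball (g t0) e y.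
    move=> [u /andP[u0 ut2]]; rewrite -!ball_normE /= lt_min => /andP[ye1 ye].
    have [ut1|t1u] := leP u t1; [left|right].
      by exists u; rewrite -?ball_normE ?u0.
    rewrite [e]splitr; apply: le_lt_trans (ler_distD (g u) _ _) _.
    apply: ltrD => //; apply: gd1; move: t1d t2d; rewrite !ltr_norml.
    move=> /andP[? ?] /andP[? ?]; apply/andP; split; lra.
  exists (Num.min e1 (e / 2)), s2; split.
  - by rewrite lt_min e10 divr_gt0.
  - by move=> y /sub[/tS|/BS].
  - by move=> y /sub; exact: s2P.
  - by rewrite s21 // ; exact: tube_center.
have good0 x : S x -> exists e s, good x 0 e s.
  move=> Sx.
  have : \forall y \near c, S y /\ sec s0 y.
    apply: filterS2 (open_nbhs_nbhs (conj oS Sc)) (ls_open ls Sc s0c).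
    by move=> y.
  move=> /nbhs_ballP[e e0 eP]; exists e, s0.
  have tb y : tube c x 0 e y -> ball c e y.
    move=> [u]; rewrite -eq_le => /eqP <-.
    by rewrite scale0r addr0.
  by split => // y /tb/eP[].
have good1 x : S x -> exists e s, good x 1 e s.
  move=> Sx.
  pose P (t : R) := exists e s, good x t e s.
  have I01 t : 0 <= t <= 1 -> `[0, 1]%classic t by rewrite /= in_itv.
  have cst_P t : `[0, 1]%classic t -> \forall t' \near t, `[0, 1]%classic t' -> (P t <-> P t').
    rewrite /= in_itv /= => t01; have [d d0 dP] := step x t Sx t01.
    apply/nbhs_ballP; exists d => // t'; rewrite -ball_normE /= => t'd.
    rewrite in_itv /= => t'01.
    by split; apply: dP => //; rewrite subrr normr0.
  apply: (connected_locally_const (@segment_connected R 0 1) cst_P (I01 0 _) (I01 1 _)).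
  - by rewrite lexx ler01.
  - by rewrite lexx ler01.
  - exact: good0.
have /choice[e /choice[s gd]] : forall x, exists e, exists s, S x -> good x 1 e s.
  move=> x; have [/good1[e [s sP]]|nS] := pselect (S x); first by exists e, s.
  by exists 0, (fun=> 0) => /nS.
have xtube x : S x -> tube c x 1 (e x) x.
  move=> /gd[e0 _ _ _]; have := tube_end c x ler01 e0.
  by rewrite scale1r addrC subrK.
exists (fun x => s x x) => x Sx.
have [e0 tS sP sc] := gd _ Sx.
apply: (ls_ext ls Sx (sP _ (xtube _ Sx))).
have := open_nbhs_nbhs (conj (@tube_open _ _ _ _) (xtube _ Sx)); apply: filterS => y xy.
have Sy := tS _ xy; have [e0' tS' sP' sc'] := gd _ Sy.
rewrite -[RHS]mul1r.
apply: (@ls_ratio_connected _ _ _ _ _ ls (tube c x 1 (e x) `&` tube c y 1 (e y))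
  (s x) (s y) 1 _ _ _ _ _ c y) => //.
- by move=> z [/tS].
- by apply: openI; exact: tube_open.
- by apply: convex_connected; apply: is_convexI; exact: tube_convex.
- by move=> z [/sP].
- by move=> z [_ /sP'].
- by split; exact: tube_center.
- by split => //; exact: xtube.
- by rewrite mul1r sc sc'.
Qed.
End StarShaped.

(** * Superlevel sets of saddles *)

Section NormRow.
Variables (R : realType) (m : nat).
Implicit Types x : 'rV[R]_m.

Lemma row_norm_ge x i : `|x 0 i| <= `|x|.
Proof. by rewrite [leRHS]/Num.norm /= mx_normrE; apply/bigmax_geP; right => /=; exists (0, i). Qed.

Lemma row_norm_le x c : 0 <= c -> (forall i, `|x 0 i| <= c) -> `|x| <= c.
Proof.
move=> c0 xc; rewrite [leLHS]/Num.norm /= mx_normrE; apply/bigmax_leP; split => //.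
by move=> [i j] _ /=; rewrite ord1.
Qed.

Lemma row_norm_sqr_le x : `|x| ^+ 2 <= \sum_i x 0 i ^+ 2.
Proof.
set N := \sum_i _; have N0 : 0 <= N by apply: sumr_ge0 => i _; exact: sqr_ge0.
rewrite -[N]sqr_sqrtr //; apply: lerXn2r; rewrite ?nnegrE ?sqrtr_ge0 //.
apply: row_norm_le => [|i]; first exact: sqrtr_ge0.
rewrite -sqrtr_sqr ler_wsqrtr // /N (bigD1 i) //= lerDl.
by apply: sumr_ge0 => j _; exact: sqr_ge0.
Qed.
End NormRow.

(** Along the segment from a centre to a point of the superlevel set, the
    value is bounded below by [t ^+ 2 * f x] plus positive terms coming from the
    bilinear form; these absorb the error terms, which are of second order. *)
Lemma segment_estimate (R : realType) (kap t r a p X Ext Etx Ex Qx b Qc : R) :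
  let eps := kap / 100 / 100 in
  0 < kap -> 11 * kap < 1 -> 0 <= t -> t <= 1 -> 0 < r -> 0 <= a -> 0 <= p ->
  0 < Ex + Qx ->
  - (eps * (X + t * a) * ((1 - t) * p)) <= Ext - Etx ->
  - (eps * (t * a + a) * ((1 - t) * a)) <= Etx - Ex ->
  - (eps * a ^+ 2) <= Ex ->
  X <= t * a + (1 - t) * p ->
  kap * a * (r / 32) <= b -> p <= r / 2 -> r ^+ 2 / 32 / 32 <= Qc -> a < r ->
  0 < Ext + (t ^+ 2 * Qx + 2 * t * (1 - t) * b + (1 - t) ^+ 2 * Qc).
Proof.
move=> eps kap0 kap11 t0 t1 r0 a0 p0 fx0 E1 E2 E3 nxt Bc pr Qc0 ar.
have eps0 : 0 < eps by rewrite !divr_gt0.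
have epsE : eps = kap / 100 / 100 by [].
clearbody eps.
have u0 : 0 <= 1 - t by rewrite subr_ge0.
have step1 : eps * (X + t * a) * ((1 - t) * p) <= eps * (1 - t) * (t * a * r + (1 - t) * (r ^+ 2 / 4)).
  have h1 : (X + t * a) * p <= (2 * (t * a) + (1 - t) * p) * p by rewrite ler_wpM2r //; lra.
  have h2 : (2 * (t * a) + (1 - t) * p) * p <= t * a * r + (1 - t) * (r ^+ 2 / 4).
    have ta : 0 <= t * a by rewrite mulr_ge0.
    have hp : p * p <= r ^+ 2 / 4 by rewrite -[r ^+ 2 / 4](_ : r / 2 * (r / 2) = _); [rewrite ler_pM|field].
    have : t * a * (2 * p) <= t * a * r by rewrite ler_wpM2l //; lra.
    have : (1 - t) * (p * p) <= (1 - t) * (r ^+ 2 / 4) by rewrite ler_wpM2l.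
    lra.
  have -> : eps * (X + t * a) * ((1 - t) * p) = eps * (1 - t) * ((X + t * a) * p) by ring.
  rewrite ler_wpM2l //; [by rewrite mulr_ge0 // ltW|exact: le_trans h2].
have step2 : eps * (t * a + a) * ((1 - t) * a) + (1 - t ^+ 2) * (eps * a ^+ 2) <=
    eps * (1 - t) * (4 * (t * a * r + (1 - t) * r ^+ 2)).
  have -> : eps * (t * a + a) * ((1 - t) * a) + (1 - t ^+ 2) * (eps * a ^+ 2) =
    eps * (1 - t) * (2 * (1 + t) * a ^+ 2) by ring.
  rewrite ler_wpM2l //; first by rewrite mulr_ge0 // ltW.
  have h1 : a ^+ 2 <= a * r by rewrite expr2 ler_wpM2l // ltW.
  have h2 : a ^+ 2 <= r ^+ 2 by apply: lerXn2r; rewrite ?nnegrE // ltW.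
  have h3 : t * a ^+ 2 <= t * (a * r) by rewrite ler_wpM2l.
  have h4 : (1 - t) * a ^+ 2 <= (1 - t) * r ^+ 2 by rewrite ler_wpM2l.
  have h5 : (1 + t) * a ^+ 2 <= 2 * a ^+ 2 by rewrite ler_wpM2r ?sqr_ge0 //; lra.
  lra.
have step3 : - (1 - t ^+ 2) * (eps * a ^+ 2) <= (1 - t ^+ 2) * Ex.
  rewrite mulNr -mulrN ler_wpM2l // subr_ge0; exact: exprn_ile1.
have gainB : 2 * t * (1 - t) * (kap * a * (r / 32)) <= 2 * t * (1 - t) * b.
  by rewrite ler_wpM2l // !mulr_ge0.
have gainQ : (1 - t) ^+ 2 * (r ^+ 2 / 32 / 32) <= (1 - t) ^+ 2 * Qc by rewrite ler_wpM2l // sqr_ge0.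
have win1 : eps * (1 - t) * (5 * (t * a * r)) <= 2 * t * (1 - t) * (kap * a * (r / 32)).
  have : 0 <= (1 - t) * (t * a * r) * kap by rewrite !mulr_ge0 // ltW.
  rewrite epsE; lra.
have r2 : 0 < r ^+ 2 by rewrite exprn_gt0.
have win2 : eps * (1 - t) * (5 * ((1 - t) * r ^+ 2)) <= (1 - t) ^+ 2 * (r ^+ 2 / 32 / 64).
  have : 0 <= (1 - t) ^+ 2 * r ^+ 2 by rewrite mulr_ge0 // sqr_ge0.
  set W := (1 - t) ^+ 2 * r ^+ 2 => W0; have : kap * W <= 11^-1 * W by rewrite ler_wpM2r //; lra.
  have -> : eps * (1 - t) * (5 * ((1 - t) * r ^+ 2)) = 5 * eps * W by rewrite /W; ring.
  have -> : (1 - t) ^+ 2 * (r ^+ 2 / 32 / 64) = W / 32 / 64 by rewrite /W; ring.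
  rewrite epsE; lra.
have final : 0 < t ^+ 2 * (Ex + Qx) + (1 - t) ^+ 2 * (r ^+ 2 / 32 / 64).
  have [t00|tn0] := eqVneq t 0.
    by rewrite t00 expr0n mul0r add0r subr0 expr1n mul1r !divr_gt0.
  apply: ltr_pwDl; first by rewrite mulr_gt0 // exprn_gt0 // lt_def tn0.
  by rewrite mulr_ge0 ?sqr_ge0 // !divr_ge0 // ltW.
have u2r : 0 <= eps * (1 - t) * ((1 - t) * r ^+ 2).
  by rewrite !mulr_ge0 // ltW.
lra.
Qed.

Section Cones.
Variables (R : realType) (m : nat) (pos : pred 'I_m).
Hypothesis pos3 : (3 <= #|pos|)%N.
Implicit Types (x y q : 'rV[R]_m) (i j : 'I_m).
Local Notation simplex := (option {i | pos i}).

Let sg i : R := if pos i then 1 else -1.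
Let B x y := \sum_i sg i * x 0 i * y 0 i.
Let Q x := \sum_i sg i * x 0 i ^+ 2.
(* The slope of the cones: a point all of whose [lf j] are at most [kap * `|x|]
   has positive coordinates of size at most [m * kap * `|x|]; their
   squares add up to at most [`|x| ^+ 2 / 16]. *)
Let kap : R := (16 * m%:R ^+ 2)^-1.
Let sp x := \sum_(i | pos i) x 0 i.

(** The linear forms [lf j] sum to zero and are otherwise independent on the
    positive coordinates: the cones where one of them is large are the stars of
    the vertices of a simplex around the origin. *)
Definition lf (j : simplex) x : R :=
  if j is Some i then x 0 (val i) else - sp x.

(* The vector [a e_i + a e_j - g u], where [u] is the sum of the positive unit
   vectors: all the centres and common points of cones have this form. *)
Let vec i j (a g : R) : 'rV[R]_m :=
  \row_k (if pos k then a * ((k == i)%:R + (k == j)%:R) - g else 0).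

Let Qcomb t u x y : Q (t *: x + u *: y) = t ^+ 2 * Q x + 2 * t * u * B x y + u ^+ 2 * Q y.
Proof.
rewrite /Q /B !mulr_sumr -!big_split; apply: eq_bigr => i _ /=.
by rewrite !mxE; ring.
Qed.

Let spC t u x y : sp (t *: x + u *: y) = t * sp x + u * sp y.
Proof. by rewrite /sp !mulr_sumr -big_split; apply: eq_bigr => i _; rewrite !mxE. Qed.

Let lfC (j : simplex) t u x y : lf j (t *: x + u *: y) = t * lf j x + u * lf j y.
Proof. by case: j => [i|] /=; [rewrite !mxE|rewrite spC; ring]. Qed.

Let sum_eqpos i (F : 'I_m -> R) : pos i -> \sum_(k | pos k) (k == i)%:R * F k = F i.
Proof.
move=> pi; rewrite (bigD1 i) //= eqxx mul1r big1 ?addr0 // => k /andP[_ /negbTE ->].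
by rewrite mul0r.
Qed.

Let B_vec x i j a g : pos i -> pos j -> B x (vec i j a g) = a * (x 0 i + x 0 j) - g * sp x.
Proof.
move=> pi pj; rewrite /B (bigID pos) /= [X in _ + X]big1 ?addr0; last first.
  by move=> k /negbTE pk; rewrite mxE pk mulr0.
rewrite -(sum_eqpos (x 0) pi) -(sum_eqpos (x 0) pj) /sp -big_split /= !mulr_sumr -sumrB.
by apply: eq_bigr => k pk; rewrite /sg mxE pk; ring.
Qed.

Let sp_vec i j a g : pos i -> pos j -> sp (vec i j a g) = 2 * a - g * #|pos|%:R.
Proof.
move=> pi pj; rewrite /sp.
under eq_bigr => k pk do rewrite mxE pk mulrDr.
rewrite sumrB big_split /= sumr_const -[g *+ _]mulr_natr; congr (_ - _).
rewrite -!mulr_sumr.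
have E l : pos l -> \sum_(k | pos k) (k == l)%:R = 1 :> R.
  by move=> pl; rewrite -[RHS](sum_eqpos (fun=> 1) pl); apply: eq_bigr => k _; rewrite mulr1.
by rewrite !E //; ring.
Qed.

Let Q_pos q i : pos i -> (forall k, ~~ pos k -> q 0 k = 0) -> q 0 i ^+ 2 <= Q q.
Proof.
move=> pi q0; rewrite /Q (bigD1 i) //= /sg pi mul1r lerDl.
apply: sumr_ge0 => k _; case: ifP => [_|/negbT /q0 ->].
  by rewrite mul1r sqr_ge0.
by rewrite expr0n mulr0.
Qed.

Let vec_norm i j a g : `|a| * 2 + `|g| <= 11 -> `|vec i j a g| <= 11.
Proof.
move=> ag; apply: row_norm_le => // k; rewrite mxE; case: ifP => _; last by rewrite normr0.
apply: le_trans (ler_normB _ _) _; apply: le_trans ag; rewrite lerD2r normrM ler_wpM2l //.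
by case: eqP; case: eqP => _ _; rewrite ?mulr0n ?mulr1n ger0_norm; lra.
Qed.

Let m3 : (3 <= m)%N.
Proof. by apply: leq_trans pos3 _; rewrite -[X in (_ <= X)%N]card_ord; exact: max_card. Qed.
Let mR3 : 3 <= m%:R :> R. Proof. by rewrite ler_nat. Qed.
Let kap0 : 0 < kap.
Proof. by rewrite invr_gt0 mulr_gt0 // exprn_gt0 // ltr0n (leq_trans _ m3). Qed.
Let kap11 : 11 * kap < 1.
Proof.
rewrite /kap ltr_pdivrMr ?mul1r; last by rewrite mulr_gt0 // exprn_gt0 // ltr0n (leq_trans _ m3).
have := mR3; nra.
Qed.

(** The conditions that make a small multiple of [q] a centre for the common part
    of the cones [i] and [j]: it lies deep inside both, and it pairs positively
    with all their points. *)
Definition center (i j : simplex) (q : 'rV[R]_m) := [/\ `|q| <= 11, 1 <= Q q,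
  1 <= lf i q, 1 <= lf j q &
  forall x, kap * `|x| <= lf i x -> kap * `|x| <= lf j x -> kap * `|x| <= B x q].

Let posR : 3 <= #|pos|%:R :> R. Proof. by rewrite ler_nat. Qed.

Let Q_vec i j a g : pos i -> pos j -> 1 <= (vec i j a g) 0 i ^+ 2 -> 1 <= Q (vec i j a g).
Proof.
move=> pi pj /le_trans; apply; apply: Q_pos => // k /negbTE pk.
by rewrite mxE pk.
Qed.

Lemma center_exists (i j : simplex) : exists q, center i j q.
Proof.
have [i0 p0] : exists i0, pos i0.
  by case: (pickP pos) => [i0 ?|p0]; [exists i0|move: pos3; rewrite eq_card0].
case: i j => [[i pi]|] [[j pj]|].
- exists (vec i j 1 0); split.
  + by apply: vec_norm; rewrite normr1 normr0; lra.
  + by apply: Q_vec => //; rewrite mxE pi eqxx; case: eqP => _ /=; rewrite ?mulr0n ?mulr1n; lra.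
  + by rewrite /= mxE pi eqxx; case: eqP => _ /=; rewrite ?mulr0n ?mulr1n; lra.
  + by rewrite /= mxE pj eqxx; case: eqP => _ /=; rewrite ?mulr0n ?mulr1n; lra.
  + move=> x /=; rewrite B_vec // => h1 h2; have := normr_ge0 x; have := kap0; nra.
- exists (vec i i (3/2) 2); split.
  + by apply: vec_norm; rewrite !ger0_norm; lra.
  + by apply: Q_vec => //; rewrite mxE pi eqxx /= mulr1n; lra.
  + by rewrite /= mxE pi eqxx mulr1n; lra.
  + by rewrite /= sp_vec //; have := posR; lra.
  + move=> x /=; rewrite B_vec // => h1 h2; have := normr_ge0 x; have := kap0; nra.
- exists (vec j j (3/2) 2); split.
  + by apply: vec_norm; rewrite !ger0_norm; lra.
  + by apply: Q_vec => //; rewrite mxE pj eqxx /= mulr1n; lra.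
  + by rewrite /= sp_vec //; have := posR; lra.
  + by rewrite /= mxE pj eqxx mulr1n; lra.
  + move=> x /=; rewrite B_vec // => h1 h2; have := normr_ge0 x; have := kap0; nra.
- exists (vec i0 i0 0 1); split.
  + by apply: vec_norm; rewrite normr1 normr0; lra.
  + by apply: Q_vec => //; rewrite mxE p0 eqxx /= mulr1n; lra.
  + by rewrite /= sp_vec //; have := posR; lra.
  + by rewrite /= sp_vec //; have := posR; lra.
  + move=> x /=; rewrite B_vec // => h1 h2; have := normr_ge0 x; have := kap0; nra.
Qed.

(** Three cones, one of them the cone [None], meet because there are at least
    three positive coordinates. *)
Lemma triple_point (i j : simplex) : exists q, [/\ `|q| <= 11, 1 <= Q q,
  1 <= lf i q, 1 <= lf j q & 1 <= lf None q].
Proof.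
have [i0 p0] : exists i0, pos i0.
  by case: (pickP pos) => [i0 ?|p0]; [exists i0|move: pos3; rewrite eq_card0].
have one k : pos k -> exists q, [/\ `|q| <= 11, 1 <= Q q, 1 <= q 0 k & 1 <= lf None q].
  move=> pk; exists (vec k k (3/2) 2); split.
  - by apply: vec_norm; rewrite !ger0_norm; lra.
  - by apply: Q_vec => //; rewrite mxE pk eqxx /= mulr1n; lra.
  - by rewrite mxE pk eqxx mulr1n; lra.
  - by rewrite /= sp_vec //; have := posR; lra.
case: i j => [[i pi]|] [[j pj]|].
- exists (vec i j 4 3); split.
  + by apply: vec_norm; rewrite !ger0_norm; lra.
  + by apply: Q_vec => //; rewrite mxE pi eqxx; case: eqP => _ /=; rewrite ?mulr0n ?mulr1n; lra.
  + by rewrite /= mxE pi eqxx; case: eqP => _ /=; rewrite ?mulr0n ?mulr1n; lra.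
  + by rewrite /= mxE pj eqxx; case: eqP => _ /=; rewrite ?mulr0n ?mulr1n; lra.
  + by rewrite /= sp_vec //; have := posR; lra.
- by have [q [? ? ? ?]] := one i pi; exists q.
- by have [q [? ? ? ?]] := one j pj; exists q.
- by have [q [? ? ? ?]] := one i0 p0; exists q.
Qed.

Variables (K : fieldType) (f : 'rV[R]_m -> R).
Hypothesis f0 : f 0 = 0.
Hypothesis fQ : forall e, 0 < e -> exists2 d, 0 < d & forall x y, `|x| < d -> `|y| < d ->
  `|(f x - Q x) - (f y - Q y)| <= e * (`|x| + `|y|) * `|x - y|.

Let piece r (j : simplex) := ball (0 : 'rV[R]_m) r `&` [set x | 0 < f x] `&` [set x | kap * `|x| < lf j x].

(* Where [f] is positive the positive coordinates carry at least about half of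
   the sum of squares, so one of the forms [lf j] is large. *)
Let piece_cover (e r : R) x : e < 1/4 -> 0 <= e -> `|f x - Q x| <= e * `|x| ^+ 2 ->
  ball 0 r x -> 0 < f x -> exists j : simplex, piece r j x.
Proof.
move=> e14 e0 fe xr fx0; apply: contrapT => nj.
have xp : 0 < `|x|.
  by rewrite normr_gt0; apply: contraTneq fx0 => ->; rewrite f0 ltxx.
have nlf (j : simplex) : lf j x <= kap * `|x|.
  by rewrite leNgt; apply/negP => h; apply: nj; exists j.
set a := `|x| in xp fe nlf *.
have small i : pos i -> `|x 0 i| <= m%:R * kap * a.
  move=> pi; rewrite ler_norml; apply/andP; split; last first.
    apply: le_trans (nlf (Some (exist _ i pi))) _.
    have ka0 : 0 <= kap * a by rewrite mulr_ge0 // ltW.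
    rewrite -mulrA; have := mR3; nra.
  have := nlf None => /=; rewrite /sp (bigD1 i) //=.
  have : \sum_(k | pos k && (k != i)) x 0 k <= (m%:R - 1) * (kap * a).
    have h : \sum_(k | pos k && (k != i)) x 0 k <= \sum_(k | k != i) (kap * a).
      rewrite [leRHS](bigID pos) /=.
      rewrite -[leLHS]addr0; apply: lerD.
        under [X in _ <= X]eq_bigl do rewrite andbC.
        by apply: ler_sum => k /andP[pk _]; exact: (nlf (Some (exist _ k pk))).
      by apply: sumr_ge0 => k _; rewrite mulr_ge0 // ltW.
    apply: le_trans h _; rewrite sumr_const cardC1 card_ord -[leLHS]mulr_natl.
    by rewrite -subn1 natrB //; exact: leq_trans m3.
  by have := mR3; set c := kap * a; rewrite -mulrA -/c; lra.
have Spos : \sum_(i | pos i) x 0 i ^+ 2 <= m%:R * (m%:R * kap * a) ^+ 2.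
  have : \sum_(i | pos i) x 0 i ^+ 2 <= \sum_(i : 'I_m) (m%:R * kap * a) ^+ 2.
    rewrite [leRHS](bigID pos) /= -[leLHS]addr0; apply: lerD.
      apply: ler_sum => i pi; rewrite -[leLHS]real_normK ?num_real //.
      apply: lerXn2r; rewrite ?nnegrE //; last exact: small.
      by rewrite !mulr_ge0 // ltW.
    by apply: sumr_ge0 => i _; exact: sqr_ge0.
  by move=> /le_trans; apply; rewrite sumr_const card_ord -[leLHS]mulr_natl.
have QE : Q x = \sum_(i | pos i) x 0 i ^+ 2 - \sum_(i | ~~ pos i) x 0 i ^+ 2.
  rewrite /Q (bigID pos) /= -sumrN; congr (_ + _); apply: eq_bigr => i.
    by rewrite /sg => ->; rewrite mul1r.
  by rewrite /sg => /negbTE ->; rewrite mulN1r.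
have NE := row_norm_sqr_le x; rewrite (bigID pos) /= -/a in NE.
have mk : m%:R * (m%:R * kap * a) ^+ 2 <= a ^+ 2 / 16.
  rewrite !exprMn /kap; have := mR3; set M := m%:R => M3.
  have M0 : 0 < M by lra.
  have -> : M * (M ^+ 2 * (16 * M ^+ 2)^-1 ^+ 2 * a ^+ 2) = a ^+ 2 * (256 * M)^-1.
    by field; rewrite gt_eqF.
  rewrite ler_wpM2l ?sqr_ge0 // lef_pV2 ?posrE; lra.
move: fe; rewrite ler_norml => /andP[_ fe].
have : e * a ^+ 2 <= 1 / 4 * a ^+ 2 by rewrite ler_wpM2r ?sqr_ge0 // ltW.
have : 0 < a ^+ 2 by rewrite exprn_gt0.
lra.
Qed.

(* The error terms allow any small multiple of [kap]; the radius of the ball is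
   scaled by [32] so that a centre of norm at most [11] stays in its half. *)
Let eps : R := kap / 100 / 100.
Let eps0 : 0 < eps. Proof. by rewrite !divr_gt0. Qed.

Let center_in (r : R) q : 0 < r -> `|q| <= 11 -> 1 <= Q q ->
  `|f ((r / 32) *: q) - Q ((r / 32) *: q)| <= eps * `|(r / 32) *: q| ^+ 2 ->
  0 < f ((r / 32) *: q) /\ ball 0 r ((r / 32) *: q).
Proof.
move=> r0 q11 Qq; have s0 : 0 <= r / 32 by rewrite divr_ge0 // ltW.
have -> : Q ((r / 32) *: q) = (r / 32) ^+ 2 * Q q.
  have := Qcomb (r / 32) 0 q 0; rewrite scaler0 addr0 => ->.
  by rewrite mulr0 mul0r expr0n mul0r !addr0.
rewrite -ball_normE /= sub0r normrN normrZ ger0_norm // [(_ * `|q|) ^+ 2]exprMn => fe; split.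
  move: fe; rewrite ler_norml => /andP[+ _].
  have N1 : `|q| ^+ 2 <= 11 ^+ 2 by apply: lerXn2r; rewrite ?nnegrE.
  have e1 : eps * `|q| ^+ 2 < 1.
    have : eps * `|q| ^+ 2 <= eps * 11 ^+ 2 by rewrite ler_wpM2l // ltW.
    by have := kap11; rewrite /eps; lra.
  have : 0 < (r / 32) ^+ 2 by rewrite exprn_gt0 // divr_gt0.
  set S := (r / 32) ^+ 2; move: N1 e1; set P := `|q| ^+ 2 => N1 e1 S0 fe'.
  have : S * (eps * P) < S * 1 by rewrite ltr_pM2l.
  have : S * 1 <= S * Q q by rewrite ler_pM2l.
  lra.
have : r / 32 * `|q| <= r / 32 * 11 by rewrite ler_wpM2l.
lra.
Qed.

Let piece_star (r d : R) (i j : simplex) q : 0 < r -> r < d ->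
  (forall x y, `|x| < d -> `|y| < d ->
    `|(f x - Q x) - (f y - Q y)| <= eps * (`|x| + `|y|) * `|x - y|) ->
  center i j q -> star_shaped (piece r i `&` piece r j) ((r / 32) *: q).
Proof.
move=> r0 rd fd [q11 Qq liq ljq Bq]; set c := _ *: q.
have s0 : 0 < r / 32 by rewrite divr_gt0.
have d0 : 0 < d by exact: lt_trans rd.
have fx x : `|x| < d -> `|f x - Q x| <= eps * `|x| ^+ 2.
  move=> xd; have := fd x 0 xd; rewrite normr0 addr0 subr0 => /(_ d0).
  have -> : Q 0 = 0 by rewrite /Q big1 // => k _; rewrite mxE expr0n mulr0.
  by rewrite f0 !subr0 -mulrA -expr2.
have cr : `|c| <= r / 2.
  rewrite normrZ gtr0_norm //.
  have : r / 32 * `|q| <= r / 32 * 11 by rewrite ler_pM2l.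
  lra.
have cd : `|c| < d by apply: le_lt_trans cr _; lra.
have [fc cb] := center_in r0 q11 Qq (fx _ cd).
have QcE : Q c = (r / 32) ^+ 2 * Q q.
  have := Qcomb (r / 32) 0 q 0; rewrite scaler0 addr0 => ->.
  by rewrite mulr0 mul0r expr0n mul0r !addr0.
have Qc : r ^+ 2 / 32 / 32 <= Q c.
  rewrite QcE; have : (r / 32) ^+ 2 * 1 <= (r / 32) ^+ 2 * Q q by rewrite ler_wpM2l // sqr_ge0.
  lra.
have lfZ (l : simplex) : lf l c = r / 32 * lf l q.
  have := lfC l (r / 32) 0 q 0; rewrite scaler0 addr0 => ->.
  by rewrite mul0r addr0.
have lc (l : simplex) : 1 <= lf l q -> kap * `|c| < lf l c.
  move=> lq; rewrite lfZ normrZ (gtr0_norm s0) mulrCA ltr_pM2l //.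
  apply: lt_le_trans lq; apply: le_lt_trans kap11; rewrite [leRHS]mulrC.
  by rewrite ler_pM2l.
split; first by split; split => //; exact: lc.
move=> x t [[[xb fx0] lix] [_ ljx]] /andP[t0 t1].
set xt := c + _.
have xtE : xt = t *: x + (1 - t) *: c.
  by apply/rowP => k; rewrite !mxE; ring.
have u0 : 0 <= 1 - t by rewrite subr_ge0.
have lxt (l : simplex) : kap * `|x| < lf l x -> 1 <= lf l q -> kap * `|xt| < lf l xt.
  move=> lx /lc lc'; rewrite xtE lfC.
  have h : `|xt| <= t * `|x| + (1 - t) * `|c|.
    by rewrite xtE; apply: le_trans (ler_normD _ _) _; rewrite !normrZ (ger0_norm t0) (ger0_norm u0).
  rewrite xtE in h.
  have : kap * `|t *: x + (1 - t) *: c| <= t * (kap * `|x|) + (1 - t) * (kap * `|c|).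
    have -> : t * (kap * `|x|) + (1 - t) * (kap * `|c|) = kap * (t * `|x| + (1 - t) * `|c|) by ring.
    by rewrite ler_pM2l.
  move/le_lt_trans; apply.
  have [->|tn0] := eqVneq t 0; first by rewrite !mul0r subr0 !mul1r !add0r.
  apply: ltr_leD; last by rewrite ler_wpM2l // ltW.
  by rewrite ltr_pM2l // lt_def tn0.
have xbt : ball 0 r xt by apply: convex_ball; rewrite // t0 t1.
suff fxt : 0 < f xt by split; split => //; exact: lxt.
move: xb xbt; rewrite -!ball_normE /= !sub0r !normrN => xr xtr.
have txd : `|t *: x| < d.
  rewrite normrZ ger0_norm //; apply: le_lt_trans (_ : `|x| < d); last exact: lt_trans rd.
  by rewrite ler_piMl.
have xd : `|x| < d by exact: lt_trans rd.
have E1 := fd _ _ (lt_trans xtr rd) txd.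
have E2 := fd _ _ txd xd.
have E3 := fx _ xd.
have n1 : xt - t *: x = (1 - t) *: c by rewrite xtE addrC addKr.
have n2 : t *: x - x = - ((1 - t) *: x).
  by apply/rowP => k; rewrite !mxE; ring.
rewrite n1 [`|t *: x|]normrZ [`|(1 - t) *: c|]normrZ (ger0_norm t0) (ger0_norm u0) in E1.
rewrite n2 normrN !normrZ (ger0_norm t0) (ger0_norm u0) in E2.
have nxt : `|xt| <= t * `|x| + (1 - t) * `|c|.
  by rewrite xtE; apply: le_trans (ler_normD _ _) _; rewrite !normrZ (ger0_norm t0) (ger0_norm u0).
have Bc : kap * `|x| * (r / 32) <= B x c.
  have -> : B x c = r / 32 * B x q.
    by rewrite /B mulr_sumr; apply: eq_bigr => k _; rewrite !mxE; ring.
  rewrite mulrC ler_pM2l //; apply: Bq; exact: ltW.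
have Qxt : Q xt = t ^+ 2 * Q x + 2 * t * (1 - t) * B x c + (1 - t) ^+ 2 * Q c.
  by rewrite xtE Qcomb.
move: E1 E2 E3; rewrite !ler_norml => /andP[E1 _] /andP[E2 _] /andP[E3 _].
rewrite /= in fx0.
move: (normr_ge0 x) (normr_ge0 c) E1 E2 E3 nxt Bc Qxt cr Qc xr.
set a := `|x|; set p := `|c|; set X := `|xt|.
set Ext := f xt - Q xt; set Etx := f (t *: x) - _; set Ex := f x - Q x; set b := B x c.
move=> a0 p0 E1 E2 E3 nxt Bc Qxt pr Qc ar.
have -> : f xt = Ext + Q xt by rewrite /Ext subrK.
rewrite Qxt; apply: (segment_estimate kap0 kap11 t0 t1 r0 a0 p0 _ E1 E2 E3 nxt Bc pr Qc ar).
by rewrite /Ex subrK.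
Qed.

(** Near a nondegenerate critical point with at least three positive
    directions, the superlevel set is a union of stars with the intersection
    pattern of the vertices of a simplex of dimension at least three. *)
Lemma saddle_monodromy_free : exists2 d, 0 < d & forall r, 0 < r < d ->
  let S := ball (0 : 'rV[R]_m) r `&` [set x | 0 < f x] in open S ->
  [/\ S !=set0, connected S & monodromy_free K S].
Proof.
have [d d0 fd] := fQ eps0; exists d => // r /andP[r0 rd] S oS.
have fx x : `|x| < r -> `|f x - Q x| <= eps * `|x| ^+ 2.
  move=> xr; have := fd x 0 (lt_trans xr rd); rewrite normr0 addr0 subr0 => /(_ d0).
  have -> : Q 0 = 0 by rewrite /Q big1 // => k _; rewrite mxE expr0n mulr0.
  by rewrite f0 !subr0 -mulrA -expr2.
have SE : S = \bigcup_(j : simplex) piece r j.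
  apply/seteqP; split=> [x [xr fx0]|x [j _ [Sx _]]] //.
  have xr' : `|x| < r by move: xr; rewrite -ball_normE /= sub0r normrN.
  have [||j jx] := piece_cover _ _ (fx _ xr') xr fx0; last by exists j.
  - by rewrite /eps; have := kap11; lra.
  - exact: ltW.
have cone_open (j : simplex) : open [set x | kap * `|x| < lf j x].
  have -> : [set x | kap * `|x| < lf j x] = (fun x => lf j x - kap * `|x|) @^-1` [set y | 0 < y].
    by apply/seteqP; split => x /=; rewrite subr_gt0.
  apply: open_comp; last exact: open_gt.
  move=> x _; have cl : lf j y @[y --> x] --> lf j x.
    case: j => [i|]; first exact: (@coord_continuous R 1 m 0 (val i) x).
    have cs : sp y @[y --> x] --> sp x.
      apply: (@cvg_big _ _ _ _ _ (@add_continuous R) _ (nbhs x)) => i _.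
      exact: (@coord_continuous R 1 m 0 i x).
    exact: cvgN cs.
  have cn : kap * `|y| @[y --> x] --> kap * `|x|.
    exact: cvgM (cvg_cst _) (@norm_continuous _ _ x).
  exact: cvgB cl cn.
have oP (j : simplex) : open (piece r j) by exact: openI.
have starP (i j : simplex) : exists q, star_shaped (piece r i `&` piece r j) q.
  have [q qc] := center_exists i j; exists ((r / 32) *: q).
  exact: piece_star r0 rd fd qc.
have meet (i j : simplex) : piece r i `&` piece r j `&` piece r None !=set0.
  have [q [q11 Qq liq ljq lnq]] := triple_point i j.
  have qr : `|(r / 32) *: q| < r.
    rewrite normrZ gtr0_norm ?divr_gt0 //.
    have : r / 32 * `|q| <= r / 32 * 11 by rewrite ler_pM2l // divr_gt0.
    lra.
  have [fc cb] := center_in r0 q11 Qq (fx _ qr).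
  have lc (l : simplex) : 1 <= lf l q -> kap * `|(r / 32) *: q| < lf l ((r / 32) *: q).
    move=> lq; have := lfC l (r / 32) 0 q 0; rewrite scaler0 addr0 => ->.
    rewrite mul0r addr0 normrZ gtr0_norm ?divr_gt0 // mulrCA ltr_pM2l ?divr_gt0 //.
    apply: lt_le_trans lq; apply: le_lt_trans kap11; rewrite [leRHS]mulrC.
    by rewrite ler_pM2l.
  by exists ((r / 32) *: q); split; [split|]; split => //; exact: lc.
have cP (i j : simplex) : connected (piece r i `&` piece r j).
  by have [q] := starP i j; exact: star_connected.
split.
- have [z [_ [Sz _]]] := meet None None; by exists z.
- rewrite SE; apply: bigcup_pairwise_connected.
    by move=> j; rewrite -[piece r j]setIid.
  by move=> i j; have [z [? _]] := meet i j; exists z.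
- rewrite SE; apply: (monodromy_free_bigcup (j0 := None)) => //.
  by move=> j; have [q] := starP j j; rewrite setIid; exact: star_monodromy_free.
Qed.
End Cones.

(** * Superlevel sets of submersions *)

Section Submersion.
Variables (R : realType) (m : nat) (l : 'I_m -> R) (i0 : 'I_m).
Variables (K : fieldType) (f : 'rV[R]_m -> R).
Let L (x : 'rV[R]_m) := \sum_i l i * x 0 i.
Hypotheses (li0 : l i0 != 0) (f0 : f 0 = 0).
Hypothesis fL : forall e, 0 < e -> exists2 d, 0 < d & forall x y, `|x| < d -> `|y| < d ->
  `|(f x - L x) - (f y - L y)| <= e * `|x - y|.

(** Near a noncritical point the superlevel set is star-shaped about a point
    above the level set: along a segment from a point [x] to it, either [f]
    increases, or the whole segment lies high enough for the linear part to
    dominate. *)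
Lemma submersion_monodromy_free : exists2 d, 0 < d & forall r, 0 < r < d ->
  let S := ball (0 : 'rV[R]_m) r `&` [set x | 0 < f x] in open S ->
  [/\ S !=set0, connected S & monodromy_free K S].
Proof.
pose ell := `|l i0|; have ell0 : 0 < ell by rewrite normr_gt0.
have LC t s x y : L (t *: x + s *: y) = t * L x + s * L y.
  by rewrite /L !mulr_sumr -big_split; apply: eq_bigr => i _; rewrite !mxE /=; ring.
have [|d d0 fd] := fL (e := ell / 16); first by rewrite divr_gt0.
exists d => // r /andP[r0 rd] S oS.
pose q : 'rV[R]_m := (r / 2 * Num.sg (l i0)) *: delta_mx 0 i0.
have Lq : L q = ell * (r / 2).
  rewrite /L (bigD1 i0) //= big1 ?addr0 => [|i /negbTE ii0].
    by rewrite !mxE !eqxx /= mulr1 mulrCA [l i0 * _]mulrC -normrEsg mulrC.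
  by rewrite !mxE ii0 andbF mulr0n !mulr0.
have nq : `|q| <= r / 2.
  apply: row_norm_le => [|i]; first by rewrite divr_ge0 // ltW.
  have r20 : 0 <= r / 2 by rewrite divr_ge0 // ltW.
  rewrite !mxE eqxx /= normrM [`|r / 2 * _|]normrM normr_sg li0 mulr1 (ger0_norm r20).
  by case: eqP => _ /=; rewrite ?mulr1n ?mulr0n ?normr1 ?normr0 ?mulr1 ?mulr0.
have ballE x : ball 0 r x = (`|x| < r) :> Prop by rewrite -ball_normE /= sub0r normrN.
have fx x : `|x| < r -> L x - ell / 16 * `|x| <= f x.
  move=> xr; have := fd x 0 (lt_trans xr rd); rewrite normr0 subr0 => /(_ d0).
  have -> : L 0 = 0 by rewrite /L big1 // => k _; rewrite mxE mulr0.
  by rewrite f0 !subr0 ler_norml => /andP[]; lra.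
have qr : `|q| < r by apply: le_lt_trans nq _; lra.
have Sq : S q.
  split; rewrite ?ballE //=; apply: lt_le_trans (fx _ qr); rewrite Lq.
  have := normr_ge0 q; nra.
have star : star_shaped S q.
  split=> // x t [xr fx0] /andP[t0 t1]; set xt := q + _.
  have xb : ball 0 r xt by apply: convex_ball; rewrite ?ballE ?t0 // -ballE.
  rewrite ballE in xr; split => //; rewrite ballE in xb; rewrite /= in fx0 *.
  have xtE : xt = t *: x + (1 - t) *: q by apply/rowP => k; rewrite !mxE; ring.
  have Lxt : L xt = t * L x + (1 - t) * (ell * (r / 2)) by rewrite xtE LC Lq.
  have u0 : 0 <= 1 - t by rewrite subr_ge0.
  have er : 0 < ell * r by rewrite mulr_gt0.
  have [Lx|Lx] := ltP (L x) (ell * r / 4).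
    apply: lt_le_trans fx0 _.
    have := fd _ _ (lt_trans xb rd) (lt_trans xr rd).
    have -> : xt - x = (1 - t) *: (q - x) by rewrite xtE; apply/rowP => k; rewrite !mxE; ring.
    rewrite normrZ (ger0_norm u0) ler_norml => /andP[+ _].
    have qx : `|q - x| <= 2 * r.
      by apply: le_trans (ler_normB _ _) _; lra.
    have h1 : ell / 16 * ((1 - t) * `|q - x|) <= (1 - t) * (ell * r / 8).
      rewrite mulrCA ler_wpM2l // -[ell * r / 8](_ : ell / 16 * (2 * r) = _); last by field.
      by rewrite ler_pM2l // divr_gt0.
    have h2 : (1 - t) * (ell * r / 4) <= (1 - t) * (ell * (r / 2) - L x).
      by rewrite ler_wpM2l //; lra.
    have h3 : 0 <= (1 - t) * (ell * r / 8) by rewrite mulr_ge0 // divr_ge0 // ltW.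
    rewrite Lxt; lra.
  apply: lt_le_trans (fx _ xb); rewrite Lxt.
  have h1 : t * (ell * r / 4) <= t * L x by rewrite ler_wpM2l.
  have h2 : (1 - t) * (ell * r / 4) <= (1 - t) * (ell * (r / 2)) by rewrite ler_wpM2l //; lra.
  have h3 : ell / 16 * `|xt| <= ell / 16 * r by rewrite ler_pM2l ?divr_gt0 // ltW.
  lra.
split; first by exists q.
  exact: star_connected star.
exact: star_monodromy_free oS star.
Qed.
End Submersion.

(** * First and second order estimates *)

Section PartialDerivatives.
Variables (R : realType) (m : nat).
Implicit Types (f g : 'rV[R]_m -> R) (x y z p : 'rV[R]_m) (i j : 'I_m).
Local Notation e_ i := (delta_mx 0 i : 'rV[R]_m).
Local Notation derivable_i g x i := (derivable (g : 'rV[R]_m -> R^o) x (e_ i)).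

Lemma is_derive_line g z i t : derivable_i g (z + t *: e_ i) i ->
  is_derive t (1 : R) (fun s : R => g (z + s *: e_ i)) (partial i g (z + t *: e_ i)).
Proof.
move=> dg.
have E : (fun h : R => h^-1 *: (((fun s : R => g (z + s *: e_ i)) \o shift t) (h *: (1 : R)) - g (z + t *: e_ i)))
       = (fun h => h^-1 *: ((g \o shift (z + t *: e_ i)) (h *: e_ i) - g (z + t *: e_ i))).
  apply/funext => h /=; congr (_ *: (g _ - _)).
  by rewrite [h *: 1]mulr1 scalerDl addrCA.
apply: DeriveDef; first by rewrite /derivable E.
by rewrite /partial /derive E.
Qed.

Lemma mvt_line g z i h : 0 <= h ->
  (forall t, 0 <= t <= h -> derivable_i g (z + t *: e_ i) i) ->
  exists2 t, 0 <= t <= h & g (z + h *: e_ i) - g z = partial i g (z + t *: e_ i) * h.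
Proof.
move=> h0 dg; pose phi (s : R) := g (z + s *: e_ i).
have dphi t : 0 <= t <= h -> is_derive t (1 : R) phi (partial i g (z + t *: e_ i)).
  by move=> th; apply: is_derive_line; exact: dg.
have [||t th E] := @MVT_segment R phi (fun t => partial i g (z + t *: e_ i)) 0 h h0.
- by move=> t; rewrite in_itv /= => /andP[/ltW a /ltW b]; apply: dphi; rewrite a b.
- apply: derivable_within_continuous => t; rewrite in_itv /= => th.
  by have [] := dphi _ th.
- exists t; first by move: th; rewrite in_itv.
  by move: E; rewrite /phi scale0r addr0 subr0.
Qed.

Lemma partial_bound_line g z i h M :
  (forall t, 0 <= t <= 1 -> derivable_i g (z + (t * h) *: e_ i) i /\
     `|partial i g (z + (t * h) *: e_ i)| <= M) ->
  `|g (z + h *: e_ i) - g z| <= M * `|h|.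
Proof.
have pos z' h' : 0 <= h' -> (forall t, 0 <= t <= 1 -> derivable_i g (z' + (t * h') *: e_ i) i /\
     `|partial i g (z' + (t * h') *: e_ i)| <= M) ->
  `|g (z' + h' *: e_ i) - g z'| <= M * `|h'|.
  move=> h0 dg.
  have [->|hn0] := eqVneq h' 0; first by rewrite scale0r addr0 subrr !normr0 mulr0.
  have hp : 0 < h' by rewrite lt_def hn0.
  have scl t : 0 <= t <= h' -> 0 <= t / h' <= 1 /\ t / h' * h' = t.
    move=> /andP[t0 th]; rewrite divfK //; split => //.
    by rewrite divr_ge0 // ler_pdivrMr // mul1r.
  have [t th|t th ->] := @mvt_line g z' i h' h0.
    by have [t1 tE] := scl t th; have [] := dg _ t1; rewrite tE.
  rewrite normrM ler_wpM2r //.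
  by have [t1 tE] := scl t th; have [_] := dg _ t1; rewrite tE.
have [h0|h0] := leP 0 h; first exact: pos.
move=> dg; rewrite distrC -[`|h|]normrN.
have {1}-> : z = (z + h *: e_ i) + (- h) *: e_ i by rewrite scaleNr addrK.
apply: pos; first by rewrite oppr_ge0 ltW.
move=> t /andP[t0 t1]; have := dg (1 - t); rewrite subr_ge0 t1 lerBlDr lerDl t0.
move=> /(_ isT).
by rewrite -addrA -scalerDl (_ : (1 - t) * h = h + t * - h) //; ring.
Qed.

(** The segment from [y] to [x] is replaced by a path parallel to the axes, which
    stays in the ball because the norm is the sup norm. *)
Lemma partial_bound_ball g p (d M : R) :
  (forall z i, ball p d z -> derivable_i g z i /\ `|partial i g z| <= M) ->
  forall x y, ball p d x -> ball p d y -> `|g x - g y| <= m%:R * M * `|x - y|.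
Proof.
move=> dg x y xd yd.
pose z (k : nat) : 'rV[R]_m := \row_i (if (i < k)%N then x 0 i else y 0 i).
have z0 : z 0%N = y by apply/rowP => i; rewrite mxE.
have zm : z m = x by apply/rowP => i; rewrite mxE ltn_ord.
have -> : g x - g y = \sum_(k < m) (g (z k.+1) - g (z k)).
  by rewrite -{1}zm -{1}z0 -(telescope_sumr (fun k => g (z k))) // big_mkord.
apply: le_trans (ler_norm_sum _ _ _) _.
rewrite -mulrA mulr_natl -[X in _ *+ X]card_ord -sumr_const; apply: ler_sum => k _.
have zS : z k.+1 = z k + (x 0 k - y 0 k) *: e_ k.
  apply/rowP => i; rewrite !mxE eqxx /= ltnS leq_eqVlt -val_eqE /=.
  case: eqP => [/val_inj -> |_] /=; last by rewrite mulr0 addr0.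
  by rewrite ltnn mulr1 addrC subrK.
have dk : `|x 0 k - y 0 k| <= `|x - y|.
  by have := row_norm_ge (x - y) k; rewrite !mxE.
have [M0|M0] := ltP M 0.
  have [_] := dg x k xd; move=> /le_lt_trans /(_ M0).
  by rewrite ltNge normr_ge0.
apply: le_trans (_ : M * `|x 0 k - y 0 k| <= _); last by rewrite ler_wpM2l.
rewrite zS; apply: partial_bound_line => t /andP[t0 t1]; apply: dg.
have [dp xd'] := xd; have [_ yd'] := yd.
split=> // i' i; rewrite ord1 !mxE eqxx /=.
have := xd' 0 i; have := yd' 0 i; rewrite -!ball_normE /=.
have [->|ik] := eqVneq i k; last first.
  by rewrite mulr0 addr0; case: ifP.
rewrite ltnn mulr1 !ltr_norml => /andP[y1 y2] /andP[x1 x2].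
have [xy|xy] := leP (x 0 k) (y 0 k); apply/andP; split.
- have : t * (y 0 k - x 0 k) <= y 0 k - x 0 k by rewrite ler_piMl // subr_ge0.
  have : 0 <= t * (y 0 k - x 0 k) by rewrite mulr_ge0 // subr_ge0.
  lra.
- have : t * (y 0 k - x 0 k) <= y 0 k - x 0 k by rewrite ler_piMl // subr_ge0.
  lra.
- have : t * (x 0 k - y 0 k) <= x 0 k - y 0 k by rewrite ler_piMl // subr_ge0 ltW.
  lra.
- have : 0 <= t * (x 0 k - y 0 k) by rewrite mulr_ge0 // subr_ge0 ltW.
  lra.
Qed.

Lemma is_derive_quadratic g z i (a b : R) :
  (forall h, g (h *: e_ i + z) - g z = h * a + h ^+ 2 * b) ->
  derivable_i g z i /\ partial i g z = a.
Proof.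
move=> gE.
have cv : (fun h : R => a + h * b) @ (0 : R)^' --> a.
  rewrite -[X in _ --> X]addr0 -[X in _ --> a + X](mul0r b).
  apply: cvg_within_filter; apply: cvgD; first exact: cvg_cst.
  by apply: cvgM; [exact: cvg_id|exact: cvg_cst].
have cv' : (fun h : R => h^-1 *: ((g \o shift z) (h *: e_ i) - g z)) @ (0 : R)^' --> a.
  apply: cvg_trans cv; apply: near_eq_cvg; near=> h.
  have h0 : h != 0 by near: h; exact: nbhs_dnbhs_neq.
  rewrite /= gE /GRing.scale /=; field.
  exact: h0.
split; first exact: cvgP cv'.
exact: (@cvg_lim R^o).
Unshelve. all: by end_near. Qed.

Lemma derivable_iB f g z i : derivable_i f z i -> derivable_i g z i ->
  derivable_i (fun x => f x - g x) z i /\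
  partial i (fun x => f x - g x) z = partial i f z - partial i g z.
Proof.
move=> df dg; split; first exact: derivableB.
exact: (@deriveB R 'rV[R]_m R^o f g z (e_ i) df dg).
Qed.

Lemma derivable_iD f z p i : derivable_i f (p + z) i ->
  derivable_i (fun x => f (p + x)) z i /\
  partial i (fun x => f (p + x)) z = partial i f (p + z).
Proof.
have E : (fun h : R => h^-1 *: (((fun x => f (p + x)) \o shift z) (h *: e_ i) - f (p + z)))
       = (fun h => h^-1 *: ((f \o shift (p + z)) (h *: e_ i) - f (p + z))).
  by apply/funext => h /=; rewrite addrCA.
by move=> df; split; rewrite /derivable /partial /derive E.
Qed.

Definition lin (l : 'I_m -> R) x := \sum_i l i * x 0 i.

Lemma partial_lin l z i : derivable_i (lin l) z i /\ partial i (lin l) z = l i.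
Proof.
apply: (@is_derive_quadratic _ _ _ _ 0) => h; rewrite mulr0 addr0 /lin -sumrB.
rewrite (bigD1 i) //= big1 ?addr0 => [|j /negbTE ji]; first by rewrite !mxE !eqxx /= mulr1n; ring.
by rewrite !mxE ji andbF /= mulr0n; ring.
Qed.

Definition grad f p i := partial i f p.

(** The partial derivatives of [f] minus its linear part are small near [p], so
    the mean value estimate applies to the difference of two values. *)
Lemma strict_differentiability f p (D : set 'rV[R]_m) : open D -> D p -> Ck_on 1 D f ->
  forall e, 0 < e -> exists2 d, 0 < d & forall x y, `|x| < d -> `|y| < d ->
  `|(f (p + x) - lin (grad f p) x) - (f (p + y) - lin (grad f p) y)| <= e * `|x - y|.
Proof.
move=> oD Dp [_ [df cf]] e e0.
pose M := e / (m%:R + 1).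
have m1 : 0 < m%:R + 1 :> R by rewrite ltr_wpDl.
have M0 : 0 < M by rewrite divr_gt0.
have /nbhs_ballP[d /= d0 dP] : \forall z \near p, D z /\ forall i, `|partial i f p - partial i f z| <= M.
  apply: filterI; first exact: open_nbhs_nbhs.
  apply: (@filter_forall _ _ (fun i z => `|partial i f p - partial i f z| <= M) (nbhs p)) => i.
  have [ci _] := cf i.
  exact: (iffLR (@cvgrPdist_le R R^o _ (nbhs p) _ _ _) (ci p Dp) _ M0).
exists d => // x y xd yd.
have toball z : `|z| < d -> ball (0 : 'rV[R]_m) d z by rewrite -ball_normE /= sub0r normrN.
have := @partial_bound_ball (fun x => f (p + x) - lin (grad f p) x) 0 d M _ x y (toball _ xd) (toball _ yd).
move=> h; apply: le_trans (h _) _ => [z i zd|].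
  have pz : ball p d (p + z).
    by move: zd; rewrite -!ball_normE /= opprD addrA subrr.
  have [Dpz pM] := dP _ pz.
  have [d1 E1] := derivable_iD (df _ i Dpz).
  have [d2 E2] := partial_lin (grad f p) z i.
  have [d3 E3] := derivable_iB d1 d2.
  by split => //; rewrite E3 E1 E2 distrC; exact: pM.
rewrite ler_wpM2r // /M mulrA ler_pdivrMr // mulrC ler_pM2l // lerDl.
exact: ler01.
Qed.

Lemma unit_norm (i : 'I_m) (h : R) : `|h *: e_ i| <= `|h|.
Proof.
apply: row_norm_le => // j; rewrite !mxE eqxx /= normrM ler_piMr //.
by case: eqP => _ /=; rewrite ?normr1 ?normr0.
Qed.

(** The second difference of [f] in the directions [i] and [j] is, by the mean
    value theorem in direction [i], [h ^+ 2] times the derivative of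
    [partial i f] in direction [j], up to [o(h ^+ 2)]. *)
Lemma second_difference f p (D : set 'rV[R]_m) i j : open D -> D p -> Ck_on 2 D f ->
  forall e, 0 < e -> exists2 d, 0 < d & forall h, 0 < h < d ->
  `|f (p + h *: e_ i + h *: e_ j) - f (p + h *: e_ i) - f (p + h *: e_ j) + f p
     - hessian f p j i * h ^+ 2| <= e * h ^+ 2.
Proof.
move=> oD Dp [_ [df c1]] e e0.
have c1i := c1 i.
have [d1 d10 d1P] := strict_differentiability oD Dp c1i e0.
have /nbhs_ballP[d2 /= d20 d2P] : nbhs p D by exact: open_nbhs_nbhs.
exists (Num.min d1 d2 / 2); first by rewrite divr_gt0 // lt_min d10.
move=> h /andP[h0]; rewrite ltr_pdivlMr // lt_min => /andP[hd1 hd2].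
have small t : 0 <= t <= h -> `|t *: e_ i + h *: e_ j| <= h * 2 /\ `|t *: e_ i| <= h * 2.
  move=> /andP[t0 th].
  have := unit_norm i t; have := unit_norm j h; rewrite (ger0_norm t0) (gtr0_norm h0) => n1 n2.
  by split; [apply: le_trans (ler_normD _ _) _|]; lra.
have inD z : `|z| <= h * 2 -> D (p + z).
  move=> zh; apply: d2P; rewrite -ball_normE /= opprD addrA subrr sub0r normrN.
  exact: le_lt_trans hd2.
pose phi x := f (x + h *: e_ j) - f x.
have dphi t : 0 <= t <= h -> derivable_i phi (p + t *: e_ i) i /\
   partial i phi (p + t *: e_ i) = partial i f (p + t *: e_ i + h *: e_ j) - partial i f (p + t *: e_ i).
  move=> /small[s1 s2].
  have [] := @derivable_iD f (p + t *: e_ i) (h *: e_ j) i.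
    by rewrite [h *: _ + _]addrC -addrA; apply: df; exact: inD.
  have -> : (fun x => f (h *: e_ j + x)) = (fun x => f (x + h *: e_ j)).
    by apply/funext => x; rewrite addrC.
  rewrite [h *: e_ j + _]addrC => d1' E1.
  have [d2' E2] := derivable_iB d1' (df _ i (inD _ s2)).
  by rewrite /phi E2 E1.
have [t th E] : exists2 t, 0 <= t <= h & phi (p + h *: e_ i) - phi p = partial i phi (p + t *: e_ i) * h.
  by apply: mvt_line; [exact: ltW|move=> t /dphi[]].
have -> : f (p + h *: e_ i + h *: e_ j) - f (p + h *: e_ i) - f (p + h *: e_ j) + f p =
   phi (p + h *: e_ i) - phi p by rewrite /phi; ring.
rewrite E (dphi _ th).2.
have [s1 s2] := small _ th.
have := d1P _ _ (le_lt_trans s1 hd1) (le_lt_trans s2 hd1).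
have linD l x y : lin l (x + y) = lin l x + lin l y.
  by rewrite /lin -big_split; apply: eq_bigr => k _; rewrite mxE mulrDr.
have linj : lin (grad (partial i f) p) (h *: e_ j) = hessian f p j i * h.
  rewrite /lin (bigD1 j) //= big1 ?addr0 => [|k /negbTE kj].
    by rewrite !mxE !eqxx /= mulr1.
  by rewrite !mxE kj andbF /= !mulr0.
have -> : t *: e_ i + h *: e_ j - t *: e_ i = h *: e_ j by rewrite addrC addKr.
rewrite linD linj (addrA p).
set a := partial i f _; set b := partial i f _; set l := lin _ _; set H := hessian f p j i.
have -> : a - (l + H * h) - (b - l) = a - b - H * h by ring.
move=> le1; have -> : (a - b) * h - H * h ^+ 2 = (a - b - H * h) * h by ring.
rewrite normrM (gtr0_norm h0) expr2 mulrA ler_pM2r //.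
apply: le_trans le1 _; rewrite ler_pM2l //.
by have := unit_norm j h; rewrite (gtr0_norm h0).
Qed.

(** The second difference is symmetric in [i] and [j]. *)
Lemma hessian_sym f p (D : set 'rV[R]_m) : open D -> D p -> Ck_on 2 D f ->
  forall i j, hessian f p i j = hessian f p j i.
Proof.
move=> oD Dp c2 i j; apply/eqP; rewrite -subr_eq0 -normr_le0.
apply/ler_addgt0Pl => e e0; rewrite addr0.
have e2 : 0 < e / 2 by rewrite divr_gt0.
have [d1 d10 d1P] := second_difference i j oD Dp c2 e2.
have [d2 d20 d2P] := second_difference j i oD Dp c2 e2.
pose h := Num.min d1 d2 / 2.
have m0 : 0 < Num.min d1 d2 by rewrite lt_min d10.
have h0 : 0 < h by rewrite divr_gt0.
have hm : h < Num.min d1 d2 by rewrite ltr_pdivrMr // ltr_pMr // ltr1n.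
move: (hm); rewrite lt_min => /andP[hd1 hd2].
have := d1P h; rewrite h0 hd1 => /(_ isT).
have := d2P h; rewrite h0 hd2 => /(_ isT).
rewrite [p + h *: e_ j + h *: e_ i]addrAC.
set A := f (p + h *: e_ i + h *: e_ j); set X := f _; set Y := f _; set Z := f _.
have -> : A - Y - X + Z = A - X - Y + Z by ring.
set S := A - X - Y + Z => B1 B2.
have h2 : 0 < h ^+ 2 by rewrite exprn_gt0.
rewrite -(ler_pM2r h2) -[X in _ * X <= _](gtr0_norm h2) -normrM.
have -> : (hessian f p i j - hessian f p j i) * h ^+ 2 =
   (S - hessian f p j i * h ^+ 2) - (S - hessian f p i j * h ^+ 2) by ring.
apply: le_trans (ler_normB _ _) _; lra.
Qed.

(** By strict differentiability, each partial derivative of the remainder is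
    [o(`|z|)]; the mean value estimate on a ball of radius comparable to
    [`|x| + `|y|] concludes. *)
Lemma strict_second_order f p (D : set 'rV[R]_m) : open D -> D p -> Ck_on 2 D f ->
  (forall i, partial i f p = 0) ->
  forall e, 0 < e -> exists2 d, 0 < d & forall x y, `|x| < d -> `|y| < d ->
  `|(f (p + x) - 2^-1 * (x *m hessian f p *m x^T) 0 0)
    - (f (p + y) - 2^-1 * (y *m hessian f p *m y^T) 0 0)| <= e * (`|x| + `|y|) * `|x - y|.
Proof.
move=> oD Dp c2 crit e e0; have sym := hessian_sym oD Dp c2.
pose B x y := (x *m hessian f p *m y^T) 0 0.
have Bsum x y : B x y = \sum_i x 0 i * \sum_j hessian f p i j * y 0 j.
  rewrite /B -mulmxA mxE; apply: eq_bigr => i _; rewrite mxE; congr (_ * _).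
  by apply: eq_bigr => j _; rewrite !mxE.
have Bsym x y : B x y = B y x.
  rewrite !Bsum; under eq_bigr do rewrite mulr_sumr.
  rewrite exchange_big /=; apply: eq_bigr => i _; rewrite mulr_sumr.
  by apply: eq_bigr => j _; rewrite sym; ring.
have Be i y : B (e_ i) y = lin (fun j => hessian f p j i) y.
  rewrite Bsum (bigD1 i) //= [X in _ + X]big1 ?addr0 => [|k /negbTE ki].
    by rewrite !mxE !eqxx /= mul1r; apply: eq_bigr => j _; rewrite sym.
  by rewrite !mxE ki andbF /= mul0r.
have Bl h a z y : B (h *: a + z) y = h * B a y + B z y.
  by rewrite /B !mulmxDl -!scalemxAl !mxE.
pose Q x := 2^-1 * B x x.
have dQ z i : derivable_i Q z i /\ partial i Q z = lin (fun j => hessian f p j i) z.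
  rewrite -Be; apply: (@is_derive_quadratic _ _ _ _ (Q (e_ i))) => h.
  have -> : Q (h *: e_ i + z) = 2^-1 * (h ^+ 2 * B (e_ i) (e_ i) + h * B (e_ i) z + h * B z (e_ i) + B z z).
    by rewrite /Q Bl [B _ (h *: _ + _)]Bsym [B z (h *: _ + _)]Bsym !Bl; ring.
  by rewrite [B z (e_ i)]Bsym /Q; field.
have [[cf0 [df c1]] m0] : Ck_on 2 D f /\ 0 < m%:R + 1 :> R by split => //; rewrite ltr_wpDl.
pose e' := e / (2 * (m%:R + 1)).
have e'0 : 0 < e' by rewrite divr_gt0 // mulr_gt0.
have /nbhs_ballP[d0 /= d00 d0P] : nbhs p D by exact: open_nbhs_nbhs.
have [d d_0 dP] : exists2 d, 0 < d & forall i z, `|z| < d ->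
   `|partial i f (p + z) - lin (fun j => hessian f p j i) z| <= e' * `|z|.
  have /choice[d dP] : forall i, exists d, 0 < d /\ forall z, `|z| < d ->
    `|partial i f (p + z) - lin (fun j => hessian f p j i) z| <= e' * `|z|.
    move=> i; have [d d_0 dP] := strict_differentiability oD Dp (c1 i) e'0.
    exists d; split=> // z zd; have := dP z 0 zd; rewrite normr0 subr0 => /(_ d_0).
    rewrite addr0 crit; have -> : lin (grad (partial i f) p) 0 = 0.
      by rewrite /lin big1 // => j _; rewrite mxE mulr0.
    rewrite !subr0; congr (`|_ - _| <= _); apply: eq_bigr => j _.
    by rewrite /hessian mxE.
  exists (\big[Num.min/1]_i d i).
    by apply/bigmin_gtP; split => // i _; case: (dP i).
  move=> i z zd; case: (dP i) => _; apply; apply: lt_le_trans zd _.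
  exact: bigmin_le_cond.
exists (Num.min d0 d / 4); first by rewrite divr_gt0 // lt_min d00.
move=> x y; rewrite !ltr_pdivlMr // !lt_min => /andP[x1 x2] /andP[y1 y2].
pose r := 2 * (`|x| + `|y|).
have [r00|rn0] := eqVneq r 0.
  have [x0 y0] : `|x| = 0 /\ `|y| = 0.
    by have := normr_ge0 x; have := normr_ge0 y; move: r00; rewrite /r; split; lra.
  have -> : x = y by rewrite (normr0_eq0 x0) (normr0_eq0 y0).
  by rewrite !subrr !normr0 mulr0.
have r0 : 0 < r by rewrite lt_def rn0 mulr_ge0 // addr_ge0.
have nx := normr_ge0 x; have ny := normr_ge0 y.
have ballE z : ball (0 : 'rV[R]_m) r z = (`|z| < r) :> Prop by rewrite -ball_normE /= sub0r normrN.
have := @partial_bound_ball (fun z => f (p + z) - Q z) 0 r (e' * r) _ x y _ _.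
rewrite !ballE => h; apply: le_trans (h _ _ _) _ => [z i|||].
- rewrite ballE => zr.
  have zd : `|z| < d by apply: lt_trans zr _; rewrite /r; lra.
  have Dz : D (p + z).
    apply: d0P; rewrite -ball_normE /= opprD addrA subrr sub0r normrN.
    by apply: lt_trans zr _; rewrite /r; lra.
  have [d1 E1] := derivable_iD (df _ i Dz).
  have [d2 E2] := dQ z i; have [d3 E3] := derivable_iB d1 d2.
  split => //; rewrite E3 E1 E2; apply: le_trans (dP i z zd) _.
  by rewrite ler_pM2l // ltW.
- by move: r0; rewrite /r; lra.
- by move: r0; rewrite /r; lra.
rewrite ler_wpM2r //.
have -> : e * (`|x| + `|y|) = (m%:R + 1) * (e' * r).
  by rewrite /e' /r; field; rewrite gt_eqF.
by rewrite ler_wpM2r ?lerDl // mulr_ge0 // ltW.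
Qed.
End PartialDerivatives.

(** * Symmetric forms *)

Section SymmetricForms.
Variable R : realType.

Lemma sym_nonisotropic m (A : 'M[R]_m) : A^T = A -> A != 0 ->
  exists v : 'rV[R]_m, (v *m A *m v^T) 0 0 != 0.
Proof.
move=> As An0; apply: contrapT => iso.
have q0 (v : 'rV[R]_m) : (v *m A *m v^T) 0 0 = 0.
  by apply: contrapT => /eqP nv; apply: iso; exists v.
have eAe i j : ((delta_mx 0 i : 'rV[R]_m) *m A *m (delta_mx 0 j : 'rV[R]_m)^T) 0 0 = A i j.
  by rewrite -rowE trmx_delta -colE !mxE.
move/eqP: An0; apply; apply/matrixP => i j; rewrite mxE.
have := q0 (delta_mx 0 i + delta_mx 0 j).
have mxD (M N : 'M[R]_1) : (M + N) 0 0 = M 0 0 + N 0 0 by rewrite mxE.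
rewrite linearD /= !mulmxDl !mulmxDr !mxD !eAe.
have := q0 (delta_mx 0 i); have := q0 (delta_mx 0 j); rewrite !eAe => -> ->.
have -> : A j i = A i j by rewrite -{1}As mxE.
by rewrite add0r addr0 => /eqP; rewrite -mulr2n mulrn_eq0 /= => /eqP.
Qed.

(** By induction: a nonisotropic vector splits off as a direct summand. *)
Lemma sym_diagonalizable m (A : 'M[R]_m) : A^T = A ->
  exists2 T : 'M[R]_m, T \in unitmx & exists d : 'rV[R]_m, T *m A *m T^T = diag_mx d.
Proof.
elim: m A => [|m IH] A As.
  by exists 1%:M; rewrite ?unitmx1 //; exists 0; apply/matrixP => -[].
have [->|An0] := eqVneq A 0.
  by exists 1%:M; rewrite ?unitmx1 //; exists 0; rewrite mulmx0 mul0mx linear0.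
have [v vAv] := sym_nonisotropic As An0.
pose S := row_ebase v; have Su : S \in unitmx by exact: row_ebase_unit.
pose B := S *m A *m S^T.
have Bs : B^T = B by rewrite /B !trmx_mul trmxK As mulmxA.
have B00 : B 0 0 != 0.
  apply: contraNneq vAv => B0.
  pose w : 'rV[R]_m.+1 := pid_mx (\rank v) *m S.
  have vE : v = col_ebase v 0 0 *: w.
    by rewrite -{1}[v]mulmx_ebase {1}[col_ebase v]mx11_scalar mul_scalar_mx -scalemxAl.
  suff w0 : (w *m A *m w^T) 0 0 = 0.
    have mxZ c (M : 'M[R]_1) : (c *: M) 0 0 = c * M 0 0 by rewrite mxE.
    by rewrite vE linearZ /= -!scalemxAl -scalemxAr !mxZ w0 !mulr0.
  rewrite /w; case: (\rank v) (rank_leq_row v) => [|[|//]] _.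
    by rewrite pid_mx_0 !mul0mx mxE.
  have -> : pid_mx 1 = delta_mx 0 0 :> 'rV[R]_m.+1.
    apply/rowP => i; rewrite !mxE eqxx /= andbC.
    by case: (i =P 0) => [->|] //= /eqP; rewrite -val_eqE /= eq_sym => /negbTE ->.
  rewrite trmx_mul trmx_delta -!mulmxA.
  rewrite [S *m (A *m _)]mulmxA [S *m A *m _]mulmxA -/B -colE -rowE [LHS]mxE [LHS]mxE.
  exact: B0.
pose B' : 'M[R]_(1 + m) := B.
pose a := B 0 0; pose r := ursubmx B'; pose C0 := drsubmx B'.
have BE : B' = block_mx a%:M r r^T C0.
  rewrite -[LHS]submxK; congr block_mx.
    by rewrite [LHS]mx11_scalar; congr (_ %:M); rewrite [LHS]mxE [LHS]mxE /a /B'; congr (B _ _); apply/val_inj.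
  by rewrite /r trmx_ursub Bs.
pose E : 'M[R]_(1 + m) := block_mx 1%:M 0 ((- a^-1) *: r^T) 1%:M.
have C0s : C0^T = C0 by rewrite /C0 trmx_drsub Bs.
have /IH[T Tu [d Td]] : (C0 - a^-1 *: (r^T *m r))^T = C0 - a^-1 *: (r^T *m r).
  by rewrite linearB linearZ /= trmx_mul trmxK C0s.
pose D : 'M[R]_(1 + m) := block_mx 1%:M 0 0 T.
have Du : D \in unitmx by rewrite block_diag_mx_unit unitmx1.
have Eu : E \in unitmx by rewrite unitmxE det_lblock !det1 mulr1 unitr1.
exists (D *m E *m S : 'M[R]_m.+1).
  by rewrite !unitmx_mul Su andbT; apply/andP.
pose dd : 'rV[R]_(1 + m) := row_mx a%:M d.
have ddE : diag_mx dd = block_mx (diag_mx a%:M) 0 0 (diag_mx d) by exact: diag_mx_row.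
exists (dd : 'rV[R]_m.+1); suff : D *m E *m S *m A *m (D *m E *m S)^T =
    block_mx (diag_mx a%:M) 0 0 (diag_mx d) by rewrite -ddE.
have -> : D *m E *m S *m A *m (D *m E *m S)^T =
   D *m (E *m B' *m E^T) *m D^T.
  by rewrite !trmx_mul /B' /B !mulmxA.
have -> : E *m B' *m E^T = block_mx a%:M 0 0 (C0 - a^-1 *: (r^T *m r)).
  rewrite BE /E tr_block_mx !mulmx_block !trmx1 !trmx0 !mul1mx !mulmx1 !mul0mx !mulmx0 !addr0.
  rewrite linearZ /= trmxK -!scalemxAl -!scalemxAr mul_mx_scalar mul_scalar_mx !scalerA.
  rewrite mulNr mulVf // !scaleN1r !addNr mul0mx scaler0 add0r.
  by rewrite scaleNr addrC.
rewrite /D tr_block_mx !mulmx_block !trmx1 !trmx0 !mul1mx !mulmx1 !mul0mx !mulmx0 !addr0 !add0r.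
rewrite Td; congr block_mx; last by rewrite mul0mx.
by apply/matrixP => i j; rewrite !ord1 !mxE eqxx.
Qed.

Lemma sym_signature m (A : 'M[R]_m) : A^T = A -> A \in unitmx ->
  exists2 T : 'M[R]_m, T \in unitmx & exists pos : pred 'I_m, forall x : 'rV[R]_m,
    ((x *m T) *m A *m (x *m T)^T) 0 0 = \sum_i (if pos i then 1 else -1) * x 0 i ^+ 2.
Proof.
move=> As Au; have [T Tu [d Td]] := sym_diagonalizable As.
have d0 i : d 0 i != 0.
  have : diag_mx d \in unitmx by rewrite -Td !unitmx_mul unitmx_tr Tu Au.
  rewrite unitmxE det_diag unitfE => /prodf_neq0; exact.
pose s : 'rV[R]_m := \row_i (Num.sqrt `|d 0 i|)^-1.
have s0 i : Num.sqrt `|d 0 i| != 0 by rewrite gt_eqF // sqrtr_gt0 normr_gt0.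
exists (diag_mx s *m T).
  rewrite unitmx_mul Tu andbT unitmxE det_diag unitfE; apply/prodf_neq0 => i _.
  by rewrite mxE invr_eq0.
exists (fun i => 0 < d 0 i) => x.
have -> : (x *m (diag_mx s *m T)) *m A *m (x *m (diag_mx s *m T))^T =
    x *m diag_mx s *m diag_mx d *m (x *m diag_mx s)^T.
  by rewrite -Td !trmx_mul !mulmxA.
rewrite mul_mx_diag mul_mx_diag mxE; apply: eq_bigr => i _; rewrite !mxE.
have -> : x 0 i / Num.sqrt `|d 0 i| * d 0 i * (x 0 i / Num.sqrt `|d 0 i|) =
  d 0 i * (Num.sqrt `|d 0 i| ^+ 2)^-1 * x 0 i ^+ 2 by field.
rewrite sqr_sqrtr //; congr (_ * _); case: ltP => di.
  by rewrite gtr0_norm // mulfV.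
by rewrite ler0_norm // invrN mulrN mulfV.
Qed.

Definition neg_def m (A : 'M[R]_m) (W : {vspace 'rV[R]_m}) :=
  forall v, v \in W -> v != 0 -> (v *m A *m v^T) 0 0 < 0.

Lemma neg_space m (A T : 'M[R]_m) (pos : pred 'I_m) : T \in unitmx ->
  (forall x : 'rV[R]_m,
    ((x *m T) *m A *m (x *m T)^T) 0 0 = \sum_i (if pos i then 1 else -1) * x 0 i ^+ 2) ->
  exists2 W : {vspace 'rV[R]_m}, (\dim W + #|pos| = m)%N & neg_def A W.
Proof.
move=> Tu TE; pose N := [pred i | ~~ pos i].
pose P : 'M[R]_(#|N|, m) := \matrix_(k, i) (enum_val k == i)%:R.
have PE (y : 'rV[R]_#|N|) k : (y *m P) 0 (enum_val k) = y 0 k.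
  rewrite mxE (bigD1 k) //= big1 ?addr0 => [|l /negbTE lk]; first by rewrite mxE eqxx mulr1.
  by rewrite mxE (inj_eq enum_val_inj) lk mulr0.
have P0 (y : 'rV[R]_#|N|) i : pos i -> (y *m P) 0 i = 0.
  move=> pi; rewrite mxE big1 // => k _; rewrite mxE; case: eqP => [ki|]; last by rewrite mulr0.
  by have := enum_valP k; rewrite ki inE pi.
pose g := linfun (mulmxr (P *m T)) : 'Hom('rV[R]_#|N|, 'rV[R]_m).
have gE y : g y = y *m P *m T by rewrite lfunE /= mulmxA.
have ginj : lker g == 0%VS.
  apply/lker0P => y y'; rewrite !gE => /(congr1 (fun z => z *m invmx T)).
  rewrite !mulmxK // => yP; apply/rowP => k.
  by rewrite -[LHS]PE yP PE.
exists (limg g).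
  rewrite limg_dim_eq ?dimvf ?dim_matrix ?mul1n; last first.
    by rewrite (eqP ginj) capv0.
  by rewrite addnC -[in RHS](card_ord m) -(cardC pos); congr addn; rewrite [LHS]mul1n; apply: eq_card.
move=> v /memv_imgP[y _ ->]; rewrite gE => v0.
have y0 : y *m P != 0 by apply: contraNneq v0 => ->; rewrite mul0mx.
rewrite TE; have [i yi] : exists i, (y *m P) 0 i != 0.
  apply/existsP; apply: contraNT y0; rewrite negb_exists => /forallP z.
  by apply/eqP/rowP => i; rewrite [RHS]mxE; apply/eqP; have := z i; rewrite negbK.
have pi : ~~ pos i by apply: contraNN yi => /P0 ->.
rewrite -oppr_gt0 -sumrN (bigD1 i) //= (negbTE pi) mulN1r opprK.
apply: ltr_pwDl; first by rewrite lt_def sqrf_eq0 yi sqr_ge0.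
apply: sumr_ge0 => j _; case: ifP => [/P0 ->|_]; first by rewrite expr0n mulr0 oppr0.
by rewrite mulN1r opprK sqr_ge0.
Qed.

(** A negative definite space meets its image under [J] only in [0] when the
    form is positive on average over every pair [x], [J x]. *)
Lemma neg_def_dim n (A J : 'M[R]_(n + n)) (W : {vspace 'rV[R]_(n + n)}) :
  J \in unitmx ->
  (forall x : 'rV[R]_(n + n), x != 0 ->
    0 < (x *m A *m x^T) 0 0 + ((x *m J) *m A *m (x *m J)^T) 0 0) ->
  neg_def A W -> (\dim W <= n)%N.
Proof.
move=> Ju AJ negW; rewrite leqNgt; apply/negP => nW.
pose g := linfun (mulmxr J) : 'End('rV[R]_(n + n)).
have gE y : g y = y *m J by rewrite lfunE.
have ginj : lker g == 0%VS.
  by apply/lker0P => y y'; rewrite !gE => /(congr1 (fun z => z *m invmx J)); rewrite !mulmxK.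
have dg : \dim (g @: W) = \dim W by rewrite limg_dim_eq // (eqP ginj) capv0.
have : (\dim (W :&: g @: W) != 0)%N.
  have := dimv_sum_cap W (g @: W); rewrite dg => E.
  have : (\dim (W + g @: W) <= n + n)%N.
    apply: leq_trans (dimvS (subvf (W + g @: W)%VS)) _.
    by rewrite dimvf dim_matrix [leqLHS]mul1n.
  by apply: contraTneq => E0; rewrite E0 addn0 in E; rewrite E -ltnNge -addnS leq_add // ltnW.
rewrite dimv_eq0 => /negP; apply.
apply/eqP; apply/vspaceP => v; rewrite memv0 memv_cap.
apply/idP/eqP => [/andP[vW /memv_imgP[w wW vE]]|->]; last by rewrite !mem0v.
apply/eqP; apply: contraTT isT => v0.
have w0 : w != 0 by apply: contraNneq v0 => w0; rewrite vE w0 linear0.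
have := AJ w w0; rewrite -gE -vE.
have := negW v vW v0; have := negW w wW w0; lra.
Qed.
End SymmetricForms.

(** * Levi form and signature of the Hessian *)

Section Levi.
Variables (R : realType) (n : nat).
Implicit Types (f : 'rV[R]_(n + n) -> R) (x p : 'rV[R]_(n + n)).

(** Multiplication by [i] on [C^n] in real coordinates. *)
Definition Jmx : 'M[R]_(n + n) := block_mx 0 1%:M (- 1%:M) 0.

Lemma Jmx_unit : Jmx \in unitmx.
Proof.
have : Jmx *m (- Jmx) = 1%:M.
  rewrite mulmxN /Jmx mulmx_block !mul0mx !mulmx0 !mul1mx !mulmx1 !add0r !addr0.
  by rewrite opp_block_mx !oppr0 opprK scalar_mx_block.
by move/mulmx1_unit => [].
Qed.

Lemma mul_Jmx x : x *m Jmx = row_mx (- rsubmx x) (lsubmx x).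
Proof.
rewrite -{1}[x]hsubmxK mul_row_block !mulmx0 mulmx1 mulmxN mulmx1 add0r addr0.
by [].
Qed.

Lemma cplx_of_real_eq0 x : x != 0 -> cplx_of_real x != 0.
Proof.
apply: contraNneq => x0; apply/eqP/rowP => k; rewrite mxE.
case: (splitP k) => j kj.
  have -> : k = lshift n j by apply/val_inj.
  by move/rowP/(_ j): x0; rewrite !mxE => -[].
have -> : k = rshift n j by apply/val_inj.
by move/rowP/(_ j): x0; rewrite !mxE => -[].
Qed.

Lemma ReD (a b : C R) : complex.Re (a + b) = complex.Re a + complex.Re b.
Proof. by case: a b => [? ?] [? ?]. Qed.

Lemma Re_sum (I : finType) (F : I -> C R) :
  complex.Re (\sum_i F i) = \sum_i complex.Re (F i).
Proof. exact: (big_morph (@complex.Re R) ReD). Qed.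

Lemma Re_hermitian_term (A B u v u' v' : R) :
  4 * complex.Re ((4^-1 * (A +i* B)%C) * (u +i* v)%C * ((u' +i* v')%C : C R)^* : C R) =
  A * (u * u' + v * v') - B * (v * u' - u * v').
Proof.
have -> : (4^-1 : C R) = (4^-1 : R)%:C%C by rewrite fmorphV /= rmorph_nat.
have -> : ((u' +i* v')%C : C R)^* = (u' -i* v')%C by [].
rewrite /= /real_complex_def.

lra.
Qed.

(** The Levi form is the mean of the Hessian over the real and the imaginary
    direction of a complex line. *)
Lemma levi_hessian f p x :
  4 * complex.Re (\sum_j \sum_k levi_mx f p j k * cplx_of_real x 0 j * (cplx_of_real x 0 k)^*) =
  (x *m hessian f p *m x^T) 0 0
    + ((x *m Jmx) *m hessian f p *m (x *m Jmx)^T) 0 0.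
Proof.
have qE y : (y *m hessian f p *m y^T) 0 0 =
   \sum_i \sum_j y 0 i * y 0 j * hessian f p i j.
  rewrite -mulmxA mxE; apply: eq_bigr => i _; rewrite mxE mulr_sumr.
  by apply: eq_bigr => j _; rewrite !mxE; ring.
have lE j k : 4 * complex.Re (levi_mx f p j k * cplx_of_real x 0 j * (cplx_of_real x 0 k)^*) =
   (hessian f p (lshift n j) (lshift n k) + hessian f p (rshift n j) (rshift n k)) *
     (x 0 (lshift n j) * x 0 (lshift n k) + x 0 (rshift n j) * x 0 (rshift n k)) -
   (hessian f p (lshift n j) (rshift n k) - hessian f p (rshift n j) (lshift n k)) *
     (x 0 (rshift n j) * x 0 (lshift n k) - x 0 (lshift n j) * x 0 (rshift n k)).
  rewrite 3!mxE Re_hermitian_term /hessian !mxE.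
  by [].
rewrite Re_sum mulr_sumr.
under eq_bigr do rewrite Re_sum mulr_sumr.
under eq_bigr do under eq_bigr do rewrite lE.
rewrite !qE !big_split_ord /= -!big_split /=; apply: eq_bigr => j _.
rewrite !big_split_ord /= -!big_split /=; apply: eq_bigr => k _.
rewrite mul_Jmx !row_mxEl !row_mxEr ![(- rsubmx x) _ _]mxE ![lsubmx x _ _]mxE ![rsubmx x _ _]mxE.
ring.
Qed.

Hypothesis n2 : (2 <= n)%N.

(** Strict plurisubharmonicity bounds the number of negative directions of
    the Hessian by [n], hence there are at least [n] positive ones. *)
Lemma psh_signature f p : (hessian f p)^T = hessian f p -> hessian f p \in unitmx ->
  (forall w : 'rV[C R]_n, w != 0 ->
    0 < \sum_j \sum_k levi_mx f p j k * w 0 j * (w 0 k)^*) ->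
  (3 <= n)%N \/ neg_index (hessian f p) <> 2%N ->
  exists2 T : 'M[R]_(n + n), T \in unitmx & exists2 pos : pred 'I_(n + n), (3 <= #|pos|)%N &
  forall x, 2^-1 * ((x *m T) *m hessian f p *m (x *m T)^T) 0 0 =
    \sum_i (if pos i then 1 else -1) * x 0 i ^+ 2.
Proof.
set H := hessian f p => Hs Hu levi n3.
have posJ x : x != 0 -> 0 < (x *m H *m x^T) 0 0 + ((x *m Jmx) *m H *m (x *m Jmx)^T) 0 0.
  move=> x0; rewrite -levi_hessian mulr_gt0 //.
  by have := levi _ (cplx_of_real_eq0 x0); rewrite ltcE => /andP[].
have dimW W : neg_def H W -> (\dim W <= n)%N := neg_def_dim Jmx_unit posJ.
have h2 : (2^-1 : R) \is a GRing.unit by rewrite unitfE invr_eq0.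
have [||T Tu [pos TE]] := @sym_signature _ _ (2^-1 *: H).
- by rewrite linearZ /= Hs.
- by rewrite unitmxZ.
have [W dW nW] := neg_space Tu TE.
have nWH : neg_def H W.
  move=> v vW v0; have := nW v vW v0.
  by rewrite -scalemxAr -scalemxAl mxE pmulr_rlt0 // invr_gt0.
exists T => //; exists pos => [|x]; last first.
  by rewrite -TE -scalemxAr -scalemxAl [RHS]mxE.
have nn := dimW _ nWH.
have pn : (n <= #|pos|)%N by rewrite -(leq_add2l (\dim W)) dW leq_add2r.
have [n3'|] := leqP 3 n; first exact: leq_trans pn.
rewrite ltnS => nle2.
have nE : n = 2%N by apply/eqP; rewrite eqn_leq nle2.
case: n3 => [/leq_trans/(_ nle2)//|idx].
rewrite ltnNge; apply/negP => p2; apply: idx.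
have dW2 : \dim W = 2%N.
  by move: dW nn p2 pn nE; lia.
apply/eqP; rewrite eqn_leq; apply/andP; split.
  apply/bigmax_leqP => d /asboolP[W' [<- nW']]; exact: leq_trans (dimW _ nW') nle2.
have dlt : (\dim W < (n + n).+1)%N by rewrite ltnS; exact: leq_trans nn (leq_addr _ _).
rewrite -dW2; apply: (leq_bigmax_cond (Ordinal dlt)).
by apply/asboolP; exists W.
Qed.
End Levi.

(** * Real charts of complex manifolds *)

Section RealChart.
Variables (R : realType) (n : nat).

Lemma normc_bound (a b : R) : `|((a +i* b)%C : C R)| <= (`|a| + `|b|)%:C%C.
Proof.
have -> : (a +i* b)%C = a%:C%C + 'i%C * b%:C%C :> C R by exact: (complexE (a +i* b)%C).
apply: le_trans (ler_normD _ _) _.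
have nR (c : R) : `|(c%:C%C : C R)| = `|c|%:C%C.
  by rewrite normc_def /= expr0n addr0 sqrtr_sqr.
rewrite normrM !nR [`|'i%C|]normc_def /= expr0n add0r expr1n sqrtr1 mul1r.
by rewrite -rmorphD.
Qed.

Lemma Re_Im_bound (z : C R) : `|complex.Re z|%:C%C <= `|z| /\ `|complex.Im z|%:C%C <= `|z|.
Proof.
split; first exact: normc_ge_Re.
by rewrite normc_def lecR -sqrtr_sqr ler_wsqrtr // lerDr sqr_ge0.
Qed.

Lemma cplx_of_realK : cancel (@cplx_of_real R n) (@real_of_cplx R n).
Proof.
move=> x; rewrite -[RHS]hsubmxK /real_of_cplx; congr row_mx; apply/rowP => j; by rewrite !mxE.
Qed.

Lemma real_of_cplxK : cancel (@real_of_cplx R n) (@cplx_of_real R n).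
Proof.
move=> z; apply/rowP => j; rewrite mxE /real_of_cplx row_mxEl row_mxEr !mxE.
by case: (z 0 j).
Qed.

Lemma pos_complexE (e : C R) : 0 < e -> e = (complex.Re e)%:C%C /\ 0 < complex.Re e.
Proof.
by case: e => a b; rewrite ltcE /= => /andP[/eqP -> a0].
Qed.

Lemma cplx_of_real_continuous : continuous (@cplx_of_real R n).
Proof.
move=> x A /nbhs_ballP[e /= /pos_complexE[eE e0] eA]; apply/nbhs_ballP.
exists (complex.Re e / 2) => [|y [_ xy]]; first by rewrite /= divr_gt0.
apply: eA; split; first by rewrite eE ltcR.
move=> i j; rewrite ord1 -ball_normE /= !mxE.
have xl := xy 0 (lshift n j); have xr := xy 0 (rshift n j).
rewrite -ball_normE /= in xl; rewrite -ball_normE /= in xr.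
apply: le_lt_trans (normc_bound (x 0 (lshift n j) - y 0 (lshift n j)) (x 0 (rshift n j) - y 0 (rshift n j))) _.
by rewrite eE ltcR [ltRHS]splitr ltrD.
Qed.

Lemma real_of_cplx_continuous : continuous (@real_of_cplx R n).
Proof.
move=> z A /nbhs_ballP[e /= e0 eA]; apply/(@nbhs_ballP (C R) 'rV[C R]_n).
exists (e%:C%C) => [|w [_ zw]]; first by rewrite /= ltcR.
apply: eA; split => // i j; rewrite ord1 -ball_normE /=.
have nRI k : `|complex.Re (z 0 k) - complex.Re (w 0 k)| < e /\ `|complex.Im (z 0 k) - complex.Im (w 0 k)| < e.
  have := zw 0 k; rewrite -ball_normE /= => zwk.
  have [h1 h2] := Re_Im_bound (z 0 k - w 0 k).
  by split; rewrite -ltcR; [have := le_lt_trans h1 zwk|have := le_lt_trans h2 zwk];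
    case: (z 0 k) (w 0 k) => [? ?] [? ?].
case: (splitP j) => k jk.
  have -> : j = lshift n k by apply/val_inj.
  by rewrite !row_mxEl !mxE; have [] := nRI k.
have -> : j = rshift n k by apply/val_inj.
by rewrite !row_mxEr !mxE; have [] := nRI k.
Qed.

Lemma mulmx_bound m (T : 'M[R]_m) : exists2 c : R, 0 < c &
  forall y : 'rV[R]_m, `|y *m T| <= c * `|y|.
Proof.
pose c : R := \sum_i \sum_j `|T i j| + 1.
have s0 : 0 <= \sum_i \sum_j `|T i j| by apply: sumr_ge0 => i _; apply: sumr_ge0.
exists c; first by rewrite ltr_wpDl.
move=> y; apply: row_norm_le => [|j]; first by rewrite mulr_ge0 // addr_ge0.
rewrite mxE; apply: le_trans (ler_norm_sum _ _ _) _.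
apply: (@le_trans _ _ (\sum_i `|y| * `|T i j|)).
  by apply: ler_sum => i _; rewrite normrM ler_wpM2r // row_norm_ge.
rewrite -mulr_sumr mulrC ler_wpM2r // /c -[leLHS]addr0 lerD //.
by apply: ler_sum => i _; rewrite (bigD1 j) //= lerDl; apply: sumr_ge0.
Qed.

Lemma affine_continuous m (T : 'M[R]_m) (p : 'rV[R]_m) :
  continuous (fun y : 'rV[R]_m => p + y *m T).
Proof.
move=> x A /nbhs_ballP[e /= e0 eA]; have [c c0 cT] := mulmx_bound T; apply/nbhs_ballP.
exists (e / c) => [|y]; first by rewrite /= divr_gt0.
rewrite -ball_normE /= => xy; apply: eA.
rewrite -ball_normE /= opprD addrACA subrr add0r -mulmxBl.
by apply: le_lt_trans (cT _) _; rewrite -ltr_pdivlMl // mulrC.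
Qed.

Variables (X : complex_manifold R n) (U : set X).
Hypothesis oU : open U.
Local Notation V := 'rV[R]_(n + n).

(** [chi] is a homeomorphism from the ball of radius [r0] onto a
    neighbourhood of [p] in [U], with inverse [chi']. *)
Definition local_param (p : X) (r0 : R) (chi : V -> X) (chi' : X -> V) :=
  [/\ 0 < r0, chi 0 = p & forall y, ball 0 r0 y ->
    [/\ U (chi y), {for y, continuous chi}, chi' (chi y) = y &
        forall A, nbhs y A -> nbhs (chi y) (chi @` A)]].

Lemma chart_inv_continuous_at (c : chart R n X) z :
  (c @` chart_dom c) z -> {for z, continuous (chart_inv c)}.
Proof.
move=> cz; have := @chart_inv_continuous _ _ _ c.
rewrite continuous_open_subspace; last exact: chart_im_open.
by apply; rewrite inE.
Qed.

Lemma chart_continuous_at (c : chart R n X) x :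
  chart_dom c x -> {for x, continuous c}.
Proof.
move=> cx; have := @chart_map_continuous _ _ _ c.
rewrite continuous_open_subspace; last exact: chart_dom_open.
by apply; rewrite inE.
Qed.

Lemma chart_image_open (c : chart R n X) (O : set X) : open O ->
  open (c @` (chart_dom c `&` O)).
Proof.
move=> oO; have -> : c @` (chart_dom c `&` O) = (c @` chart_dom c) `&` [set z | O (chart_inv c z)].
  apply/seteqP; split=> [_ [x [cx Ox] <-]|z [[x cx <-]]].
    by split; [exists x|rewrite /= chart_mapK].
  by rewrite /= chart_mapK // => Ox; exists x.
rewrite openE => z [cz Oz]; apply: filterI.
  by apply: open_nbhs_nbhs; split => //; exact: chart_im_open.
apply: (chart_inv_continuous_at cz); exact: open_nbhs_nbhs.
Qed.

(** The linear change of coordinates [T] makes room for the normal form of the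
    Hessian at a critical point. *)
Lemma param_exists (i : cm_index X) p (T : 'M[R]_(n + n)) :
  chart_dom (cm_chart i) p -> U p -> T \in unitmx ->
  exists r0 chi', local_param p r0
    (fun y => chart_inv (cm_chart i) (cplx_of_real (coords i p + y *m T))) chi'.
Proof.
move=> ip Up Tu; set c := cm_chart i.
pose D := [set x : V | (c @` (chart_dom c `&` U)) (cplx_of_real x)].
have oD : open D.
  apply: (@open_comp _ _ (@cplx_of_real R n)); last exact: chart_image_open.
  by move=> x _; exact: cplx_of_real_continuous.
have Dp : D (coords i p) by exists p => //; rewrite /coords real_of_cplxK.
pose g y := coords i p + y *m T.
have g0 : g 0 = coords i p by rewrite /g mul0mx addr0.
have /nbhs_ballP[r0 /= r00 r0P] : nbhs (0 : V) (g @^-1` D).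
  by apply: affine_continuous; apply: open_nbhs_nbhs; split => //; rewrite mul0mx addr0.
exists r0, (fun q => (coords i q - coords i p) *m invmx T); split => // [|y /r0P].
  by rewrite -/(g 0) g0 /coords real_of_cplxK chart_mapK.
move=> [q [cq Uq] gq].
have chiE : chart_inv c (cplx_of_real (g y)) = q by rewrite -gq chart_mapK.
have gqE : g y = coords i q by rewrite /coords -/c gq cplx_of_realK.
rewrite -/(g y) chiE; split => //.
- apply: (@continuous_comp _ _ _ (fun y => cplx_of_real (g y)) (chart_inv c)).
    apply: (@continuous_comp _ _ _ g (@cplx_of_real R n)); first exact: affine_continuous.
    exact: cplx_of_real_continuous.
  by apply: chart_inv_continuous_at; exists q.
- by rewrite -gqE /g addrC addKr mulmxK.
- move=> A Ay; pose psi q' := (coords i q' - coords i p) *m invmx T.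
  have cpsi : {for q, continuous psi}.
    have -> : psi = (fun z : V => - (coords i p *m invmx T) + z *m invmx T) \o (@real_of_cplx R n) \o c.
      by apply/funext => q'; rewrite /psi /= mulmxBl addrC.
    apply: continuous_comp; first exact: chart_continuous_at.
    apply: continuous_comp; first exact: real_of_cplx_continuous.
    exact: affine_continuous.
  have psiq : psi q = y by rewrite /psi -gqE /g addrC addKr mulmxK.
  have nA : \forall q' \near q, A (psi q') by apply: cpsi; rewrite psiq.
  apply: filterS2 nA (open_nbhs_nbhs (conj (@chart_dom_open _ _ _ c) cq)) => q' Aq' cq'.
  exists (psi q') => //; rewrite /psi mulmxKV // addrC subrK.
  by rewrite /coords real_of_cplxK chart_mapK.
Qed.
End RealChart.

(** * Local topology of superlevel sets *)

Section LocalTopology.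
Variables (R : realType) (n : nat) (X : complex_manifold R n) (U : set X).
Hypothesis oU : open U.
Local Notation V := 'rV[R]_(n + n).

Lemma param_ball_open p r0 (chi : V -> X) chi' r :
  local_param U p r0 chi chi' -> r <= r0 -> open (chi @` ball (0 : V) r).
Proof.
move=> [r00 _ chiP] rr0; rewrite openE => _ [y yr <-].
have [|_ _ _] := chiP y; first exact: le_ball yr.
apply; apply: open_nbhs_nbhs; split => //; exact: ball_open.
Qed.

Lemma param_small p r0 (chi : V -> X) chi' O : local_param U p r0 chi chi' -> nbhs p O ->
  exists2 d, 0 < d & forall y, ball 0 d y -> O (chi y).
Proof.
move=> [r00 chi0 chiP] pO; have [|_ cchi _ _] := chiP 0; first exact: ballxx.
have : nbhs (0 : V) (chi @^-1` O) by apply: cchi; rewrite chi0.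
by move=> /nbhs_ballP[d d0 dO]; exists d.
Qed.

(** Images of closed coordinate balls are compact, hence closed. *)
Lemma manifold_regular p O : U p -> nbhs p O ->
  exists W, [/\ open W, W p & closure W `<=` O].
Proof.
move=> Up pO; have [i ip] := cm_cover p.
have [r0 [chi' par]] := param_exists oU ip Up (unitmx1 _ _).
set chi := fun y => _ in par.
have [d d0 dO] := param_small par pO.
have [r00 chi0 chiP] := par.
pose r := Num.min r0 d / 2.
have m0 : 0 < Num.min r0 d by rewrite lt_min r00.
have rp : 0 < r by rewrite divr_gt0.
have rlt : r < Num.min r0 d by rewrite ltr_pdivrMr // ltr_pMr // ltr1n.
have [rr0 rd] : r < r0 /\ r < d by move: rlt; rewrite lt_min => /andP[].
exists (chi @` ball 0 r); split.
- exact: param_ball_open par (ltW rr0).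
- by exists 0; rewrite ?chi0 //; exact: ballxx.
pose B := closed_ball (0 : V) r.
have BE y : B y -> `|y| <= r by rewrite /B closed_ballE // /closed_ball_ /= sub0r normrN.
have cB : compact (chi @` B).
  apply: continuous_compact.
    apply: continuous_in_subspaceT => y; rewrite inE => /BE yr.
    have [|] := chiP y; last by [].
    by rewrite -ball_normE /= sub0r normrN (le_lt_trans yr).
  apply: bounded_closed_compact; last exact: closed_ball_closed.
  exists r; split; first exact: num_real.
  by move=> s rs y /BE /le_trans; apply; exact: ltW.
have := compact_closed (@cm_hausdorff _ _ X) cB; rewrite closure_id => cE.
apply: (@subset_trans _ (chi @` B)).
  rewrite cE; apply: closureS; apply: image_subset; exact: subset_closed_ball.
move=> _ [y /BE yr <-]; apply: dO.
by rewrite -ball_normE /= sub0r normrN (le_lt_trans yr).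
Qed.

Variables (rho : X -> R) (t0 : R).
Let P := superlevel_set U rho t0.
Hypothesis oP : open P.

(** Over the part of [W] above the level [t0], local systems have global sections,
    and by connectedness these are unique up to scaling. *)
Definition tame W := [/\ W `&` P !=set0, connected (W `&` P) & monodromy_free (C R) (W `&` P)].

Lemma param_tame p r0 (chi : V -> X) chi' d : local_param U p r0 chi chi' -> 0 < d ->
  (forall r, 0 < r < d -> let S := ball (0 : V) r `&` [set y | 0 < rho (chi y) - t0] in
     open S -> [/\ S !=set0, connected S & monodromy_free (C R) S]) ->
  forall O, nbhs p O -> exists W, [/\ open W, W p, W `<=` O, W `<=` U & tame W].
Proof.
move=> par d0 dP O pO; have [e e0 eO] := param_small par pO.
have [r00 chi0 chiP] := par.
pose r := Num.min r0 (Num.min d e) / 2.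
have m0 : 0 < Num.min r0 (Num.min d e) by rewrite !lt_min r00 d0.
have rp : 0 < r by rewrite divr_gt0.
have rlt : r < Num.min r0 (Num.min d e) by rewrite ltr_pdivrMr // ltr_pMr // ltr1n.
have [rr0 rd re] : [/\ r < r0, r < d & r < e] by move: rlt; rewrite !lt_min => /and3P[].
have chiP' y : ball 0 r y -> [/\ U (chi y), {for y, continuous chi}, chi' (chi y) = y &
        forall A, nbhs y A -> nbhs (chi y) (chi @` A)].
  by move=> yr; apply: chiP; exact: le_ball (ltW rr0) _ yr.
pose S := ball (0 : V) r `&` [set y | 0 < rho (chi y) - t0].
have SE : (chi @` ball 0 r) `&` P = chi @` S.
  apply/seteqP; split=> [_ [[y yr <-] [Uy ty]]|_ [y [yr ty] <-]].
    by exists y => //; split => //; rewrite /= subr_gt0.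
  have [Uy _ _ _] := chiP' y yr.
  by split; [exists y|split => //; move: ty; rewrite /= subr_gt0].
have oS : open S.
  rewrite openE => y [yr ty]; have [Uy cy _ _] := chiP' y yr.
  have Py : P (chi y) by split => //; move: ty; rewrite /= subr_gt0.
  have yb : nbhs y (ball (0 : V) r) by apply: open_nbhs_nbhs; split => //; exact: ball_open.
  apply: filterS2 yb (cy _ (open_nbhs_nbhs (conj oP Py))) => z zr [_ tz].
  by split => //; rewrite /= subr_gt0.
have [S0 cS mS] := dP r (introT andP (conj rp rd)) oS.
exists (chi @` ball 0 r); split.
- exact: param_ball_open par (ltW rr0).
- by exists 0; rewrite ?chi0 //; exact: ballxx.
- by move=> _ [y yr <-]; apply: eO; exact: le_ball (ltW re) _ yr.
- by move=> _ [y yr <-]; have [] := chiP' y yr.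
rewrite /tame SE; split.
- by have [y Sy] := S0; exists (chi y), y.
- apply: connected_continuous_connected => //.
  by apply: continuous_in_subspaceT => y; rewrite inE => -[/chiP'[]].
- apply: (monodromy_free_image (psi := chi')) => //.
  + by move=> y [/chiP'[]].
  + by move=> y [/chiP'[]].
  + by move=> y A [/chiP'[_ _ _ h] _]; exact: h.
Qed.

Hypothesis hsmooth : smooth_fun rho U.

(** At a noncritical point, [rho] is a perturbation of a nonzero linear form. *)
Lemma regular_tame p : U p -> rho p = t0 -> ~ critical_point rho p ->
  forall O, nbhs p O -> exists W, [/\ open W, W p, W `<=` O, W `<=` U & tame W].
Proof.
move=> Up pt0 /existsNP[i /not_implyP[ip /existsNP[a /eqP da]]].
have [r0 [chi' par]] := param_exists oU ip Up (unitmx1 _ _).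
have [r00 chi0 _] := par.
set D := [set x | (cm_chart i @` (chart_dom (cm_chart i) `&` U)) (@cplx_of_real R n x)].
have oD : open D.
  apply: (@open_comp _ _ (@cplx_of_real R n)); last exact: chart_image_open.
  by move=> x _; exact: cplx_of_real_continuous.
have Dp : D (coords i p) by exists p => //; rewrite /coords real_of_cplxK.
have sd := strict_differentiability oD Dp (hsmooth i 1).
pose f (y : V) := rho (chart_inv (cm_chart i) (cplx_of_real (coords i p + y *m 1%:M))) - t0.
have f0 : f 0 = 0 by rewrite /f chi0 pt0 subrr.
have [|d d0 dP] := @submersion_monodromy_free R _ (grad (in_chart rho i) (coords i p)) a (C R) f da f0.
  move=> e e0; have [d d0 dP] := sd e e0; exists d => // x y xd yd.
  have := dP x y xd yd; rewrite /f /in_chart !mulmx1 /lin /grad.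
  by congr (`|_| <= _); ring.
exact: param_tame par d0 dP.
Qed.

(** At a critical point, [rho] is a perturbation of a quadratic form with at least
    three positive squares: the part above the level has the homotopy type of a
    sphere of dimension at least two. *)
Lemma critical_tame p : (2 <= n)%N -> strictly_psh rho U -> morse_fun rho U ->
  U p -> rho p = t0 -> critical_point rho p -> (3 <= n)%N \/ morse_index rho p <> 2%N ->
  forall O, nbhs p O -> exists W, [/\ open W, W p, W `<=` O, W `<=` U & tame W].
Proof.
move=> n2 psh morse Up pt0 crit; rewrite /morse_index.
set i := sval _ => idx.
have ip : chart_dom (cm_chart i) p by exact: svalP (cid (cm_cover p)).
set D := [set x | (cm_chart i @` (chart_dom (cm_chart i) `&` U)) (@cplx_of_real R n x)].
have oD : open D.
  apply: (@open_comp _ _ (@cplx_of_real R n)); last exact: chart_image_open.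
  by move=> x _; exact: cplx_of_real_continuous.
have Dp : D (coords i p) by exists p => //; rewrite /coords real_of_cplxK.
have C2 := hsmooth i 2.
have Hs : (hessian (in_chart rho i) (coords i p))^T = hessian (in_chart rho i) (coords i p).
  by apply/matrixP => a b; rewrite mxE; exact: hessian_sym oD Dp C2 _ _.
have [T Tu [pos pos3 TE]] := psh_signature n2 Hs (morse _ Up crit _ ip) (psh _ _ ip Up) idx.
have [r0 [chi' par]] := param_exists oU ip Up Tu.
have [r00 chi0 _] := par.
have so := strict_second_order oD Dp C2 (crit i ip).
pose f (y : V) := rho (chart_inv (cm_chart i) (cplx_of_real (coords i p + y *m T))) - t0.
have f0 : f 0 = 0 by rewrite /f chi0 pt0 subrr.
have [|d d0 dP] := @saddle_monodromy_free R _ pos pos3 (C R) f f0.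
  move=> e e0; have [c c0 cT] := mulmx_bound T.
  have [|d d0 dP] := so (e / (c * c)); first by rewrite divr_gt0 // mulr_gt0.
  exists (d / c) => [|x y xd yd]; first by rewrite divr_gt0.
  have Td (z : V) : `|z| < d / c -> `|z *m T| < d.
    by move=> zd; apply: le_lt_trans (cT z) _; rewrite mulrC -ltr_pdivlMr.
  have := dP _ _ (Td _ xd) (Td _ yd); rewrite !TE.
  rewrite /f /in_chart -mulmxBl.
  set a := rho _; set b := rho _; set qx := \sum_i _; set qy := \sum_i _.
  have -> : a - t0 - qx - (b - t0 - qy) = a - qx - (b - qy) by ring.
  move=> /le_trans; apply.
  have -> : e * (`|x| + `|y|) * `|x - y| = e / (c * c) * ((c * `|x| + c * `|y|) * (c * `|x - y|)).
    by field; rewrite gt_eqF.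
  rewrite -mulrA ler_pM2l ?divr_gt0 ?mulr_gt0 //.
  by apply: ler_pM; rewrite ?addr_ge0 ?lerD.
exact: param_tame par d0 dP.
Qed.
End LocalTopology.

(** * Extension of cocycles *)

Section LocalRoots.
Variables (K : numClosedFieldType) (X : topologicalType) (k : nat).
Hypothesis k0 : (0 < k)%N.
Implicit Types (c n : X -> K) (x : X).

Lemma pow_eq_near c c' x : {for x, continuous c} -> {for x, continuous c'} ->
  c x = c' x -> c x != 0 -> (\forall y \near x, c y ^+ k = c' y ^+ k) ->
  \forall y \near x, c y = c' y.
Proof.
move=> cc cc' cx c0 ck.
have [[A B] [/= cA cB] AB] := pow_locally_inj k0 c0.
rewrite cx in cB.
have nA : \forall y \near x, A (c y) by exact: cc.
have nB : \forall y \near x, B (c' y) by exact: cc'.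
by apply: filterS3 nA nB ck => y Ay By; apply: (AB (c y, c' y)).
Qed.

(** Roots of unity form a discrete set. *)
Lemma pow1_near_const c x : {for x, continuous c} ->
  (\forall y \near x, c y ^+ k = 1) -> \forall y \near x, c y = c x.
Proof.
move=> cc ck; have cx := nbhs_singleton ck.
apply: (@pow_eq_near c (cst (c x))) => //; first exact: cst_continuous.
  by apply/eqP => c0; move: cx; rewrite c0 expr0n gtn_eqF // => /eqP; rewrite eq_sym oner_eq0.
by apply: filterS ck => y ->; rewrite /= cx.
Qed.

Lemma root_exists (w : K) : exists z, z ^+ k = w.
Proof. by exists (k.-root w); rewrite rootCK. Qed.

Lemma local_root_fun n x : (\forall y \near x, {for y, continuous n}) -> n x != 0 ->
  exists g, \forall y \near x, g y ^+ k = n y /\ {for y, continuous g}.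
Proof.
move=> cn n0; have [z zk] := root_exists (n x).
have z0 : z != 0.
  by apply: contraNneq n0 => z0; rewrite -zk z0 expr0n gtn_eqF.
have [r [rP _]] := local_root k0 z0; rewrite zk in rP.
exists (r \o n); have := nbhs_singleton cn _ rP.
rewrite nbhs_simpl /= => h; apply: filterS2 h cn => y /= [ry cy] ny; split => //.
exact: continuous_comp.
Qed.
End LocalRoots.

Section Gluing.
Variables (K : numClosedFieldType) (X : topologicalType) (k : nat).
Hypothesis k0 : (0 < k)%N.
Variables (P U Sig : set X).
Hypotheses (oP : open P) (SU : Sig `<=` U) (cS : compact Sig).
Variables (IE IF : Type) (De : IE -> set X) (Df : IF -> set X).
Variables (e : IE -> X -> K) (f : IF -> X -> K).
Hypotheses (De_open : forall a, open (De a)) (De_cover : \bigcup_a De a = P).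
Hypotheses (Df_open : forall b, open (Df b)) (Df_cover : \bigcup_b Df b = U).
Hypothesis e0 : forall a x, De a x -> e a x != 0.
Hypothesis f0 : forall b x, Df b x -> f b x != 0.
Hypothesis ee : forall a a' x, De a x -> De a' x ->
  {for x, continuous (fun y => e a y / e a' y)}.
Hypothesis ff : forall b b' x, Df b x -> Df b' x ->
  {for x, continuous (fun y => f b y / f b' y)}.
Hypothesis fe : forall a b x, De a x -> Df b x ->
  {for x, continuous (fun y => f b y / e a y ^+ k)}.
Hypothesis reg : forall p O, Sig p -> nbhs p O ->
  exists W, [/\ open W, W p & closure W `<=` O].
Hypothesis tameS : forall p O, Sig p -> nbhs p O -> exists W, [/\ open W, W p, W `<=` O
  & [/\ W `&` P !=set0, connected (W `&` P) & monodromy_free K (W `&` P)]].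

(** The values of [s] at [x] are those of a local frame of the first bundle
    whose [k]-th power is the frame [b] of the second one. *)
Definition flat_at b (s : X -> K) (x : X) := s x ^+ k = f b x /\
  forall a, De a x -> {for x, continuous (fun y => s y / e a y)}.

Definition flat b (s : X -> K) (x : X) := \forall y \near x, flat_at b s y.

Lemma near_open (A : set X) (x : X) : open A -> A x -> \forall y \near x, A y.
Proof. by move=> oA Ax; apply: open_nbhs_nbhs. Qed.

Lemma eq_near_continuous (c c' : X -> K) (x : X) : (\forall y \near x, c' y = c y) ->
  {for x, continuous c} -> {for x, continuous c'}.
Proof.
move=> E cc; have cE : c' x = c x by exact: nbhs_singleton E.
suff : c' y @[y --> x] --> c' x by []; rewrite cE.
by apply: cvg_trans cc; apply: near_eq_cvg; apply: filterS E => y ->.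
Qed.

Lemma near_near (Q : X -> Prop) (x : X) : (\forall y \near x, Q y) ->
  \forall y \near x, \forall z \near y, Q z.
Proof. by move=> Qx; apply: nbhs_interior. Qed.

Lemma flat_ratio b b' (s s' : X -> K) (x : X) : P x -> Df b x -> Df b' x -> flat b s x -> flat b' s' x ->
  {for x, continuous (fun y => s y / s' y)}.
Proof.
rewrite -De_cover => -[a _ ax] bx b'x sx s'x.
have [sk sa] := nbhs_singleton sx; have [s'k s'a] := nbhs_singleton s'x.
have ex := e0 ax.
have s'0 : s' x != 0.
  by have := f0 b'x; rewrite -s'k expf_eq0 k0.
apply: (@eq_near_continuous (fun y => (s y / e a y) / (s' y / e a y))).
  apply: filterS (near_open (De_open a) ax) => y ay.
  by rewrite invf_div mulrA divfK // e0.
apply: cvgM; first exact: sa.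
apply: cvgV; last exact: s'a.
by rewrite mulf_neq0 // invr_eq0.
Qed.

(** The sections are the normalised frames; two of them differ by a [k]-th root of
    unity, and a [k]-th root of [f b / e a ^+ k] provides one. *)
Lemma flat_local_system b : local_system [set z | z ^+ k = 1] (Df b `&` P) (flat b).
Proof.
have nz s x : Df b x -> flat b s x -> s x != 0.
  move=> bx /nbhs_singleton[sk _]; have := f0 bx.
  by rewrite -sk expf_eq0 k0.
split.
- by move=> s x _; exact: near_near.
- by move=> s x [bx _]; exact: nz.
- move=> s s' x [bx Px] sx s'x.
  have cr := flat_ratio Px bx bx s'x sx.
  have r1 : \forall y \near x, (s' y / s y) ^+ k = 1.
    apply: filterS3 sx s'x (near_open (Df_open b) bx) => y [sk _] [s'k _] yb.
    by rewrite expr_div_n sk s'k mulfV // f0.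
  exists (s' x / s x); first exact: nbhs_singleton r1.
  have nn : \forall y \near x, s y != 0.
    apply: filterS2 sx (near_open (Df_open b) bx) => y [sk _] /f0.
    by rewrite -sk expf_eq0 k0.
  by apply: filterS2 (pow1_near_const k0 cr r1) nn => y <- sy; rewrite divfK.
- move=> s s' a x [bx Px] /= a1 sx s'E.
  apply: filterS2 sx (near_near s'E) => y [sk sa] s'y; split.
    by rewrite (nbhs_singleton s'y) exprMn a1 mul1r.
  move=> c cy; apply: (@eq_near_continuous (fun z => a * (s z / e c z))).
    by apply: filterS s'y => z ->; rewrite mulrA.
  by apply: cvgM; [exact: cst_continuous|exact: sa].
- move=> x [bx]; rewrite -De_cover => -[a _ ax].
  have abx : \forall y \near x, De a y /\ Df b y.
    by apply: filterS2 (near_open (De_open a) ax) (near_open (Df_open b) bx).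
  have [||g gP] := @local_root_fun K X k k0 (fun y => f b y / e a y ^+ k) x.
  + by apply: filterS abx => y [ay yb]; exact: fe.
  + by rewrite mulf_neq0 ?f0 // invr_eq0 expf_neq0 // e0.
  exists (fun y => g y * e a y); apply: filterS2 abx gP => y [ay yb] [gk gc]; split.
    by rewrite exprMn gk divfK // expf_neq0 // e0.
  move=> a' a'y; apply: (@eq_near_continuous (fun z => g z * (e a z / e a' z))).
    by apply: filterE => z; rewrite mulrA.
  by apply: cvgM; [exact: gc|exact: ee].
Qed.

(** If no finite subfamily covered [Sig], the complements of the finite unions
    would generate a filter with a cluster point, whose own neighbourhood in the
    family gives a contradiction. *)
Lemma finite_subcover (N : X -> set X) :
  (forall p, Sig p -> open (N p) /\ N p p) ->
  exists (I : finType) (c : I -> X), (forall i, Sig (c i)) /\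
    forall x, Sig x -> exists i, N (c i) x.
Proof.
move=> NP; apply: contrapT => nfin.
pose un (D : seq X) := [set x | exists2 p, p \in D & N p x].
pose F : set_system X := [set A | exists2 D : seq X,
  (forall p, p \in D -> Sig p) & Sig `\` un D `<=` A].
have FP : ProperFilter F.
  split=> [[D DS D0]|]; last split.
  - apply: nfin; exists 'I_(size D), (fun i => tnth (in_tuple D) i); split=> [i|x Sx].
      by apply: DS; exact: mem_tnth.
    have [p pD Np] : un D x by apply: contrapT => nx; exact: (D0 x).
    by have /tnthP[i ip] : p \in in_tuple D by []; exists i; rewrite -ip.
  - by exists [::].
  - move=> A A' [D DS DA] [D' D'S D'A']; exists (D ++ D') => [p|x [Sx nx]].
      by rewrite mem_cat => /orP[/DS|/D'S].
    by split; [apply: DA|apply: D'A']; split => // -[p pD Np]; apply: nx; exists p => //;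
      rewrite mem_cat pD ?orbT.
  - by move=> A A' AA' [D DS DA]; exists D => // x /DA/AA'.
have FS : F Sig by exists [::] => // x [].
have [p [Sp clp]] := cS FP FS.
have [oN Np] := NP p Sp.
have FN : F (Sig `\` N p).
  exists [:: p] => [q|x [Sx nx]]; first by rewrite inE => /eqP ->.
  by split=> // Nx; apply: nx; exists p => //; rewrite mem_head.
by have [x [[_ nNx] Nx]] := clp _ _ FN (near_open oN Np).
Qed.

(** Here the vanishing of the monodromy enters. *)
Lemma frame_exists p : Sig p -> exists b B s, [/\ open B, B p, B `<=` Df b &
  forall x, B x -> P x -> flat b s x].
Proof.
move=> Sp; have := SU Sp; rewrite -Df_cover => -[b _ bp].
have [W [oW Wp Wb [_ _ mW]]] := tameS Sp (near_open (Df_open b) bp).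
have [|s sP] := mW [set z | z ^+ k = 1] (flat b).
  by apply: local_systemS (flat_local_system b) => x [/Wb].
by exists b, W, s; split => // x Wx Px; exact: sP.
Qed.

Section Cocycle.
Variables (I : finType) (B B' : I -> set X) (b : I -> IF) (s : I -> X -> K).
Hypothesis B_open : forall i, open (B i).
Hypotheses (B'B : forall i, closure (B' i) `<=` B i) (Bb : forall i, B i `<=` Df (b i)).
Hypothesis sP : forall i x, B i x -> P x -> flat (b i) (s i) x.
Hypothesis B'cov : forall x, Sig x -> exists i, B' i x.

Let s0 i x : B i x -> P x -> s i x != 0.
Proof.
move=> Bx Px; have [sk _] := nbhs_singleton (sP Bx Px).
by have := f0 (Bb Bx); rewrite -sk expf_eq0 k0.
Qed.

(** On a small neighbourhood [W] of a point [q] of [Sig] the ratios of frames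
    extend continuously across [Sig]: such a ratio is, on the connected set
    [W `&` P], a constant multiple of a [k]-th root defined on all of [W]. *)
Lemma transition_extend q : Sig q -> exists W i0 (g : I -> X -> K),
  [/\ open W, W q, W `<=` B i0,
   forall i x, W x -> B' i x -> W `<=` B i &
   forall i x, W `<=` B i -> W x -> [/\ {for x, continuous (g i)},
     g i x ^+ k = f (b i) x / f (b i0) x & P x -> g i x = s i x / s i0 x]].
Proof.
move=> Sq; have [i0 i0q] := B'cov Sq.
pose n i x := f (b i) x / f (b i0) x.
have i0B : B i0 q by apply: B'B; exact: subset_closure.
have /choice[r rP] : forall i, exists g : X -> K, B i q ->
    \forall y \near q, g y ^+ k = n i y /\ {for y, continuous g}.
  move=> i; have [Bq|nB] := pselect (B i q); last by exists (fun=> 0).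
  have [||g gP] := @local_root_fun K X k k0 (n i) q; last by exists g.
    apply: filterS2 (near_open (B_open i) Bq) (near_open (B_open i0) i0B) => y By B0y.
    by apply: ff; apply: Bb.
  by rewrite mulf_neq0 ?invr_eq0 // f0 //; apply: Bb.
pose O i := [set x | (B i q -> r i x ^+ k = n i x /\ {for x, continuous (r i)}) /\
   ((closure (B' i) q -> B i x) /\ (~ closure (B' i) q -> ~ B' i x))].
have nO : \forall x \near q, B i0 x /\ forall i, O i x.
  apply: filterI; first exact: near_open.
  apply: (@filter_forall _ _ (fun i x => O i x) (nbhs q)) => i.
  apply: filterI.
    by have [/rP rq|nB] := pselect (B i q); [apply: filterS rq|apply: filterE].
  have [cq|ncq] := pselect (closure (B' i) q).
    by apply: filterS (near_open (B_open i) (B'B cq)).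
  have := near_open (closed_openC (@closed_closure _ (B' i))) ncq.
  by apply: filterS => x nx; split => // _ /subset_closure.
have [W [oW Wq WO [WP cWP _]]] := tameS Sq nO.
have [z [Wz Pz]] := WP.
pose g i x := s i z / (r i z * s i0 z) * r i x.
exists W, i0, g; split => //.
- by move=> x /WO[].
- move=> i x Wx B'x y Wy; have [_ /(_ i)[_ [h _]]] := WO _ Wy; apply: h.
  by apply: contrapT => ncq; have [_ /(_ i)[_ [_ /(_ ncq)]]] := WO _ Wx.
move=> i x WB Wx.
have rW y : W y -> r i y ^+ k = n i y /\ {for y, continuous (r i)}.
  by move=> Wy; have [_ /(_ i)[h _]] := WO _ Wy; apply: h; exact: WB.
have WB0 y : W y -> B i0 y by move=> /WO[].
have n0 y : W y -> n i y != 0.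
  by move=> Wy; rewrite mulf_neq0 ?invr_eq0 // f0 //; apply: Bb; [exact: WB|exact: WB0].
have r0 y : W y -> r i y != 0.
  by move=> Wy; have := n0 y Wy; rewrite -(rW y Wy).1 expf_eq0 k0.
have sE j y : B j y -> P y -> s j y ^+ k = f (b j) y.
  by move=> By Py; case: (nbhs_singleton (sP By Py)).
pose c y := s i y / (r i y * s i0 y).
have ck y : W y -> P y -> c y ^+ k = 1.
  move=> Wy Py; rewrite expr_div_n exprMn (rW y Wy).1 (sE _ _ (WB _ Wy) Py) (sE _ _ (WB0 _ Wy) Py).
  by rewrite /n divfK ?mulfV // f0 //; apply: Bb; [exact: WB|exact: WB0].
have cc y : W y -> P y -> {for y, continuous c}.
  move=> Wy Py.
  apply: (@eq_near_continuous (fun w => (s i w / s i0 w) * (r i w)^-1)).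
    by apply: filterE => w; rewrite /c invfM mulrA mulrAC.
  apply: cvgM; first apply: (flat_ratio Py (Bb (WB _ Wy)) (Bb (WB0 _ Wy))).
  - by apply: sP; [exact: WB|].
  - by apply: sP; [exact: WB0|].
  - by apply: cvgV; [exact: r0|exact: (rW y Wy).2].
have cE y : W y -> P y -> c y = c z.
  move=> Wy Py; apply: (connected_locally_const (P := fun w => c w = c z) cWP _
    (conj Wz Pz) (conj Wy Py)) => // w [Ww Pw].
  have ck1 : \forall w' \near w, c w' ^+ k = 1.
    by apply: filterS2 (near_open oW Ww) (near_open oP Pw).
  by apply: filterS (pow1_near_const k0 (cc w Ww Pw) ck1) => w' ->.
split.
- apply: cvgM; first exact: cst_continuous.
  exact: (rW x Wx).2.
- by rewrite /g exprMn -/(c z) ck // mul1r (rW x Wx).1.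
move=> Px; rewrite /g -/(c z) -(cE x Wx Px) /c.
by field; rewrite r0 // s0 //; exact: WB0.
Qed.
End Cocycle.

(** The frames of the extended bundle. Over [P] these are the given ones;
    outside [P] they are defined through the extended transition functions, on a
    neighbourhood of [Sig] so small that the finitely many choices made
    are compatible. *)
Lemma extend_frames : exists (I : Type) (V : I -> set X) (b : I -> IF) (s : I -> X -> K),
  [/\ forall i, open (V i), forall i, V i `<=` Df (b i), Sig `<=` \bigcup_i V i &
  [/\ forall i x, V i x -> s i x ^+ k = f (b i) x,
      forall i a x, V i x -> De a x -> {for x, continuous (fun y => s i y / e a y)} &
      forall i j x, V i x -> V j x -> {for x, continuous (fun y => s i y / s j y)}]].
Proof.
have [[p0 Sp0]|noS] := pselect (exists p, Sig p); last first.
  exists void, (@of_void _), (@of_void _), (@of_void _); split=> [[]|[]|x Sx|]; last by split=> [[]|[]|[]].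
  by case: noS; exists x.
have [b0 [_ [_ _]]] := frame_exists Sp0.
have /choice[t1 t1P] : forall p, exists t : IF * set X * set X * (X -> K), Sig p ->
   [/\ open t.1.1.2, open t.1.2, t.1.2 p, closure t.1.2 `<=` t.1.1.2 & t.1.1.2 `<=` Df t.1.1.1 /\
    forall x, t.1.1.2 x -> P x -> flat t.1.1.1 t.2 x].
  move=> p; have [Sp|nS] := pselect (Sig p); last by exists (b0, setT, setT, fun=> 0).
  have [b [B [s [oB Bp Bb sP]]]] := frame_exists Sp.
  have [B' [oB' B'p B'B]] := reg Sp (near_open oB Bp).
  by exists (b, B, B', s).
have [I [c [cS' cov]]] := @finite_subcover (fun p => (t1 p).1.2) (fun p Sp => 
  let: And5 _ oB' B'p _ _ := t1P p Sp in conj oB' B'p).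
pose B i := (t1 (c i)).1.1.2; pose B' i := (t1 (c i)).1.2.
pose b i := (t1 (c i)).1.1.1; pose s i := (t1 (c i)).2.
have oB i : open (B i) by have [] := t1P _ (cS' i).
have oB' i : open (B' i) by have [] := t1P _ (cS' i).
have B'B i : closure (B' i) `<=` B i by have [] := t1P _ (cS' i).
have Bb i : B i `<=` Df (b i) by have [_ _ _ _ []] := t1P _ (cS' i).
have sP i x : B i x -> P x -> flat (b i) (s i) x.
  by have [_ _ _ _ [_]] := t1P _ (cS' i); apply.
have [j0 _] := cov _ Sp0.
have sE i x : B i x -> P x -> s i x ^+ k = f (b i) x.
  by move=> Bx Px; case: (nbhs_singleton (sP i x Bx Px)).
have s0 i x : B i x -> P x -> s i x != 0.
  by move=> Bx Px; have := f0 (Bb _ _ Bx); rewrite -(sE _ _ Bx Px) expf_eq0 k0.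
pose good (W : set X) (i0 : I) (g : I -> X -> K) := [/\ W `<=` B i0,
   forall i x, W x -> B' i x -> W `<=` B i &
   forall i x, W `<=` B i -> W x -> [/\ {for x, continuous (g i)},
     g i x ^+ k = f (b i) x / f (b i0) x & P x -> g i x = s i x / s i0 x]].
have /choice[t2 t2P] : forall q, exists t : set X * set X * I * (I -> X -> K), Sig q ->
   [/\ open t.1.1.1, open t.1.1.2, t.1.1.2 q, closure t.1.1.2 `<=` t.1.1.1 & good t.1.1.1 t.1.2 t.2].
  move=> q; have [Sq|nS] := pselect (Sig q); last by exists (setT, setT, j0, fun _ _ => 0).
  have [W [i0 [g [oW Wq W0 W1 gP]]]] := transition_extend oB B'B Bb sP cov Sq.
  have [W' [oW' W'q W'W]] := reg Sq (near_open oW Wq).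
  by exists (W, W', i0, g).
have [L [d [dS' cov2]]] := @finite_subcover (fun q => (t2 q).1.1.2) (fun p Sp => 
  let: And5 _ oB' B'p _ _ := t2P p Sp in conj oB' B'p).
pose W l := (t2 (d l)).1.1.1; pose W' l := (t2 (d l)).1.1.2.
pose i0 l := (t2 (d l)).1.2; pose g l := (t2 (d l)).2.
have oW l : open (W l) by have [] := t2P _ (dS' l).
have oW' l : open (W' l) by have [] := t2P _ (dS' l).
have W'W l : closure (W' l) `<=` W l by have [] := t2P _ (dS' l).
have gd l : good (W l) (i0 l) (g l) by have [] := t2P _ (dS' l).
have WB l i x : W l x -> B' i x -> W l `<=` B i by have [_ h _] := gd l; exact: h.
have gP l i x : W l `<=` B i -> W l x -> [/\ {for x, continuous (g l i)},
     g l i x ^+ k = f (b i) x / f (b (i0 l)) x & P x -> g l i x = s i x / s (i0 l) x].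
  by have [_ _ h] := gd l; exact: h.
have WB0 l : W l `<=` B (i0 l) by have [] := gd l.
have [l0 _] := cov2 _ Sp0.
have WW' l : W' l `<=` W l by move=> x /subset_closure/W'W.
have B'B' i : B' i `<=` B i by move=> x /subset_closure/B'B.
have g0 l i x : W l `<=` B i -> W l x -> g l i x != 0.
  move=> WBi Wx; have [_ gk _] := gP l i x WBi Wx.
  have : g l i x ^+ k != 0.
    by rewrite gk mulf_neq0 ?invr_eq0 // f0 //; apply: Bb; [exact: WBi|exact: WB0].
  by rewrite expf_eq0 k0.
(* Two choices of the extended transition functions agree at the points of [Sig],
   by continuity from above, hence near [Sig]. *)
pose agree l l' i j x := W' l x -> W' l' x -> B' i x -> B' j x ->
  g l i x / g l j x = g l' i x / g l' j x.
have near_agree p : Sig p -> \forall x \near p, forall l l' i j, agree l l' i j x.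
  move=> Sp.
  apply: (@filter_forall _ _ (fun l x => forall l' i j, agree l l' i j x) (nbhs p)) => l.
  apply: (@filter_forall _ _ (fun l' x => forall i j, agree l l' i j x) (nbhs p)) => l'.
  apply: (@filter_forall _ _ (fun i x => forall j, agree l l' i j x) (nbhs p)) => i.
  apply: (@filter_forall _ _ (fun j x => agree l l' i j x) (nbhs p)) => j.
  have out (A : set X) : ~ closure A p -> \forall x \near p, ~ A x.
    move=> nA; have := near_open (closed_openC (@closed_closure _ A)) nA.
    by apply: filterS => x nx /subset_closure.
  have [cl|/out] := pselect (closure (W' l) p); last by apply: filterS => x nx /nx.
  have [cl'|/out] := pselect (closure (W' l') p); last by apply: filterS => x nx _ /nx.
  have [ci|/out] := pselect (closure (B' i) p); last by apply: filterS => x nx _ _ /nx.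
  have [cj|/out] := pselect (closure (B' j) p); last by apply: filterS => x nx _ _ _ /nx.
  have meetB m h : closure (B' h) p -> W m p -> W m `<=` B h.
    move=> ch Wm; have [x [B'x Wx]] := ch _ (near_open (oW m) Wm).
    exact: WB Wx B'x.
  have [Wl Wl'] := (W'W _ _ cl, W'W _ _ cl').
  have [mli mlj] := (meetB _ _ ci Wl, meetB _ _ cj Wl).
  have [mli' mlj'] := (meetB _ _ ci Wl', meetB _ _ cj Wl').
  pose q x := (g l i x / g l j x) / (g l' i x / g l' j x).
  have q0 x : W l x -> W l' x -> [/\ g l i x != 0, g l j x != 0, g l' i x != 0 & g l' j x != 0].
    by move=> Wx W'x; split; apply: g0.
  have cq : {for p, continuous q}.
    have [ci1 _ _] := gP _ _ _ mli Wl; have [cj1 _ _] := gP _ _ _ mlj Wl.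
    have [ci2 _ _] := gP _ _ _ mli' Wl'; have [cj2 _ _] := gP _ _ _ mlj' Wl'.
    have [n1 n2 n3 n4] := q0 p Wl Wl'.
    apply: cvgM; first by apply: cvgM => //; apply: cvgV.
    apply: cvgV; first by rewrite mulf_neq0 // invr_eq0.
    by apply: cvgM => //; apply: cvgV.
  have qk : \forall x \near p, q x ^+ k = 1.
    apply: filterS2 (near_open (oW l) Wl) (near_open (oW l') Wl') => x Wx W'x.
    have [_ k1 _] := gP _ _ _ mli Wx; have [_ k2 _] := gP _ _ _ mlj Wx.
    have [_ k3 _] := gP _ _ _ mli' W'x; have [_ k4 _] := gP _ _ _ mlj' W'x.
    rewrite /q !expr_div_n k1 k2 k3 k4.
    have Fi : f (b i) x != 0 by apply: f0; apply: Bb; exact: mli.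
    have Fj : f (b j) x != 0 by apply: f0; apply: Bb; exact: mlj.
    have F1 : f (b (i0 l)) x != 0 by apply: f0; apply: Bb; exact: WB0.
    have F2 : f (b (i0 l')) x != 0 by apply: f0; apply: Bb; exact: WB0.
    by field; rewrite ?Fi ?Fj ?F1 ?F2.
  have qc := pow1_near_const k0 cq qk.
  have nW : \forall x \near p, [/\ W l x, W l' x & q x = q p].
    by apply: filterS3 (near_open (oW l) Wl) (near_open (oW l') Wl') qc.
  have [V [_ _ VW [[z [Vz Pz]] _ _]]] := tameS Sp nW.
  have qp : q p = 1.
    have [Wz W'z <-] := VW _ Vz; rewrite /q.
    have [_ _ ->] := gP _ _ _ mli Wz => //; have [_ _ ->] := gP _ _ _ mlj Wz => //.
    have [_ _ ->] := gP _ _ _ mli' W'z => //; have [_ _ ->] := gP _ _ _ mlj' W'z => //.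
    have Si : s i z != 0 by apply: s0 => //; exact: mli.
    have Sj : s j z != 0 by apply: s0 => //; exact: mlj.
    have S1 : s (i0 l) z != 0 by apply: s0 => //; exact: WB0.
    have S2 : s (i0 l') z != 0 by apply: s0 => //; exact: WB0.
    by field; rewrite ?Si ?Sj ?S1 ?S2.
  apply: filterS nW => x [Wx W'x]; rewrite qp /q => qx _ _ _ _.
  have [n1 n2 n3 n4] := q0 x Wx W'x.
  by apply: (mulIf (_ : (g l' i x / g l' j x)^-1 != 0));
    rewrite ?qx ?mulfV // ?invr_eq0 mulf_neq0 // invr_eq0.
have [w wP] : exists w : L -> X -> K, forall l x, w l x ^+ k = f (b (i0 l)) x.
  have /choice[w wP] : forall lx : L * X, exists z, z ^+ k = f (b (i0 lx.1)) lx.2.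
    by move=> lx; exact: root_exists.
  by exists (fun l x => w (l, x)) => l x; exact: wP (l, x).
(* Outside [P] only the ratios of frames are determined; the index [lev x] and the
   root [w] of the frame of index [lev x] fix the frames themselves. *)
pose lev x := if pselect (exists l, W' l x) is left h then sval (cid h) else l0.
have levP x : (exists l, W' l x) -> W' (lev x) x.
  by move=> h; rewrite /lev; case: pselect => // h'; exact: svalP (cid h').
pose sg i x := if pselect (P x) then s i x else g (lev x) i x * w (lev x) x.
pose V i := interior [set x | [/\ B' i x, exists l, W' l x & forall l l' i j, agree l l' i j x]].
have VP i x : V i x -> [/\ B' i x, exists l, W' l x & forall l l' i j, agree l l' i j x].
  by move=> /interior_subset.
have sgP i x : B' i x -> (exists l, W' l x) -> sg i x ^+ k = f (b i) x.
  move=> B'x Wx; rewrite /sg; case: pselect => Px; first exact: sE (B'B' _ _ B'x) Px.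
  have WWx := WW' _ _ (levP x Wx).
  have [_ gk _] := gP _ _ _ (WB _ _ _ WWx B'x) WWx.
  by rewrite exprMn gk wP divfK // f0 //; apply: Bb; exact: WB0.
exists I, V, b, sg; split.
- by move=> i; exact: open_interior.
- by move=> i x /VP[/B'B'/Bb].
- move=> p Sp; have [i ip] := cov _ Sp; have [l lp] := cov2 _ Sp; exists i => //.
  apply: filterS3 (near_open (oB' i) ip) (near_open (oW' l) lp) (near_agree p Sp).
  by move=> x B'x W'x ag; split => //; exists l.
split.
- by move=> i x /VP[B'x Wx _]; exact: sgP.
- move=> i a x /VP[B'x _ _] ax.
  have Px : P x by rewrite -De_cover; exists a.
  apply: (@eq_near_continuous (fun y => s i y / e a y)).
    by apply: filterS (near_open oP Px) => y Py; rewrite /sg; case: pselect.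
  by have [_] := nbhs_singleton (sP _ _ (B'B' _ _ B'x) Px); apply.
move=> i j x Vi Vj; have [B'i [l W'l] _] := VP _ _ Vi; have [B'j _ _] := VP _ _ Vj.
have Wl := WW' _ _ W'l.
have [WBi WBj] := (WB _ _ _ Wl B'i, WB _ _ _ Wl B'j).
apply: (@eq_near_continuous (fun y => g l i y / g l j y)); last first.
  have [ci _ _] := gP _ _ _ WBi Wl; have [cj _ _] := gP _ _ _ WBj Wl.
  by apply: cvgM => //; apply: cvgV => //; exact: g0.
apply: filterS3 Vi Vj (near_open (oW' l) W'l) => y [Biy Wy ag] [Bjy _ _] Wly.
rewrite /sg; case: pselect => Py /=.
  have [_ _ ->] := gP _ _ _ WBi (WW' _ _ Wly) => //; have [_ _ ->] := gP _ _ _ WBj (WW' _ _ Wly) => //.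
  have Sj : s j y != 0 by apply: s0 => //; exact: B'B'.
  have S1 : s (i0 l) y != 0 by apply: s0 => //; apply: WB0; exact: WW'.
  by field; rewrite ?Sj ?S1.
have w0 : w (lev y) y != 0.
  have : w (lev y) y ^+ k != 0.
    by rewrite wP f0 //; apply: Bb; apply: WB0; apply: WW'; exact: levP.
  by rewrite expf_eq0 k0.
rewrite invfM mulrACA divff // mulr1.
exact: ag (levP y Wy) Wly Biy Bjy.
Qed.
End Gluing.

(** * Scalar description of line bundles *)

Section Holomorphic.
Variables (R : realType) (n : nat) (X : complex_manifold R n).
Implicit Types (S : set X) (g h : X -> C R).

Lemma hol_continuous S g x : holomorphic_on S g -> S x -> {for x, continuous g}.
Proof.
move=> hg Sx; have [i ix] := cm_cover x; set c := cm_chart i in ix.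
have dg := hg i (c x) (ex_intro2 _ _ x (conj ix Sx) erefl).
have cg := differentiable_continuous dg.
apply: (@eq_near_continuous _ _ ((g \o chart_inv c) \o c)).
  by apply: filterS (near_open (@chart_dom_open _ _ _ c) ix) => y cy /=; rewrite chart_mapK.
apply: continuous_comp; [exact: chart_continuous_at|exact: cg].
Qed.

Lemma near_chart_inv (i : cm_index X) x (Q : X -> Prop) : chart_dom (cm_chart i) x ->
  (\forall y \near x, Q y) -> \forall w \near cm_chart i x, Q (chart_inv (cm_chart i) w).
Proof.
move=> ix Qx; have := @chart_inv_continuous_at _ _ _ (cm_chart i) (cm_chart i x).
move=> /(_ (ex_intro2 _ _ x ix erefl)) ci; apply: ci.
by rewrite chart_mapK.
Qed.

Lemma hol_ext S g h : open S -> (forall x, S x -> g x = h x) ->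
  holomorphic_on S h -> holomorphic_on S g.
Proof.
move=> oS gh hh i z Sz; have dh := hh i z Sz; move: Sz => [x [ix Sx] xz].
apply: (near_eq_differentiable _ dh); rewrite -xz.
apply: (near_chart_inv (Q := fun y => h y = g y)) => //.
by apply: filterS (near_open oS Sx) => y /gh.
Qed.

Lemma hol_inv S g : (forall x, S x -> g x != 0) -> holomorphic_on S g ->
  holomorphic_on S (fun x => (g x)^-1).
Proof.
move=> g0 hg i z Sz; have dg := hg i z Sz; move: Sz => [x [ix Sx] xz].
apply: (differentiableV dg); rewrite /= -xz chart_mapK //; exact: g0.
Qed.

(** In a chart this is [differentiable_root]: holomorphy of the glued frames comes
    for free from their continuity. *)
Lemma hol_root (k : nat) S g h : (0 < k)%N -> open S ->
  (forall x, S x -> g x != 0) -> (forall x, S x -> {for x, continuous g}) ->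
  (forall x, S x -> g x ^+ k = h x) -> holomorphic_on S h -> holomorphic_on S g.
Proof.
move=> k0 oS g0 cg gk hh i z Sz; have dh := hh i z Sz; move: Sz => [x [ix Sx] xz].
apply: (differentiable_root k0 _ _ _ dh).
- by rewrite /= -xz chart_mapK //; exact: g0.
- rewrite -xz; apply: continuous_comp.
    by apply: chart_inv_continuous_at; exists x.
  by rewrite chart_mapK //; exact: cg.
- rewrite -xz; apply: (near_chart_inv (Q := fun y => g y ^+ k = h y)) => //.
  by apply: filterS (near_open oS Sx).
Qed.
End Holomorphic.

Section Frames.
Variables (R : realType) (n : nat) (X : complex_manifold R n).
Local Notation K := (C R).
Local Notation "'Lin' V" := ('Hom(V, K^o)) (at level 10).

Lemma line_inv (V : vectType K) (s : 'Hom(V, K^o)) : bijective s -> exists v, s v = 1.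
Proof. by move=> [s' _ sK]; exists (s' 1). Qed.

Lemma line_coef (V : vectType K) (s t : 'Hom(V, K^o)) (v : V) : bijective s -> s v = 1 ->
  t = t v *: s.
Proof.
move=> bs sv; apply/lfunP => w; rewrite scale_lfunE.
have -> : w = s w *: v.
  by apply: (bij_inj bs); rewrite linearZ /= sv /GRing.scale /= mulr1.
by rewrite !linearZ /= sv /GRing.scale /= mulr1 mulrC.
Qed.

Lemma line_neq0 (V : vectType K) (s : 'Hom(V, K^o)) (v : V) : bijective s -> (s v != 0) = (v != 0).
Proof.
move=> bs; congr (~~ _); apply/eqP/eqP => [sv|->]; last exact: linear0.
by apply: (bij_inj bs); rewrite sv linear0.
Qed.

Definition line_map (V : vectType K) (v : V) : 'Hom(K^o, V) :=
  linfun (fun c : K^o => c *: v).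

Lemma line_mapE (V : vectType K) (v : V) c : line_map v c = c *: v.
Proof.
have lin : linear (fun c : K^o => c *: v).
  by move=> a x y; rewrite scalerDl scalerA.
pose L := GRing.isLinear.Build _ _ _ _ (fun c : K^o => c *: v) lin.
pose f : {linear _ -> _} := HB.pack (fun c : K^o => c *: v) L.
exact: (lfunE f).
Qed.

Lemma line_map_bij (V : vectType K) (s : 'Hom(V, K^o)) (v : V) : bijective s -> v != 0 ->
  bijective (line_map v).
Proof.
move=> bs; rewrite -(line_neq0 _ bs) => sv; exists (fun w => s w / s v) => [c|w].
  by rewrite line_mapE linearZ /= mulfK.
rewrite line_mapE; apply: (bij_inj bs).
by rewrite linearZ /= /GRing.scale /= divfK.
Qed.

Section Power.
Variables (G : set X) (F : line_bundle G) (th : forall x, 'Hom(F x, K^o)).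

Fixpoint frame_pow k x : 'Hom(lb_power k F x, K^o) :=
  match k return 'Hom(lb_power k F x, K^o) with
  | 0 => (\1%VF : 'Hom(K^o, K^o))
  | k'.+1 => @tensor_triv _ _ _ _ F (lb_power k' F) x (th x) (frame_pow k' x)
  end.

Lemma frame_pow_bij k x : bijective (th x) -> bijective (frame_pow k x).
Proof.
move=> bx; elim: k => [|k IH] /=; first by exists id => v; rewrite id_lfunE.
exact: tensor_triv_bij.
Qed.

Lemma tensor_trivZ (E E' : line_bundle G) x (s : 'Hom(E x, K^o)) (t : 'Hom(E' x, K^o)) (a b : K) :
  tensor_triv (a *: s) (b *: t) = (a * b) *: tensor_triv s t.
Proof.
apply/lfunP => T; rewrite scale_lfunE !tensor_trivE scale_lfunE linearZ /= linearZ /=.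
by rewrite /GRing.scale /= mulrA [a * b]mulrC.
Qed.

Variable e : lb_index F -> X -> K.
Hypothesis eE : forall a x, lb_dom a x -> lb_triv a x = e a x *: th x.
Hypothesis e0 : forall a x, lb_dom a x -> e a x != 0.
Hypothesis ee : forall a b, holomorphic_on (lb_dom a `&` lb_dom b) (fun x => e a x / e b x).

(** Each factor of an index of the tensor power may be replaced by [a] at the cost
    of a holomorphic transition function, so a single trivialisation of the bundle
    controls those of its powers. *)
Lemma power_triv k (A : lb_index (lb_power k F)) a : exists2 g : X -> K,
  holomorphic_on (lb_dom A `&` lb_dom a) g &
  forall x, lb_dom A x -> lb_dom a x ->
    lb_triv A x = (g x * e a x ^+ k) *: frame_pow k x.
Proof.
elim: k A => [|k IH] /= A.
  exists (fun=> 1); first exact: holomorphic_on_cst.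
  by move=> x _ _; rewrite mul1r expr0 scale1r.
case: A => [a' A]; have [g hg gE] := IH A.
exists (fun x => e a' x / e a x * g x).
  apply: holomorphic_onM.
    by apply: holomorphic_onS (@ee a' a) => x [[]].
  by apply: holomorphic_onS hg => x [[]].
move=> x [a'x Ax] ax.
rewrite /= (eE a'x) gE // tensor_trivZ; congr (_ *: _).
rewrite exprS; field; exact: e0.
Qed.

Lemma power_dom k (a : lb_index F) : exists A : lb_index (lb_power k F), lb_dom a `<=` lb_dom A.
Proof.
elim: k => [|k [A aA]] /=; first by exists tt => x ax; rewrite -(lb_cover F); exists a.
by exists (a, A) => x ax; split => //=; exact: aA.
Qed.
End Power.

(** The vectors [v x] may vary discontinuously: they cancel in the quotients, which
    are the transition functions. *)
Lemma scalar_frames (G : set X) (F : line_bundle G) (v : forall x, F x) :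
  (forall x, G x -> v x != 0) -> let e a x : K := lb_triv a x (v x) in
  (forall a x, lb_dom a x -> e a x != 0) /\
  (forall a b, holomorphic_on (lb_dom a `&` lb_dom b) (fun x => e a x / e b x)).
Proof.
move=> v0 e.
have e0 a x : lb_dom a x -> e a x != 0.
  move=> ax; rewrite (line_neq0 _ (lb_triv_bij ax)); apply: v0.
  by rewrite -(lb_cover F); exists a.
split; first exact: e0.
move=> a b; have [g hg gE] := lb_transition b a.
apply: (@hol_ext _ _ _ _ _ g); first by apply: openI; exact: lb_dom_open.
  move=> x [ax bx]; rewrite /e gE // scale_lfunE /GRing.scale /= mulfK //.
  exact: e0.
by rewrite setIC.
Qed.

Lemma fibre_bases (G : set X) (F : line_bundle G) :
  exists (th : forall x, 'Hom(F x, K^o)) (v : forall x, F x),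
    forall x, G x -> bijective (th x) /\ th x (v x) = 1.
Proof.
have ex x : exists tv : 'Hom(F x, K^o) * F x, G x -> bijective tv.1 /\ tv.1 tv.2 = 1.
  have [Gx|nG] := pselect (G x); last by exists (0, 0).
  have := Gx; rewrite -{1}(lb_cover F) => -[a _ ax].
  by have [v v1] := line_inv (lb_triv_bij ax); exists (lb_triv a x, v) => _; split => //; exact: lb_triv_bij.
exists (fun x => (sval (cid (ex x))).1), (fun x => (sval (cid (ex x))).2) => x.
exact: (svalP (cid (ex x))).
Qed.

Lemma scalar_triv_bij (c : K) : c != 0 -> bijective (c *: \1%VF : 'Hom(K^o, K^o)).
Proof.
move=> c0; exists (fun w => w / c) => w; rewrite scale_lfunE id_lfunE /GRing.scale /=.
  by rewrite mulrC mulKf.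
by rewrite mulrC divfK.
Qed.

Section ScalarBundle.
Variables (G : set X) (J : Type) (D : J -> set X) (e : J -> X -> K).
Hypotheses (D_open : forall a, open (D a)) (D_cover : \bigcup_a D a = G).
Hypothesis e0 : forall a x, D a x -> e a x != 0.
Hypothesis ee : forall a b, holomorphic_on (D a `&` D b) (fun x => e a x / e b x).

Lemma scalar_bij a x : D a x -> bijective (e a x *: \1%VF : 'Hom(K^o, K^o)).
Proof. by move=> /e0; exact: scalar_triv_bij. Qed.

Lemma scalar_transition a b : exists2 g : X -> K,
  holomorphic_on (D a `&` D b) g &
  forall x, D a x -> D b x ->
    e b x *: \1%VF = g x *: (e a x *: \1%VF) :> 'Hom(K^o, K^o).
Proof.
exists (fun x => e b x / e a x); first by rewrite setIC.
by move=> x ax _; rewrite scalerA divfK // e0.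
Qed.

Definition scalar_bundle : line_bundle G :=
  @LineBundle R n X G (fun=> K^o) J D (fun a x => e a x *: \1%VF)
    D_open D_cover scalar_bij scalar_transition.
End ScalarBundle.
End Frames.

(** * Extension of roots *)

Section RootExtension.
Variables (R : realType) (n : nat) (X : complex_manifold R n) (k : nat).
Hypothesis k0 : (0 < k)%N.
Local Notation K := (C R).
Variables (P U Sig : set X) (F : line_bundle P) (N : line_bundle U).
Hypotheses (PU : P `<=` U) (SU : Sig `<=` U) (cS : compact Sig).
Hypothesis reg : forall p O, Sig p -> nbhs p O ->
  exists W, [/\ open W, W p & closure W `<=` O].
Hypothesis tameS : forall p O, Sig p -> nbhs p O -> exists W, [/\ open W, W p, W `<=` O
  & [/\ W `&` P !=set0, connected (W `&` P) & monodromy_free K (W `&` P)]].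

(** Over [P] the vector [w x] is the image of the [k]-th tensor power of [v x], so
    the isomorphism disappears from the comparison of the scalar frames. *)
Lemma compatible_bases : is_kth_root k F N ->
  exists (th : forall x, 'Hom(F x, K^o)) (v : forall x, F x) (w : forall x, N x),
  [/\ forall x, P x -> bijective (th x) /\ th x (v x) = 1,
      forall x, U x -> w x != 0 &
      forall a b, holomorphic_on (lb_dom a `&` lb_dom b)
        (fun x => lb_triv (l := N) b x (w x) / lb_triv (l := F) a x (v x) ^+ k)].
Proof.
move=> [hh [hbij hhol]].
have [th [v thP]] := fibre_bases F.
have [thN [wN wNP]] := fibre_bases N.
have wN0 x : U x -> wN x != 0.
  by move=> /wNP[bth th1]; rewrite -(line_neq0 _ bth) th1 oner_neq0.
have v0 x : P x -> v x != 0.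
  by move=> /thP[bth th1]; rewrite -(line_neq0 _ bth) th1 oner_neq0.
have [e0 ee] := scalar_frames v0.
have aP (a : lb_index F) x : lb_dom a x -> P x by move=> ax; rewrite -(lb_cover F); exists a.
have eE (a : lb_index F) x : lb_dom a x -> lb_triv a x = lb_triv a x (v x) *: th x.
  by move=> /aP/thP[bth th1]; exact: line_coef.
have ex x : exists u : lb_power k F x, P x -> frame_pow th k x u = 1.
  have [Px|nP] := pselect (P x); last by exists 0.
  by have [u u1] := line_inv (frame_pow_bij k (thP x Px).1); exists u.
pose u x := sval (cid (ex x)).
have u1 x : P x -> frame_pow th k x (u x) = 1 by exact: (svalP (cid (ex x))).
pose w x : N x := if pselect (P x) then hh x (u x) else wN x.
have wE x : P x -> w x = hh x (u x) by move=> Px; rewrite /w; case: pselect.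
have wE' x : ~ P x -> w x = wN x by move=> nP; rewrite /w; case: pselect.
exists th, v, w; split; first exact: thP.
  move=> x Ux; have [Px|nP] := pselect (P x); last by rewrite wE' //; exact: wN0.
  rewrite wE //; apply/eqP => h0; have := u1 x Px.
  have -> : u x = 0 by apply: (bij_inj (hbij x Px)); rewrite h0 linear0.
  by rewrite linear0 => /eqP; rewrite eq_sym oner_eq0.
move=> a b; have [A aA] := power_dom k a.
have [g hg gE] := hhol A b; have [g' hg' gE'] := power_triv eE e0 ee A a.
have oab : open (lb_dom a `&` lb_dom b) by apply: openI; exact: lb_dom_open.
apply: (@hol_ext _ _ _ _ _ (fun x => g x * g' x) oab).
  move=> x [ax bx]; have Px := aP _ _ ax; have Ax := aA _ ax.
  rewrite wE // -comp_lfunE gE // scale_lfunE gE' // scale_lfunE u1 //.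
  rewrite /GRing.scale /= mulr1 mulrA mulfK //.
  by rewrite expf_neq0 // e0.
apply: holomorphic_onM.
  by apply: holomorphic_onS hg => x [ax bx]; split; [exact: aP ax|split => //; exact: aA].
by apply: holomorphic_onS hg' => x [ax bx]; split => //; exact: aA.
Qed.

(** The extended bundle has all its fibres equal to the line [K]; its
    trivialisations are the scalar frames of [F] over [P] and those given by
    [extend_frames]. *)
Lemma kth_root_extension : is_kth_root k F N ->
  exists (V : set X) (Ft : line_bundle (P `|` V)),
    [/\ open V, Sig `<=` V, V `<=` U, lb_iso_on P Ft F & is_kth_root k Ft N].
Proof.
move=> hF; have [th [v [w [thP w0 fe]]]] := compatible_bases hF.
have v0 x : P x -> v x != 0.
  by move=> /thP[bth th1]; rewrite -(line_neq0 _ bth) th1 oner_neq0.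
have [e0 ee] := scalar_frames v0; have [f0 ff] := scalar_frames w0.
pose e (a : lb_index F) x : K := lb_triv a x (v x).
pose f (b : lb_index N) x : K := lb_triv b x (w x).
have {}e0 a x : lb_dom a x -> e a x != 0 by exact: e0.
have {}f0 c x : lb_dom c x -> f c x != 0 by exact: f0.
have oP : open P := lb_open F.
have [I [V [b [s [oV Vb SV [sk se ss]]]]]] := @extend_frames K X k k0 P U Sig oP SU cS
  (lb_index F) (lb_index N) (fun a => lb_dom a) (fun b => lb_dom b) e f
  (@lb_dom_open _ _ _ _ F) (lb_cover F) (@lb_dom_open _ _ _ _ N) (lb_cover N) e0 f0
  (fun a a' x ax a'x => hol_continuous (ee a a') (conj ax a'x))
  (fun a a' x ax a'x => hol_continuous (ff a a') (conj ax a'x))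
  (fun a c x ax cx => hol_continuous (fe a c) (conj ax cx)) reg tameS.
have aP (a : lb_index F) x : lb_dom a x -> P x by move=> ax; rewrite -(lb_cover F); exists a.
have s0 i x : V i x -> s i x != 0.
  by move=> Vx; have := f0 _ _ (Vb _ _ Vx); rewrite -(sk _ _ Vx) expf_eq0 k0.
pose J := (lb_index F + I)%type.
pose D (j : J) : set X := match j with inl a => lb_dom a | inr i => V i end.
pose t (j : J) : X -> K := match j with inl a => e a | inr i => s i end.
have oD j : open (D j) by case: j => [a|i] /=; [exact: lb_dom_open|exact: oV].
have t0 j x : D j x -> t j x != 0 by case: j => [a|i] /=; [exact: e0|exact: s0].
have hse i a : holomorphic_on (V i `&` lb_dom a) (fun x => s i x / e a x).
  have oS : open (V i `&` lb_dom a) by apply: openI; [exact: oV|exact: lb_dom_open].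
  apply: (@hol_root _ _ _ k _ _ (fun x => f (b i) x / e a x ^+ k) k0 oS).
  - by move=> x [Vx ax]; rewrite mulf_neq0 ?s0 // invr_eq0; exact: e0.
  - by move=> x [Vx ax]; exact: se.
  - by move=> x [Vx ax]; rewrite expr_div_n sk.
  - by apply: holomorphic_onS (fe a (b i)) => x [/Vb].
have tt j j' : holomorphic_on (D j `&` D j') (fun x => t j x / t j' x).
  case: j j' => [a|i] [a'|i'] /=.
  - exact: ee.
  - have oS : open (lb_dom a `&` V i') by apply: openI; [exact: lb_dom_open|exact: oV].
    apply: (@hol_ext _ _ _ _ _ (fun x => (s i' x / e a x)^-1) oS).
      by move=> x _; rewrite invf_div.
    apply: hol_inv; last by rewrite setIC; exact: hse.
    by move=> x [ax Vx]; rewrite mulf_neq0 ?s0 // invr_eq0; exact: e0.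
  - exact: hse.
  - have oS : open (V i `&` V i') by apply: openI; exact: oV.
    apply: (@hol_root _ _ _ k _ _ (fun x => f (b i) x / f (b i') x) k0 oS).
    + by move=> x [Vx V'x]; rewrite mulf_neq0 ?s0 // invr_eq0 s0.
    + by move=> x [Vx V'x]; exact: ss.
    + by move=> x [Vx V'x]; rewrite expr_div_n !sk.
    + by apply: holomorphic_onS (ff (b i) (b i')) => x [/Vb ? /Vb].
have ft c j : holomorphic_on (D j `&` lb_dom c) (fun x => f c x / t j x ^+ k).
  case: j => [a|i] /=; first exact: fe.
  have oS : open (V i `&` lb_dom c) by apply: openI; [exact: oV|exact: lb_dom_open].
  apply: (@hol_ext _ _ _ _ _ (fun x => f c x / f (b i) x) oS).
    by move=> x [Vx _]; rewrite sk.
  by apply: holomorphic_onS (ff c (b i)) => x [/Vb ? ?].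
pose W := \bigcup_i V i.
have Dcov : \bigcup_j D j = P `|` W.
  apply/seteqP; split=> [x [[a|i] _ jx]|x [Px|[i _ ix]]].
  - by left; exact: aP jx.
  - by right; exists i.
  - by move: Px; rewrite -{1}(lb_cover F) => -[a _ ax]; exists (inl a).
  - by exists (inr i).
have WU : W `<=` U.
  by move=> x [i _ /Vb bx]; rewrite -(lb_cover N); exists (b i).
pose Ft := scalar_bundle oD Dcov t0 tt.
exists W, Ft; split => //.
- by apply: bigcup_open => i _; exact: oV.
- exists (fun x => line_map (v x)); split=> [x Px|j a].
    exact: line_map_bij (thP x Px).1 (v0 x Px).
  exists (fun x => e a x / t j x).
    by apply: holomorphic_onS (tt (inl a) j) => x [_ [? ?]].
  move=> x Px jx ax; apply/lfunP => c.
  rewrite comp_lfunE line_mapE linearZ /= !scale_lfunE id_lfunE.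
  by rewrite /GRing.scale /= mulrA divfK ?t0 // mulrC.
pose id1 x : 'Hom(Ft x, K^o) := \1%VF.
have id1b x : bijective (id1 x) by exists id => y; rewrite id_lfunE.
have tE (j : lb_index Ft) x : lb_dom j x -> lb_triv j x = t j x *: id1 x by [].
exists (fun x => line_map (w x) \o frame_pow id1 k x)%VF; split=> [x PWx|].
  have Ux : U x by case: PWx => [/PU|/WU].
  have := Ux; rewrite -{1}(lb_cover N) => -[c _ cx].
  have bw := line_map_bij (lb_triv_bij cx) (w0 x Ux).
  have bf := frame_pow_bij k (id1b x).
  apply: (eq_bij (bij_comp bw bf)) => y.
  by rewrite comp_lfunE.
have powE (A : lb_index (lb_power k Ft)) j := power_triv tE t0 tt A j.
have fpb x := frame_pow_bij k (id1b x).
have main (j : lb_index Ft) (A : lb_index (lb_power k Ft)) (c : lb_index N) : lb_dom A `<=` lb_dom j ->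
  exists2 g : X -> K, holomorphic_on ((P `|` W) `&` (lb_dom A `&` lb_dom c)) g &
  forall x, (P `|` W) x -> lb_dom A x -> lb_dom c x ->
   (lb_triv c x \o (line_map (w x) \o frame_pow id1 k x))%VF = g x *: lb_triv A x.
  move=> Aj; have [g hg gE] := powE A j.
  have g0 x : lb_dom A x -> g x != 0.
    move=> Ax; have jx := Aj _ Ax; have [y y1] := line_inv (fpb x).
    have : lb_triv A x y != 0.
      rewrite (line_neq0 _ (lb_triv_bij Ax)); rewrite -(line_neq0 _ (fpb x)) y1.
      exact: oner_neq0.
    by rewrite gE // scale_lfunE /GRing.scale /= y1 mulr1 mulf_eq0 negb_or => /andP[].
  exists (fun x => (f c x / t j x ^+ k) * (g x)^-1).
    apply: holomorphic_onM.
      by apply: holomorphic_onS (ft c j) => x [_ [/Aj ? ?]].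
    apply: hol_inv; first by move=> x [_ [Ax _]]; exact: g0.
    by apply: holomorphic_onS hg => x [_ [Ax _]]; split => //; exact: Aj.
  move=> x _ Ax cx; have jx := Aj _ Ax; apply/lfunP => y.
  rewrite !comp_lfunE line_mapE linearZ /= gE // !scale_lfunE /GRing.scale /=.
  rewrite -/(f c x) mulrC mulrA; congr (_ * _).
  have gx := g0 x Ax; have tx := t0 j x jx.
  by field; rewrite gx expf_neq0.
(* As [k] is positive, the first factor of the index [A] is a trivialisation of
   the bundle over the whole domain of [A]. *)
move=> A c; case: k k0 A main {sk ft powE fpb hF fe} => // k' _ A main.
by apply: (main A.1 A c) => x [].
Qed.
End RootExtension.

Theorem theorem1 (R : realType) (n : nat) (hn : (2 <= n)%N)
    (X : complex_manifold R n) (U : set X) (hU : is_domain U)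
    (rho : X -> R) (hsmooth : smooth_fun rho U) (hpsh : strictly_psh rho U)
    (hmorse : morse_fun rho U) (t0 : R)
    (hconn : connected (level_set U rho t0))
    (hcomp : compact (level_set U rho t0))
    (hcrit :
      (forall x, level_set U rho t0 x -> ~ critical_point rho x) \/
      (exists! c, level_set U rho t0 c /\ critical_point rho c))
    (N : line_bundle U) (k : nat) (hk : (0 < k)%N)
    (F : line_bundle (superlevel_set U rho t0)) (hF : is_kth_root k F N)
    (hcases :
      (* (a) *)
      (forall x, level_set U rho t0 x -> ~ critical_point rho x) \/
      (* (b) *)
      (3 <= n)%N \/
      (* (c) *)
      (n = 2%N /\ forall c, level_set U rho t0 c -> critical_point rho c ->
                    morse_index rho c <> 2%N)) :
  exists (V : set X) (Ft : line_bundle (superlevel_set U rho t0 `|` V)),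
    [/\ open V, level_set U rho t0 `<=` V, V `<=` U,
        lb_iso_on (superlevel_set U rho t0) Ft F &
        is_kth_root k Ft N].
Proof.
have oU : open U by case: hU.
have oP := lb_open F.
set P := superlevel_set U rho t0 in F hF oP *; set Sig := level_set U rho t0 in hconn hcomp hcrit hcases *.
have PU : P `<=` U by move=> x [].
have SU : Sig `<=` U by move=> x [].
have tameS p O : Sig p -> nbhs p O -> exists W, [/\ open W, W p, W `<=` O & tame U rho t0 W].
  move=> Sp pO; have [Up pt0] := Sp.
  suff [W [? ? ? _ ?]] : exists W, [/\ open W, W p, W `<=` O, W `<=` U & tame U rho t0 W].
    by exists W.
  have [crit|ncrit] := pselect (critical_point rho p); last first.
    exact: (regular_tame oU oP hsmooth Up pt0 ncrit).
  apply: (critical_tame oU oP hsmooth hn hpsh hmorse Up pt0 crit _ pO).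
  case: hcases => [/(_ p Sp)//|[n3|[_ idx]]]; first by left.
  by right; exact: idx.
apply: (kth_root_extension hk PU SU hcomp _ tameS hF).
by move=> p O Sp pO; exact: (manifold_regular oU (SU _ Sp) pO).
Qed.
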